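(* Let $g=hq$ where $h\in\{8,16\}$ and $q$ is a positive integer not divisible by $3$. Suppose there exists a 10-GDD of type $q^{10}$, and suppose that for each $v\in\{6,9,12,15,18\}$ and every positive integer $d\le g-3$ with $d\equiv g/4\pmod 3$ and $d\le (g/4)(v-1)/2$ there exists a 4-GDD of type $(g/4)^v d^1$. Then there exists a 4-GDD of type $g^u m^1$ for all integers $u\ge 6$ and $m\ge 1$ with $u\equiv 0\pmod 3$, $m\equiv g\pmod 3$ and $m\le g(u-1)/2$.
   Context: For a set $K$ of positive integers, a $K$-GDD (group divisible design) is a triple $(V,\mathcal G,\mathcal B)$ where $V$ is a finite set, $\mathcal G$ is a partition of $V$ into subsets called groups, $\mathcal B$ is a nonempty collection of subsets of $V$ (blocks) with sizes in $K$, such that every pair of points from distinct groups lies in exactly one block and no pair of points from the same group lies in any block. A $k$-GDD means a $\{k\}$-GDD. The type $g_1^{u_1}\cdots g_r^{u_r}$ means exactly $u_i$ groups of size $g_i$ for each $i$; type $g^u m^1$ means $u$ groups of size $g$ and one group of size $m$ (if $m=g$ this is type $g^{u+1}$). *)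

(* Defs.v *)
From mathcomp Require Import all_boot.
Set Implicit Arguments. Unset Strict Implicit. Unset Printing Implicit Defensive.

Definition is_GDD (T : finType) (K : pred nat) (G B : {set {set T}}) : Prop :=
  [/\ partition G [set: T],
      B != set0,
      (forall b, b \in B -> #|b| \in K) &
      (forall x y : T, x != y ->
         if pblock G x == pblock G y
         then (forall b, b \in B -> ~~ ((x \in b) && (y \in b)))
         else #|[set b in B | (x \in b) && (y \in b)]| = 1)].

(* There exists a K-GDD whose multiset of group sizes is [ty]
   (e.g. type g^u m^1 is  nseq u g ++ [:: m]). *)
Definition GDD_exists (K : pred nat) (ty : seq nat) : Prop :=
  exists (n : nat) (G B : {set {set 'I_n}}),
    is_GDD K G B /\ perm_eq (map (fun A : {set 'I_n} => #|A|) (enum G)) ty.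

(* Main.v *)
From Stdlib Require Import BinNat Nnat.
Require Import Defs.
From mathcomp Require Import all_boot all_algebra all_field.
From mathcomp Require Import zify.
Set Implicit Arguments. Unset Strict Implicit. Unset Printing Implicit Defensive.

(** Write g = 8 e q and u = 3 a. For m >= g one first builds, by Wilson's constructions, a
4-GDD of type (24 e q w)^v M^1 with v w = a, and then fills its groups with the
designs of type g^(3 w) m'^1; w = 1 uses the transversal design g^4. Large values of M need all
blocks to meet the last group: they come from 4-GDDs of type 6^n (3(n-1))^1, obtained
from frames for all n >= 4, which are combined, along a resolvable transversal design with
groups indexed by n, with small designs of type 6^4 w^1 and 6^8 w^1 in the other direction.
If 3 divides a, the top third of the range also follows by filling a transversal design with
three groups. For m < g one decomposes holey designs on g^u into blocks and copies of complete
multipartite graphs of type (g/4)^v, which the hypothesis fills together with the m new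
points. The finitely many small ingredients are given by base blocks under a cyclic group. *)

(** A design is treated as a decomposition of the edges of a relation into 4-sets, with groups given
    by a colouring: gluing is then a splitting of the edges, and only the sizes of colour classes
    matter. The 10-GDD enters as an orthogonal array with ten columns, which scales by q any design
    with at most nine groups and a last group of varying size. With m = g + 3t the target is t <=
    4eq(a - 1). A master design with vw = a contributes at most 4eqw(v - 1), its fillings at most
    4eq(w - 1), and the sum is exactly the target. There is no slack, so masters with a last group
    of maximal size are indispensable; this is why the types 6^n (3(n-1))^1 matter. They amount to
    3-GDDs of type 6^n resolved into parallel classes, one class per point of the last group. The
    obstacle is that MacNeish's product has few columns for orders divisible by 2 or 3 exactly once,
    and that type 6^4 is missing. Hence the case distinctions on a modulo 3 and 4, the several base
    sizes 6, 9, 12, 24, and the separate route to large t when 3 divides a. *)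

(** * Edge decompositions into 4-sets, up to isomorphism *)

Definition dec (T : finType) (e : rel T) : Prop :=
  exists B : {set {set T}},
    [/\ forall b, b \in B -> #|b| = 4,
        forall b x y, b \in B -> x \in b -> y \in b -> x != y -> e x y &
        forall x y, e x y -> exists2 b, b \in B & [/\ x \in b, y \in b &
          forall b', b' \in B -> x \in b' -> y \in b' -> b' = b]].

Lemma dec_eq (T : finType) (e e' : rel T) : e =2 e' -> dec e -> dec e'.
Proof.
move=> ee [B [B4 Be eB]]; exists B; split=> // [b x y|x y].
  by rewrite -ee; apply: Be.
by rewrite -ee; apply: eB.
Qed.

(** The common last step of all constructions below. A pair lying in a block of [B j] is an edge of
    class j, and an edge has only one class, so two blocks through it come from the same
    decomposition. *)
Lemma dec_union (T I : finType) (e : rel T) (f : I -> rel T) :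
  (forall x y, e x y -> x != y) ->
  (forall i x y, f i x y -> e x y) ->
  (forall x y, e x y -> exists2 i, f i x y & forall j, f j x y -> j = i) ->
  (forall i, dec (f i)) -> dec e.
Proof.
move=> eN fe ef /fin_all_exists [B HB]; exists (\bigcup_i B i); split.
- by move=> b /bigcupP[i _ bi]; case: (HB i) => B4 _ _; apply: B4.
- move=> b x y /bigcupP[i _ bi] xb yb xy; case: (HB i) => _ Be _.
  exact: fe (Be b x y bi xb yb xy).
- move=> x y exy; have [i fi iU] := ef _ _ exy.
  case: (HB i) => _ _ /(_ _ _ fi)[b bi [xb yb bU]].
  exists b; first by apply/bigcupP; exists i.
  split=> // b' /bigcupP[j _ b'j] xb' yb'; apply: bU => //.
  by case: (HB j) => _ /(_ _ _ _ b'j xb' yb' (eN _ _ exy)) /iU <-.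
Qed.

Lemma dec_inj (T T' : finType) (e : rel T) (e' : rel T') (f : T -> T') :
  injective f -> (forall x y, e x y = e' (f x) (f y)) ->
  (forall x y, e' x y -> exists z t, x = f z /\ y = f t) ->
  dec e -> dec e'.
Proof.
move=> fI fe ef [B [B4 Be eB]]; exists [set f @: (b : {set T}) | b in B]; split.
- by move=> _ /imsetP[b bB ->]; rewrite card_imset //; apply: B4.
- move=> _ x y /imsetP[b bB ->] /imsetP[z zb ->] /imsetP[t tb ->].
  by rewrite (inj_eq fI) -fe; exact: Be bB zb tb.
- move=> x y exy; have [z [t [xz yt]]] := ef _ _ exy.
  move: exy; rewrite xz yt -fe => /eB [b bB [zb tb bU]].
  exists (f @: b); first exact: imset_f.
  split; try exact: imset_f.
  move=> _ /imsetP[b' b'B ->]; rewrite !(mem_imset _ _ fI) => zb' tb'.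
  by rewrite (bU b').
Qed.

(** The element at position i of a fibre goes to the element at position i of the other fibre over
    the same colour. *)
Lemma fibre_bij (T T' : finType) (P : pred T) (P' : pred T') (C : eqType)
    (c : T -> C) (c' : T' -> C) :
  (forall k, #|[pred x | P x && (c x == k)]| = #|[pred x | P' x && (c' x == k)]|) ->
  exists f : {x | P x} -> {x | P' x},
    [/\ injective f, forall y, exists x, y = f x & forall x, c' (val (f x)) = c (val x)].
Proof.
move=> H.
pose A k := [pred x : {x | P x} | c (val x) == k].
pose A' k := [pred x : {x | P' x} | c' (val x) == k].
have cA k : #|A k| = #|A' k|.
  have E (U : finType) (Q : pred U) (d : U -> C) :
     #|[pred x : {x | Q x} | d (val x) == k]| = #|[pred x | Q x && (d x == k)]|.
    rewrite -(card_image val_inj); apply: eq_card => x; rewrite !inE.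
    apply/imageP/andP => [[y + ->]|[Qx dx]]; first by rewrite inE => yk; rewrite (valP y).
    by exists (Sub x Qx); rewrite ?inE ?SubK.
  by rewrite !E.
have mem x : x \in A (c (val x)) by rewrite inE.
have lt (x : {x | P x}) : index x (enum (A (c (val x)))) < size (enum (A' (c (val x)))).
  by rewrite -cardE -cA cardE index_mem mem_enum.
(* A default for [nth]; it exists because the target fibre is as large as the one of x, and so it
   depends on x. *)
have x0' (x : {x | P x}) : {x | P' x}.
  by case: (enum (A' (c (val x)))) (lt x) => [|a s _] //; exact: a.
pose f x := nth (x0' x) (enum (A' (c (val x)))) (index x (enum (A (c (val x))))).
have fc x : c' (val (f x)) = c (val x).
  by have := mem_nth (x0' x) (lt x); rewrite mem_enum inE => /eqP.
have fI : injective f.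
  move=> x y fxy; have cxy : c (val x) = c (val y) by rewrite -!fc fxy.
  have yA : y \in enum (A (c (val x))) by rewrite mem_enum inE cxy.
  have xA : x \in enum (A (c (val x))) by rewrite mem_enum.
  have ly : index y (enum (A (c (val x)))) < size (enum (A' (c (val x)))).
    by rewrite cxy lt.
  move: fxy; rewrite /f -cxy (set_nth_default (x0' y) (x0' x)) ?lt // => /eqP.
  rewrite nth_uniq ?enum_uniq ?lt // => /eqP ixy.
  by rewrite -(nth_index x xA) ixy nth_index.
exists f; split=> // y.
have cy : index y (enum (A' (c' (val y)))) < size (enum (A (c' (val y)))).
  by rewrite -cardE cA cardE index_mem mem_enum inE.
have x0 : {x | P x} by case: (enum (A _)) cy => [|a s _] //; exact: a.
pose x := nth x0 (enum (A (c' (val y)))) (index y (enum (A' (c' (val y))))).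
have cx : c (val x) = c' (val y).
  by have := mem_nth x0 cy; rewrite mem_enum inE => /eqP.
exists x; rewrite /f cx index_uniq ?enum_uniq // nth_index // mem_enum inE.
by [].
Qed.

(** The complete multipartite graph on P whose classes are the fibres of c. Keeping P as a predicate
    lets designs on parts of one point set be glued. *)
Definition restr (T : finType) (P : pred T) (C : eqType) (c : T -> C) : rel T :=
  fun x y => [&& P x, P y & c x != c y].

(** Class sizes determine a complete multipartite graph up to isomorphism; vertices outside P are
    isolated and disappear on passing to the subtype. *)
Lemma dec_restr (T T' : finType) (P : pred T) (P' : pred T') (C : eqType)
    (c : T -> C) (c' : T' -> C) :
  (forall k, #|[pred x | P x && (c x == k)]| = #|[pred x | P' x && (c' x == k)]|) ->
  dec (restr P c) -> dec (restr P' c').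
Proof.
move=> /fibre_bij [f [fI fS fc]].
suff sub (U : finType) (Q : pred U) (d : U -> C) :
   dec (restr Q d) <-> dec (fun x y : {x | Q x} => d (val x) != d (val y)).
  rewrite !sub; apply: dec_inj fI _ _ => [x y|x y _]; first by rewrite !fc.
  by have [z ->] := fS x; have [t ->] := fS y; exists z, t.
split; last first.
  apply: (dec_inj val_inj) => [x y|x y].
    by rewrite /restr (valP x) (valP y).
  by case/and3P=> Qx Qy _; exists (Sub x Qx), (Sub y Qy); rewrite !SubK.
case=> B [B4 Be eB].
(* Every point of a block has a neighbour inside the block, so blocks stay within Q. *)
have BQ b x : b \in B -> x \in b -> Q x.
  move=> bB xb; have : 1 < #|b| by rewrite B4.
  rewrite (cardsD1 x) xb add1n ltnS card_gt0 => /set0Pn[y].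
  rewrite !inE => /andP[yx yb].
  by have /and3P[] := Be _ _ _ bB xb yb (contraNneq (fun e => introT eqP (esym e)) yx).
exists [set [set x : {x | Q x} | val x \in (b : {set U})] | b in B]; split.
- move=> _ /imsetP[b bB ->]; rewrite -(B4 b bB) -(card_imset _ val_inj).
  apply: eq_card => x; apply/imsetP/idP => [[y + ->]|xb]; first by rewrite inE.
  by exists (Sub x (BQ b x bB xb)); rewrite ?inE SubK.
- move=> _ x y /imsetP[b bB ->]; rewrite !inE => xb yb xy.
  by have /and3P[] := Be b _ _ bB xb yb (contra_neq (@val_inj _ _ _ _ _) xy).
- move=> x y dxy; have [|b bB [xb yb bU]] := eB (val x) (val y).
    by rewrite /restr (valP x) (valP y).
  exists [set x : {x | Q x} | val x \in b]; first exact: imset_f.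
  split; rewrite ?inE // => _ /imsetP[b' b'B ->]; rewrite !inE => xb' yb'.
  by rewrite (bU b').
Qed.

(* a 4-GDD of type l, on the points coloured by positions in l *)
Definition gdd (l : seq nat) : Prop :=
  dec (fun x y : {i : 'I_(size l) & 'I_(nth 0 l i)} => tag x != tag y).

Lemma card_gdd_fibre (l : seq nat) k :
  #|[pred x : {i : 'I_(size l) & 'I_(nth 0 l i)} | predT x && (tag x == k :> nat)]|
    = nth 0 l k.
Proof.
have [lt|ge] := ltnP k (size l); last first.
  rewrite nth_default //; apply/eqP/pred0P => -[i x] /=.
  by apply/negbTE; rewrite neq_ltn (leq_trans (ltn_ord i)).
rewrite -[RHS]card_ord -[RHS](card_codom (f := fun x : 'I_(nth 0 l (Ordinal lt)) =>
    Tagged (fun i : 'I_(size l) => 'I_(nth 0 l i)) x)); last first.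
  by move=> x y /eqP; rewrite eq_Tagged /= => /eqP.
apply: eq_card => -[i x]; rewrite !inE /=.
apply/eqP/codomP => [ik|[y /(congr1 (fun z => val (tag z)))]] //.
have ei : i = Ordinal lt by apply: val_inj.
by rewrite ei in x *; exists x.
Qed.

(** Any coloured point set with class sizes l serves as well as the standard one. Through [nth 0]
    the hypothesis also excludes colours beyond the list; empty groups are allowed. *)
Lemma gdd_dec (T : finType) (P : pred T) (c : T -> nat) (l : seq nat) :
  (forall k, #|[pred x | P x && (c x == k)]| = nth 0 l k) ->
  gdd l <-> dec (restr P c).
Proof.
move=> H.
have -> : gdd l <-> dec (restr predT (fun x : {i : 'I_(size l) & 'I_(nth 0 l i)} => tag x : nat)).
  by rewrite /gdd; split; apply: dec_eq => x y; rewrite /restr /= (inj_eq val_inj).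
by split; apply: dec_restr => k; rewrite card_gdd_fibre H.
Qed.

Lemma gdd_nth l l' : nth 0 l =1 nth 0 l' -> gdd l -> gdd l'.
Proof.
move=> E /(gdd_dec (fun k => etrans (card_gdd_fibre l' k) (esym (E k)))).
by move/(gdd_dec (card_gdd_fibre l')).
Qed.

(** * Weighted point sets *)

(** The graph e with each vertex a replaced by w a copies, as in Wilson's fundamental construction;
    copies of one vertex are not joined when e is irreflexive. *)
Definition wdec (A : finType) (w : A -> nat) (e : rel A) : Prop :=
  dec (fun x y : {a : A & 'I_(w a)} => e (tag x) (tag y)).

Lemma card_weight (A : finType) (w : A -> nat) (P : pred A) :
  #|[pred x : {a : A & 'I_(w a)} | P (tag x)]| = \sum_(a | P a) w a.
Proof.
rewrite -sum1_card (eq_bigl (fun x : {a : A & 'I_(w a)} => P (tag x) && true)); last first.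
  by move=> x; rewrite !inE andbT.
rewrite -(sig_big_dep P (fun a _ => true) (fun a (x : 'I_(w a)) => 1)).
by apply: eq_bigr => a _; rewrite sum1_card card_ord.
Qed.

(** A group consists of all copies of the vertices of one colour, hence the sums of weights. *)
Lemma gdd_wdec (A C : finType) (w : A -> nat) (P : pred A) (c : A -> C) (f : C -> nat) :
  (forall k, \sum_(a | P a && (c a == k)) w a = f k) ->
  gdd (map f (enum C)) <-> wdec w (restr P c).
Proof.
move=> H; pose c' (x : {a : A & 'I_(w a)}) : nat := enum_rank (c (tag x)).
rewrite (gdd_dec (P := fun x : {a : A & 'I_(w a)} => P (tag x)) (c := c')) => [|k].
  by rewrite /wdec; split; apply: dec_eq => x y; rewrite /restr /c' (inj_eq val_inj) (inj_eq enum_rank_inj).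
have [lt|ge] := ltnP k (size (map f (enum C))); last first.
  rewrite nth_default //; apply/eqP/pred0P => x /=; apply/negbTE.
  rewrite size_map -cardE in ge.
  by rewrite negb_and neq_ltn /c' (leq_trans (ltn_ord _) ge) orbT.
rewrite size_map -cardE in lt.
pose k' : 'I_#|C| := Ordinal lt.
rewrite (nth_map (enum_val k')) -?cardE // -(enum_val_nth (enum_val k') k') -H -card_weight.
apply: eq_card => x; rewrite !inE /c'; congr (_ && _).
apply/eqP/eqP => [ck|->].
  by apply: enum_rank_inj; apply: val_inj; rewrite /= enum_valK.
by rewrite enum_valK.
Qed.

Lemma gdd_perm l l' : perm_eq l l' -> gdd l -> gdd l'.
Proof.
rewrite perm_sym => /(perm_iotaP 0)[s s_iota ->].
have sz : size s = size l by rewrite (perm_size s_iota) size_iota.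
have ss k : (k \in s) = (k < size l) by rewrite (perm_mem s_iota) mem_iota.
have us : uniq s by rewrite (perm_uniq s_iota) iota_uniq.
have lt (i : 'I_(size l)) : index (i : nat) s < size s by rewrite index_mem ss.
pose c (i : 'I_(size l)) : 'I_(size s) := Ordinal (lt i).
have E1 (k : 'I_(size l)) : \sum_(a | predT a && (id a == k)) nth 0 l a = nth 0 l k.
  by rewrite big_pred1_eq.
have E2 (k : 'I_(size s)) : \sum_(a | predT a && (c a == k)) nth 0 l a = nth 0 l (nth 0 s k).
  have lk : nth 0 s k < size l by rewrite -ss mem_nth.
  rewrite (big_pred1 (Ordinal lk)) // => i /=.
  apply/eqP/eqP => [kE|->]; apply: val_inj => /=; first by rewrite -kE /= nth_index ?ss.
  by rewrite index_uniq.
have -> : [seq nth 0 l i | i <- s] = [seq nth 0 l (nth 0 s i) | i : 'I_(size s) <- enum 'I_(size s)].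
  by rewrite -{1}(mkseq_nth 0 s) /mkseq -val_enum_ord -!map_comp.
rewrite -[l in X in X -> _](mkseq_nth 0) /mkseq -val_enum_ord -map_comp /=.
move/(gdd_wdec E1) => gl; apply/(gdd_wdec E2); apply: dec_eq gl => x y; rewrite /restr /=.
congr (~~ _); apply/eqP/eqP => [->//|/(congr1 val) /= /(congr1 (nth 0 s))].
by rewrite !nth_index ?ss // => /val_inj.
Qed.

Lemma wdec_union (A I : finType) (w : A -> nat) (e : rel A) (f : I -> rel A) :
  (forall a, ~~ e a a) ->
  (forall i x y, f i x y -> e x y) ->
  (forall x y, e x y -> exists2 i, f i x y & forall j, f j x y -> j = i) ->
  (forall i, wdec w (f i)) -> wdec w e.
Proof.
move=> eN fe ef; apply: dec_union => [x y exy|i x y|x y]; last exact: ef.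
  by apply: contraTneq exy => ->.
exact: fe.
Qed.

Lemma dec0 (T : finType) (e : rel T) : (forall x y, ~~ e x y) -> dec e.
Proof.
move=> e0; exists set0; split=> [b|b x y|x y]; rewrite ?inE //.
by rewrite (negbTE (e0 x y)).
Qed.

Lemma wdec_eq (A : finType) (w : A -> nat) (e e' : rel A) :
  e =2 e' -> wdec w e -> wdec w e'.
Proof. by move=> ee; apply: dec_eq => x y; apply: ee. Qed.

(** * Orthogonal arrays and weighting along them *)

(** Rows are indexed by pairs (a, b); this is a transversal design with k groups of size n. It is
    enough to ask that two columns determine the row: that every pair of entries occurs follows by
    counting. *)
Definition oa k n : Prop := exists f : 'I_n -> 'I_n -> 'I_k -> 'I_n,
  forall i j a b a' b', i != j ->
    f a b i = f a' b' i -> f a b j = f a' b' j -> a = a' /\ b = b'.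

Lemma inj2_surj n (g : 'I_n -> 'I_n -> 'I_n * 'I_n) :
  (forall a b a' b', g a b = g a' b' -> a = a' /\ b = b') ->
  forall x y, exists a b, g a b = (x, y).
Proof.
move=> gI x y; pose h (p : 'I_n * 'I_n) := g p.1 p.2.
have hI : injective h by move=> [a b] [a' b'] /gI[/= -> ->].
by exists (invF hI (x, y)).1, (invF hI (x, y)).2; rewrite -/(h _) f_invF.
Qed.

Lemma oa_surj k n (f : 'I_n -> 'I_n -> 'I_k -> 'I_n) i j :
  (forall a b a' b', f a b i = f a' b' i -> f a b j = f a' b' j -> a = a' /\ b = b') ->
  forall x y, exists a b, f a b i = x /\ f a b j = y.
Proof.
move=> H x y; have [|a [b [<- <-]]] := @inj2_surj n (fun a b => (f a b i, f a b j)) _ x y.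
  by move=> a b a' b' [/H].
by exists a, b.
Qed.

Lemma oa_le k k' n : k' <= k -> oa k n -> oa k' n.
Proof.
move=> kk [f Hf]; exists (fun a b i => f a b (widen_ord kk i)) => i j a b a' b' ij.
by apply: Hf; rewrite -(inj_eq val_inj).
Qed.

(** Wilson's fundamental construction over a transversal design: two points of different groups lie
    in exactly one row, and this row carries a design on the weights of its points. *)
Lemma gdd_oa k n (wt : 'I_k -> 'I_n -> nat) : oa k n ->
  (forall x : 'I_k -> 'I_n, gdd [seq wt j (x j) | j <- enum 'I_k]) ->
  gdd [seq \sum_x wt j x | j <- enum 'I_k].
Proof.
case=> f Hf Hx; pose w (p : 'I_k * 'I_n) := wt p.1 p.2.
have E (j : 'I_k) : \sum_(p | predT p && (p.1 == j)) w p = \sum_x wt j x.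
  rewrite (eq_bigl (fun p : 'I_k * 'I_n => pred1 j p.1 && true)); last by move=> p; rewrite andbT.
  by rewrite -(pair_big_dep (pred1 j) (fun _ _ => true) (fun a b => wt a b)) big_pred1_eq.
apply/(gdd_wdec E).
pose g (ab : 'I_n * 'I_n) : rel ('I_k * 'I_n) :=
  restr (fun p => p.2 == f ab.1 ab.2 p.1) fst.
apply: (@wdec_union _ _ _ _ g) => [[j x]|[a b] [j x] [j' x']|[j x] [j' x']|[a b]].
- by rewrite /restr /= eqxx.
- by rewrite /g /restr /= => /and3P[].
- rewrite /g /restr /= => jj.
  have [a [b [xE yE]]] := @oa_surj _ _ f j j' (fun a b a' b' => Hf j j' a b a' b' jj) x x'.
  exists (a, b); first by rewrite /= xE yE !eqxx jj.
  case=> a' b' /and3P[/= /eqP x1 /eqP x2 _].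
  by have [|| -> ->] := Hf _ _ a' b' a b jj; rewrite -?x1 -?x2.
have E' (j : 'I_k) : \sum_(p : 'I_k * 'I_n | (p.2 == f a b p.1) && (p.1 == j)) w p = wt j (f a b j).
  rewrite (big_pred1 (j, f a b j)) // => -[j' x] /=; rewrite -pair_eqE /pair_eq /= andbC.
  by case: eqP => // ->.
exact/(gdd_wdec E').
Qed.

Lemma map_enum_ord n (F : nat -> nat) : [seq F i | i : 'I_n <- enum 'I_n] = mkseq F n.
Proof. by rewrite /mkseq -val_enum_ord -map_comp. Qed.

(** Weights are constant on the first groups and vary on the last. The first groups are only scaled,
    while the last one may have as size any sum of n admissible values. *)
Lemma gdd_flexw (l : seq nat) n (w : 'I_n -> nat) : oa (size l).+1 n ->
  (forall x, gdd (rcons l (w x))) -> gdd (rcons (map (muln n) l) (\sum_x w x)).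
Proof.
move=> On Hw.
pose wt (j : 'I_(size l).+1) (x : 'I_n) := if (j : nat) < size l then nth 0 l j else w x.
have K (F : nat -> nat) z : [seq (if (j : nat) < size l then F (nth 0 l j) else z) | j : 'I_(size l).+1 <- enum 'I_(size l).+1]
   = rcons (map F l) z.
  transitivity (mkseq (fun j => if j < size l then F (nth 0 l j) else z) (size l).+1).
    exact: (map_enum_ord _ (fun j => if j < size l then F (nth 0 l j) else z)).
  rewrite mkseqS ltnn; congr rcons.
  apply: (@eq_from_nth _ 0); rewrite size_mkseq ?size_map // => i lt.
  by rewrite nth_mkseq // lt (nth_map 0).
have := @gdd_oa _ _ wt On; rewrite /wt.
have -> : [seq \sum_x (if (j : nat) < size l then nth 0 l j else w x) | j : 'I_(size l).+1 <- enum 'I_(size l).+1]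
   = rcons (map (muln n) l) (\sum_x w x).
  rewrite -K; apply: eq_map => j; case: ifP => // _.
  by rewrite sum_nat_const card_ord.
apply=> x; have := Hw (x ord_max); rewrite -{1}(map_id l) -K; congr gdd.
apply: eq_map => j; case: ifP => // jl; congr (w (x _)).
by apply: val_inj => /=; have := ltn_ord j; lia.
Qed.

(** Greedy choice: each point takes as much of the remaining t as hi allows. *)
Lemma sum_progression n lo s hi t : t <= n * hi ->
  exists2 w : 'I_n -> nat, forall x, exists2 i, i <= hi & w x = lo + s * i &
    \sum_x w x = n * lo + s * t.
Proof.
elim: n t => [|n IH] t tn.
  by exists (fun=> 0); [case | rewrite big_ord0; lia].
have [w Hw sw] := IH (t - minn t hi) ltac:(rewrite mulSn in tn; lia).
exists (fun x => if unlift ord0 x is Some y then w y else lo + s * minn t hi).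
  move=> x; case: unliftP => [y _|_]; first exact: Hw.
  by exists (minn t hi); first exact: geq_minr.
rewrite big_ord_recl unlift_none.
under eq_bigr => i _ do rewrite liftK.
rewrite sw mulSn addnACA -mulnDr; congr (_ + s * _); lia.
Qed.

Lemma gdd_flex (l : seq nat) n lo hi : oa (size l).+1 n ->
  (forall i, i <= hi -> gdd (rcons l (lo + 3 * i))) ->
  forall t, t <= n * hi -> gdd (rcons (map (muln n) l) (n * lo + 3 * t)).
Proof.
move=> On H t /(sum_progression lo 3)[w Hw <-].
by apply: gdd_flexw => // x; have [i ihi ->] := Hw x; apply: H.
Qed.

(* roa k n: an oa (k+1) n resolved by its last column, with one class made of
   constant rows *)
Definition roa k n : Prop := exists2 F : 'I_n -> 'I_n -> 'I_k -> 'I_n,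
  (forall i j d b d' b', i != j ->
    F d b i = F d' b' i -> F d b j = F d' b' j -> d = d' /\ b = b') /\
  (forall d j, injective (F d ^~ j)) & exists d0, forall b j, F d0 b j = b.

(** The class index d becomes a further column, since two rows of one class never agree. *)
Lemma roa_oa k n : roa k n -> oa k.+1 n.
Proof.
case=> F [F1 F2] _.
exists (fun d b i => if unlift ord_max i is Some j then F d b j else d).
move=> i j a b a' b' ij; case: unliftP => [i' iE|iE]; case: unliftP => [j' jE|jE].
- by apply: F1; apply: contra_neq ij => e; rewrite iE jE e.
- by move=> + aa; rewrite -aa => /F2.
- by move=> aa; rewrite -aa => /F2.
- by rewrite iE jE eqxx in ij.
Qed.

Lemma gdd_option (C : finType) (f : option C -> nat) :
  gdd (map f (enum {: option C})) <-> gdd (rcons [seq f (Some c) | c <- enum C] (f None)).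
Proof.
suff E : perm_eq (map f (enum {: option C})) (rcons [seq f (Some c) | c <- enum C] (f None)).
  by split; apply: gdd_perm => //; rewrite perm_sym.
have /(perm_map f) /perm_trans-> // : perm_eq (enum {: option C}) (None :: map some (enum C)).
  apply: uniq_perm; rewrite ?enum_uniq //=.
    by rewrite map_inj_uniq ?enum_uniq; [rewrite andbT; apply/mapP => -[] | move=> x y []].
  case=> [c|]; rewrite mem_enum in_cons //=; apply/esym/mapP.
  by exists c; rewrite ?mem_enum.
by rewrite perm_sym perm_rcons /= perm_cons -map_comp.
Qed.

Lemma gdd_opt (C : finType) g m (f : option C -> nat) :
  (forall c, f (Some c) = g) -> f None = m ->
  gdd (map f (enum {: option C})) <-> gdd (rcons (nseq #|C| g) m).
Proof.
move=> fS fN; rewrite gdd_option fN (eq_map fS) cardE.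
by rewrite (_ : [seq g | _ <- enum C] = nseq (size (enum C)) g) //; elim: (enum C) => //= c s ->.
Qed.

(** Points are pairs (column j, symbol y) of weight l_j, and each class d has a point at infinity. A
    row of a class other than [d0], with the infinite point of its class, carries a design of type
    l, w x; this settles pairs in different columns. The constant rows of [d0] are kept as groups.
    Column j with the infinite point of [d0], of weight M, carries a design with n + 1 groups of
    size l_j; this settles pairs within a column. *)
Lemma gdd_mix (l : seq nat) n (w : 'I_n -> nat) M : roa (size l) n.+1 ->
  (forall x, gdd (rcons l (w x))) ->
  (forall s, s \in l -> gdd (rcons (nseq n.+1 s) M)) ->
  gdd (rcons (nseq n.+1 (sumn l)) (M + \sum_x w x)).
Proof.
case=> F [F1 F2] [d0 F0] Hw Hl.
pose A : finType := ('I_(size l) * 'I_n.+1 + 'I_n.+1)%type.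
pose wA (a : A) := match a with inl p => nth 0 l p.1
   | inr d => if unlift d0 d is Some x then w x else M end.
pose c (a : A) : option 'I_n.+1 := match a with inl p => Some p.2 | inr _ => None end.
pose P (i : 'I_n * 'I_n.+1 + 'I_(size l)) (a : A) := match i, a with
  | inl (x, b), inl p => p.2 == F (lift d0 x) b p.1
  | inl (x, b), inr d => d == lift d0 x
  | inr j, inl p => p.1 == j
  | inr j, inr d => d == d0 end.
pose cB (a : A) : option 'I_(size l) := match a with inl p => Some p.1 | inr _ => None end.
pose f (i : 'I_n * 'I_n.+1 + 'I_(size l)) : rel A :=
  match i with inl _ => restr (P i) cB | inr _ => restr (P i) c end.
have cE (k : option 'I_n.+1) : \sum_(a | predT a && (c a == k)) wA a =
    if k is Some _ then sumn l else M + \sum_x w x.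
  rewrite big_sumType /=; case: k => [x|].
    rewrite [X in _ + X]big1 ?addn0 //.
    rewrite (eq_bigl (fun p : 'I_(size l) * 'I_n.+1 => true && (pred1 x p.2))) //.
    rewrite -(pair_big_dep predT (fun _ => pred1 x) (fun (a : 'I_(size l)) (b : 'I_n.+1) => nth 0 l a)) /=.
    rewrite sumnE (big_nth 0) big_mkord; apply: eq_bigr => i _.
    by rewrite big_pred1_eq.
  rewrite big1 ?add0n //.
  rewrite (bigD1 d0) //= unlift_none; congr addn.
  rewrite (reindex_omap (lift d0) (unlift d0)) /=; last first.
    by move=> d; rewrite eq_sym => /unlift_some[x dx ->]; rewrite /= -dx.
  apply: eq_big => [x|x _]; rewrite liftK //= ?eqxx ?andbT.
  by rewrite eq_sym neq_lift.
rewrite -[X in nseq X _](card_ord n.+1).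
apply/(gdd_opt (f := fun k => if k is Some _ then sumn l else M + \sum_x w x)) => //.
apply/(gdd_wdec cE).
apply: (@wdec_union _ _ _ _ f) => [a|i a a'|a a'|i].
- by rewrite /restr eqxx.
(* A row of another class shares at most one entry with a constant row, so its points lie in
   distinct groups. *)
- have idle (d : 'I_n) b (j j' : 'I_(size l)) : j != j' -> F (lift d0 d) b j != F (lift d0 d) b j'.
    move=> jj; apply/negP => /eqP e.
    have [/eqP + _] := F1 j j' _ b d0 _ jj (esym (F0 _ _)) (etrans (esym e) (esym (F0 _ _))).
    by rewrite eq_sym (negbTE (neq_lift _ _)).
  case: i a a' => [[x b]|j] [[k y]|d] [[k' y']|d'] /and3P[] //=.
  move=> /eqP -> /eqP -> jj; rewrite /restr /=.
  by apply: contraNneq (idle x b k k' jj) => -[->].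
- case: a a' => [[j y]|d] [[j' y']|d'] //; rewrite /restr /=.
  + rewrite (inj_eq (@Some_inj _)) => yy; have [jj|jj] := eqVneq j j'.
      subst j'; exists (inr j); first by rewrite /= /restr /= eqxx (inj_eq (@Some_inj _)).
      by case=> [[x b]|k] /and3P[] //=; rewrite ?eqxx // => /eqP ->.
    have [d [b [dy dy']]] := @oa_surj _ _ F j j' (fun d b d' b' => F1 j j' d b d' b' jj) y y'.
    case: (unliftP d0 d) => [x dx|dd]; last by rewrite -dy -dy' dd !F0 eqxx in yy.
    exists (inl (x, b)); first by rewrite /= /restr /= -dx dy dy' !eqxx (inj_eq (@Some_inj _)).
    case=> [[x' b']|k] /and3P[/= /eqP e1 /eqP e2 _]; last by rewrite e1 e2 eqxx in jj.
    have [] := F1 _ _ d b (lift d0 x') b' jj; rewrite ?dy ?dy' // dx => /lift_inj -> -> //.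
  + move=> _; case: (unliftP d0 d') => [x dx|dd].
      have [g _ gK] := injF_bij (@F2 d' j).
      exists (inl (x, g y)); first by rewrite /= /restr /= -dx gK !eqxx.
      case=> [[x' b']|k] /and3P[/= /eqP e1 /eqP e2 _].
        by move: e2; rewrite dx => /lift_inj xx; rewrite -xx -dx in e1 *; rewrite e1; congr (inl (_, _)); apply: (@F2 d' j); rewrite gK.
      by move: e2; rewrite dx => /eqP; rewrite eq_sym (negbTE (neq_lift _ _)).
    exists (inr j); first by rewrite /= /restr /= dd !eqxx.
    case=> [[x' b']|k] /and3P[/= /eqP e1 /eqP e2 _]; last by rewrite e1.
    by move: e2; rewrite dd => /eqP; rewrite (negbTE (neq_lift _ _)).
  + move=> _; case: (unliftP d0 d) => [x dx|dd].
      have [g _ gK] := injF_bij (@F2 d j').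
      exists (inl (x, g y')); first by rewrite /= /restr /= -dx gK !eqxx.
      case=> [[x' b']|k] /and3P[/= /eqP e1 /eqP e2 _].
        by move: e1; rewrite dx => /lift_inj xx; rewrite -xx -dx in e2 *; rewrite e2; congr (inl (_, _)); apply: (@F2 d j'); rewrite gK.
      by move: e1; rewrite dx => /eqP; rewrite eq_sym (negbTE (neq_lift _ _)).
    exists (inr j'); first by rewrite /= /restr /= dd !eqxx.
    case=> [[x' b']|k] /and3P[/= /eqP e1 /eqP e2 _]; last by rewrite e2.
    by move: e1; rewrite dd => /eqP; rewrite (negbTE (neq_lift _ _)).
- case: i => [[x b]|j].
    pose h (k : option 'I_(size l)) := if k is Some j then nth 0 l j else w x.
    have E (k : option 'I_(size l)) : \sum_(a | P (inl (x, b)) a && (cB a == k)) wA a = h k.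
      rewrite big_sumType /=; case: k => [j|] /=.
        rewrite [X in _ + X]big1 ?addn0 //; last by move=> i /andP[].
        rewrite (big_pred1 (j, F (lift d0 x) b j)) // => -[k y] /=.
        rewrite ?xpair_eqE (inj_eq (@Some_inj _)) andbC.
        by case: eqP => // ->.
      rewrite big1 ?add0n //; last by move=> i /andP[].
      rewrite (big_pred1 (lift d0 x)) /= ?liftK // => d.
      by rewrite andbT.
    apply/(gdd_wdec E)/gdd_option => /=.
    by rewrite map_enum_ord -/(mkseq _ _) mkseq_nth.
  pose h (k : option 'I_n.+1) := if k is Some _ then nth 0 l j else M.
  have E (k : option 'I_n.+1) : \sum_(a | P (inr j) a && (c a == k)) wA a = h k.
    rewrite big_sumType /=; case: k => [y|] /=.
      rewrite [X in _ + X]big1 ?addn0 //; last by move=> i /andP[].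
      rewrite (big_pred1 (j, y)) //.
    rewrite big1 ?add0n //; last by move=> i /andP[].
    by rewrite (big_pred1 d0) /= ?unlift_none // => d; rewrite andbT.
  apply/(gdd_wdec E)/(@gdd_opt _ (nth 0 l j) M) => //; rewrite card_ord; apply: Hl.
  exact: mem_nth.
Qed.

(* If translates of base blocks cover all edges, then, as there are no more
   translates than a decomposition needs, no edge is covered twice. *)
Lemma orbit_dec (T : finType) (e : rel T) (a : nat -> T -> T) N0 (S : seq (nat * {set T})) :
  0 < N0 -> (forall k l x, a (k + l) x = a k (a l x)) -> (forall x, a N0 x = x) ->
  (forall x y, e (a 1 x) (a 1 y) -> e x y) -> irreflexive e ->
  (forall p, p \in S -> [/\ 0 < p.1, #|p.2| = 4,
     forall x y, x \in p.2 -> y \in p.2 -> x != y -> e x y &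
     forall x, x \in p.2 -> a p.1 x \in p.2]) ->
  (forall x y, e x y -> exists2 p, p \in S &
     exists k u v, [/\ u \in p.2, v \in p.2, x = a k u & y = a k v]) ->
  12 * \sum_(p <- S) p.1 <= #|[pred q : T * T | e q.1 q.2]| -> dec e.
Proof.
move=> N00 aD aN ea eI HS cov cnt.
have a0 x : a 0 x = x by rewrite -{1}[x]aN -aD add0n aN.
have aM k x : a (k * N0) x = x by elim: k => [//|k IH]; rewrite mulSn aD IH aN.
have aK k : cancel (a k) (a (k * N0.-1)).
  by move=> x; rewrite -aD -mulnSr prednK // aM.
have aI k : injective (a k) by apply: can_inj (aK k).
have ek k x y : e (a k x) (a k y) -> e x y.
  by elim: k x y => [|k IH] x y; rewrite ?a0 // -addn1 !aD => /IH /ea.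
have ke k x y : e x y -> e (a k x) (a k y).
  by move=> exy; apply: (ek (k * N0.-1)); rewrite !aK.
pose tr k (b : {set T}) := a k @: b.
have trD k l b : tr (k + l) b = tr k (tr l b).
  by rewrite /tr -imset_comp; apply: eq_imset => x /=; apply: aD.
have trS p k : p \in S -> tr k p.2 = tr (k %% p.1) p.2.
  case/HS => l0 _ _ bl; have tl : tr p.1 p.2 = p.2.
    apply/eqP; rewrite eqEcard (card_imset _ (aI _)) leqnn andbT.
    by apply/subsetP => _ /imsetP[x xb ->]; apply: bl.
  rewrite {1}(divn_eq k p.1) addnC trD; congr tr; elim: (k %/ p.1) => [|m IH].
    by rewrite mul0n; apply/setP => x; rewrite -{1}[x]a0 mem_imset.
  by rewrite mulSn trD IH tl.
pose B : {set {set T}} := [set:: flatten [seq [seq tr k p.2 | k <- iota 0 p.1] | p <- S]].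
have inB p k : p \in S -> tr k p.2 \in B.
  move=> pS; rewrite inE; apply/flatten_mapP; exists p => //.
  by rewrite (trS _ _ pS); apply/map_f; rewrite mem_iota ltn_mod; case: (HS _ pS).
have outB b : b \in B -> exists2 p, p \in S & exists k, b = tr k p.2.
  by rewrite inE => /flatten_mapP[p pS /mapP[k _ ->]]; exists p => //; exists k.
have cB : #|B| <= \sum_(p <- S) p.1.
  rewrite cardsE (leq_trans (card_size _)) // size_flatten /shape -map_comp sumnE big_map.
  by apply: leq_sum => p _; rewrite /= size_map size_iota.
have B4 b : b \in B -> #|b| = 4.
  by case/outB => p /HS[_ <- _ _] [k ->]; rewrite card_imset.
have Be b x y : b \in B -> x \in b -> y \in b -> x != y -> e x y.
  case/outB => p /HS[_ _ pe _] [k ->] /imsetP[u ub ->] /imsetP[v vb ->].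
  by rewrite (inj_eq (aI k)) => uv; apply/ke/pe.
have eB x y : e x y -> exists2 b, b \in B & (x \in b) && (y \in b).
  case/cov => p pS [k [u [v [ub vb -> ->]]]]; exists (tr k p.2); first exact: inB.
  by rewrite !imset_f.
pose E := [pred q : T * T | e q.1 q.2].
pose c (q : T * T) := #|[set b in B | (q.1 \in b) && (q.2 \in b)]|.
(* A block contains 12 ordered pairs of distinct points. Counted with multiplicity, at most as many
   pairs are covered as there are edges; each edge is covered once already, which leaves no room for
   a second block. *)
have sumc : \sum_(q in E) c q <= #|E|.
  apply: leq_trans cnt; apply: leq_trans (leq_mul (leqnn 12) cB).
  rewrite mulnC -sum_nat_const.
  under eq_bigr => q _ do rewrite /c -sum1dep_card.
  rewrite (exchange_big_dep (mem B)) /= => [|q b _ /andP[] //].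
  apply: leq_sum => b bB; rewrite sum1dep_card.
  apply: leq_trans (_ : #|setX b b :\: [set (x, x) | x in b]| <= _).
    apply/subset_leq_card/subsetP => -[x y]; rewrite !inE /= => /andP[exy /andP[_ /andP[xb yb]]].
    rewrite xb yb !andbT; apply/imsetP => -[z _ [xz yz]].
    by move: exy; rewrite xz yz eI.
  have sub : [set (x, x) | x in b] \subset setX b b.
    by apply/subsetP => _ /imsetP[x xb ->]; rewrite !inE xb.
  by rewrite cardsD (setIidPr sub) cardsX card_imset ?B4 // => x y [].
exists B; split=> // x y exy; have [b bB /andP[xb yb]] := eB _ _ exy.
exists b => //; split=> // b' b'B xb' yb'; apply/eqP; apply: contraT => bb.
have c2 : 1 < c (x, y).
  apply: leq_trans (_ : #|[set b; b']| <= _); first by rewrite cards2 eq_sym bb.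
  apply/subset_leq_card/subsetP => d; rewrite in_set2 in_set /=.
  by case/orP => /eqP ->; rewrite ?bB ?xb ?yb // b'B xb' yb'.
suff : #|E| < \sum_(q in E) c q by rewrite ltnNge sumc.
rewrite -sum1_card (bigD1 (x, y)) //= [X in _ < X](bigD1 (x, y)) //=.
rewrite -addSn leq_add // leq_sum // => q /andP[qE _].
have [d dB qd] := eB _ _ qE; rewrite card_gt0; apply/set0Pn; exists d.
by rewrite in_set dB.
Qed.

(** * Cyclic automorphisms and the test for base blocks *)

Notation NN := BinNums.N.

Definition nrange (V : nat) : seq NN := [seq N.of_nat i | i <- iota 0 V].
Definition nsum : seq NN -> NN := foldr N.add 0%num.

(* The automorphism adds st to the points of the cyclic tracks of length n, which make
   up the first F points, and permutes the other points in cycles of lengths cs. *)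
Fixpoint turn (cs : seq NN) (k x : NN) : NN :=
  if cs is c :: cs' then
    if N.ltb x c then N.modulo (N.add x k) c else N.add c (turn cs' k (N.sub x c))
  else x.

Definition shift (F n st : NN) (cs : seq NN) (k x : NN) : NN :=
  if N.ltb x F
  then N.add (N.mul (N.div x n) n) (N.modulo (N.add (N.modulo x n) (N.mul k st)) n)
  else N.add F (turn cs k (N.sub x F)).

Lemma turn_lt cs k x : N.lt x (nsum cs) -> N.lt (turn cs k x) (nsum cs).
Proof.
elim: cs x => //= c cs IH x xs; case: N.ltb_spec => xc; last first.
  by have := IH (N.sub x c) ltac:(lia); lia.
by have := N.mod_lt (N.add x k) c ltac:(lia); lia.
Qed.

Lemma turn_add cs k l x : turn cs (N.add k l) x = turn cs k (turn cs l x).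
Proof.
elim: cs x => //= c cs IH x; case: (N.ltb_spec x c) => xc; last first.
  case: N.ltb_spec => xc'; first lia.
  by rewrite IH; congr (N.add _ (turn _ _ _)); lia.
have c0 : c <> 0%num by lia.
have /N.ltb_lt -> := N.mod_lt (N.add x l) c c0.
by rewrite N.Div0.add_mod_idemp_l; congr N.modulo; lia.
Qed.

Lemma turn_id cs k x : all (fun c => N.eqb (N.modulo k c) 0) cs -> turn cs k x = x.
Proof.
elim: cs x => //= c cs IH x /andP[/N.eqb_spec kc /IH H]; case: N.ltb_spec => xc.
  by rewrite N.Div0.add_mod kc N.add_0_r N.Div0.mod_mod N.mod_small.
by rewrite H; lia.
Qed.

Section Shift.
Variables (F n st N0 : NN) (cs : seq NN).
Hypotheses (n0 : N.lt 0 n) (Fn : N.modulo F n = 0%num) (N0st : N.mul N0 st = n)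
  (csN : all (fun c => N.eqb (N.modulo N0 c) 0) cs).
Local Notation sh := (shift F n st cs).

Let track_lt x y : N.lt x F -> N.lt y n -> N.lt (N.add (N.mul (N.div x n) n) y) F.
Proof.
move=> xF yn; have := N.div_mod F n ltac:(lia); rewrite Fn N.add_0_r => eF.
have : N.lt (N.div x n) (N.div F n) by apply: N.Div0.div_lt_upper_bound; rewrite -eF.
move: (N.div x n) (N.div F n) eF => u v ->; nia.
Qed.

Let track_div x y : N.lt y n -> N.div (N.add (N.mul (N.div x n) n) y) n = N.div x n.
Proof. by move=> yn; rewrite N.div_add_l; [rewrite (N.div_small y n) // N.add_0_r|lia]. Qed.

Let track_mod x y : N.lt y n -> N.modulo (N.add (N.mul (N.div x n) n) y) n = y.
Proof. by move=> yn; rewrite N.add_comm N.Div0.mod_add N.mod_small. Qed.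

Lemma shift_lt k x : N.lt x (N.add F (nsum cs)) -> N.lt (sh k x) (N.add F (nsum cs)).
Proof.
rewrite /shift; case: (N.ltb_spec x F) => xF xV; last first.
  by have := @turn_lt cs k (N.sub x F) ltac:(lia); lia.
have := N.mod_lt (N.add (N.modulo x n) (N.mul k st)) n ltac:(lia).
by move/(track_lt xF); lia.
Qed.

Lemma shift_ltF k x : N.ltb (sh k x) F = N.ltb x F.
Proof.
rewrite /shift; case: (N.ltb_spec x F) => xF; last by apply: (proj2 (N.ltb_ge _ _)); lia.
by apply/N.ltb_lt/track_lt => //; apply: N.mod_lt; lia.
Qed.

Lemma shift_add k l x : sh (N.add k l) x = sh k (sh l x).
Proof.
rewrite {2}/shift shift_ltF /shift; case: (N.ltb_spec x F) => xF; last first.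
  by rewrite turn_add; congr (N.add _ (turn _ _ _)); lia.
have m_lt := N.mod_lt (N.add (N.modulo x n) (N.mul l st)) n ltac:(lia).
rewrite track_div // track_mod // (N.Div0.add_mod_idemp_l _ (N.mul k st)); congr (N.add _ (N.modulo _ _)).
by rewrite N.mul_add_distr_r (N.add_comm (N.mul k st)) N.add_assoc.
Qed.

Lemma shift_id x : sh N0 x = x.
Proof.
rewrite /shift; case: (N.ltb_spec x F) => xF; last by rewrite turn_id //; lia.
rewrite N0st (N.Div0.add_mod _ n) N.Div0.mod_same N.add_0_r !N.Div0.mod_mod.
by rewrite N.mul_comm -N.div_mod //; lia.
Qed.

(** The power of the automorphism that brings x among the first st positions of its track: position
    y arrives, after one full turn, at y modulo st. *)
Definition to_start x := N.sub N0 (N.div (N.modulo x n) st).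

Lemma shift_start x : N.lt x F -> N.lt (N.modulo (sh (to_start x) x) n) st.
Proof.
move=> xF; rewrite /shift; case: (N.ltb_spec x F) => [_|]; last lia.
have st0 : st <> 0%num by nia.
rewrite track_mod; last by apply: N.mod_lt; lia.
have xn := N.mod_lt x n ltac:(lia).
set y := N.modulo x n in xn *; rewrite /to_start -/y.
have iy : N.lt (N.div y st) N0 by apply: N.Div0.div_lt_upper_bound; lia.
have -> : N.add y (N.mul (N.sub N0 (N.div y st)) st) = N.add (N.modulo y st) (N.mul 1 n).
  rewrite N.mul_sub_distr_r N0st N.mul_1_l (N.mul_comm (N.div y st)).
  by have := N.div_mod y st st0; move: (N.mul st (N.div y st)) (N.modulo y st) => u v; lia.
have ym := N.mod_lt y st st0.
have yy := N.Div0.mod_le y st.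
by rewrite N.Div0.mod_add N.mod_small //; apply: N.le_lt_trans yy xn.
Qed.

End Shift.

(** Pairs become single numbers, so that coverage can be tested on sorted lists. *)
Definition code (V x y : NN) : NN := N.add (N.mul x V) y.

Lemma code_inj V x y z t : N.lt y V -> N.lt t V -> code V x y = code V z t -> x = z /\ y = t.
Proof. by move=> yV tV; rewrite /code ![N.mul _ V]N.mul_comm; apply: N.div_mod_unique. Qed.

Section Check.
Variables (V : nat) (F n st N0 : NN) (cs : seq NN).
Variables (C : eqType) (col : NN -> C) (r : rel C) (s : C -> C) (bs : seq (NN * seq NN)).
Local Notation sh := (shift F n st cs).
Local Notation V' := (N.of_nat V).

Definition params_ok :=
  [&& N.ltb 0 n, N.eqb (N.modulo F n) 0, N.eqb (N.mul N0 st) n,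
     all (fun c => N.eqb (N.modulo N0 c) 0) cs, N.eqb V' (N.add F (nsum cs)) &
     all (fun x => col (sh 1 x) == s (col x)) (nrange V)].

Definition blocks_ok := all (fun b =>
  [&& N.ltb 0 b.1, size b.2 == 4, all (fun x => N.ltb x V') b.2,
     pairwise (fun x y => r (col x) (col y)) b.2 & all (fun x => sh b.1 x \in b.2) b.2]) bs.

Definition moved k x y := code V' (sh k x) (sh k y).

(** When the first point is on a track it is moved to a start position. A pair with only its second
    point on a track is left out, because the reversed pair is present; for pairs off the tracks all
    translates are listed. *)
Definition normal_pairs (b : NN * seq NN) : seq NN :=
  flatten [seq flatten [seq
    if N.eqb x y then [::] else if N.ltb x F then [:: moved (to_start n st N0 x) x y]
    else if N.ltb y F then [::] else [seq moved k x y | k <- nrange (N.to_nat b.1)]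
    | y <- b.2] | x <- b.2].

(* Every pair of adjacent points has a translate starting on the first points of a
   track, unless both points lie outside the tracks. *)
Definition cover_ok :=
  let cv := [seq (x, col x) | x <- nrange V] in
  let rest := [seq p <- cv | ~~ N.ltb p.1 F] in
  let starts := [seq p <- cv | N.ltb p.1 F && N.ltb (N.modulo p.1 n) st] in
  let cr := undup (map snd rest) in
  let edges := flatten [seq [seq code V' p.1 q.1 | q <- cv & r p.2 q.2] | p <- starts] ++
    (* When no two colours off the tracks are adjacent, the quadratic list of pairs there is not
       built. *)
    (if all (fun c => all (fun d => ~~ r c d) cr) cr then [::]
     else flatten [seq [seq code V' p.1 q.1 | q <- rest & r p.2 q.2] | p <- rest]) in
  (* Both lists are increasing, so [subseq] tests inclusion in one linear pass. *)
  subseq edges (sort N.leb (flatten (map normal_pairs bs))).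

Lemma mem_nrange x : (x \in nrange V) = N.ltb x V'.
Proof.
apply/mapP/idP => [[i]|/N.ltb_lt xV].
  by rewrite mem_iota => /andP[_ iV] ->; apply/N.ltb_lt; lia.
by exists (N.to_nat x); rewrite ?mem_iota; lia.
Qed.

(** Symmetry of r allows only one of the two orders of a pair to be tested; s is the action of the
    automorphism on the colours. *)
Lemma check_dec : symmetric r -> irreflexive r ->
  (forall c d, r (s c) (s d) -> r c d) -> params_ok -> blocks_ok -> cover_ok ->
  12 * \sum_(b <- bs) N.to_nat b.1 <=
    #|[pred q : 'I_V * 'I_V | r (col (N.of_nat q.1)) (col (N.of_nat q.2))]| ->
  dec (fun x y : 'I_V => r (col (N.of_nat x)) (col (N.of_nat y))).
Proof.
move=> rC rI rs /and5P[/N.ltb_lt n0 /N.eqb_spec Fn /N.eqb_spec N0st csN /andP[/N.eqb_spec VF /allP cols]].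
move=> /allP bsok /mem_subseq cov cnt.
have shD := shift_add n0 Fn N0st csN; have shI := shift_id n0 Fn N0st csN.
have shV k x : N.lt x V' -> N.lt (sh k x) V' by rewrite VF; apply: (shift_lt n0 Fn N0st csN).
have N00 : N.lt 0 N0 by move: n0; rewrite -N0st; lia.
have iV (i : 'I_V) : N.lt (N.of_nat i) V' by have := ltn_ord i; lia.
have aP k (i : 'I_V) : N.to_nat (sh k (N.of_nat i)) < V by have := shV k _ (iV i); lia.
pose a (k : nat) (i : 'I_V) := Ordinal (aP (N.of_nat k) i).
have aE k i : N.of_nat (a k i) = sh (N.of_nat k) (N.of_nat i) by rewrite /= N2Nat.id.
have a1 k (i j : 'I_V) : sh (N.of_nat k) (N.of_nat i) = N.of_nat j -> a k i = j.
  by rewrite -aE => /Nat2N.inj /val_inj.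
have colS x : N.lt x V' -> col (sh 1 x) = s (col x).
  by move=> xV; apply/eqP/cols; rewrite mem_nrange; apply/N.ltb_lt.
have rsh k x y : N.lt x V' -> N.lt y V' ->
    r (col (sh (N.of_nat k) x)) (col (sh (N.of_nat k) y)) -> r (col x) (col y).
  elim: k x y => [|k IH] x y xV yV.
    have sh0 z : sh (N.of_nat 0) z = z by rewrite -{1}[z]shI -shD N.add_0_l shI.
    by rewrite !sh0.
  rewrite (_ : N.of_nat k.+1 = N.add (N.of_nat k) 1); last lia.
  by rewrite !shD => /IH H; apply: rs; rewrite -!colS //; apply: H; apply: shV.
(* The hypothesis on s only pulls edges back; pulling back along the remaining [N0 - k] steps of a
   full turn moves them forwards. *)
have shr k x y : N.le k N0 -> N.lt x V' -> N.lt y V' -> r (col x) (col y) ->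
    r (col (sh k x)) (col (sh k y)).
  move=> kN xV yV rxy; apply: (rsh (N.to_nat (N.sub N0 k))); try exact: shV.
  rewrite -!shD (_ : N.add (N.of_nat _) k = N0) ?shI //; lia.
have nt k : N.le (to_start n st N0 k) N0 by apply: N.le_sub_l.
pose cv := [seq (x, col x) | x <- nrange V].
have cvE x : N.lt x V' -> (x, col x) \in cv.
  by move=> xV; apply/mapP; exists x; rewrite // mem_nrange; apply/N.ltb_lt.
have norm x y : N.lt x V' -> N.lt y V' -> code V' x y \in flatten (map normal_pairs bs) ->
   exists2 b, b \in bs & exists k u v, [/\ u \in b.2, v \in b.2, x = sh k u & y = sh k v].
  move=> xV yV /flatten_mapP[b bB /flatten_mapP[u ub /flatten_mapP[v vb]]].
  have vV k : N.lt (sh k v) V'.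
    by apply: shV; case/and5P: (bsok b bB) => _ _ /allP /(_ v vb)/N.ltb_lt.
  have K k : code V' x y = moved k u v -> exists2 b, b \in bs &
     exists k u v, [/\ u \in b.2, v \in b.2, x = sh k u & y = sh k v].
    by move=> /(code_inj yV (vV k))[-> ->]; exists b => //; exists k, u, v.
  case: ifP => // _; case: ifP => _; first by rewrite inE => /eqP /K.
  by case: ifP => // _ /mapP[k _ /K].
have inE0 p q : p \in cv -> q \in cv -> N.ltb p.1 F ==> N.ltb (N.modulo p.1 n) st ->
    ~~ N.ltb p.1 F ==> ~~ N.ltb q.1 F -> r p.2 q.2 ->
    code V' p.1 q.1 \in flatten (map normal_pairs bs).
  move=> pc qc pF qF rpq.
  rewrite -(mem_sort N.leb); apply: cov; rewrite mem_cat.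
  have [pF'|pF'] := boolP (N.ltb p.1 F).
    apply/orP; left; apply/allpairsPdep; exists p, q; rewrite !mem_filter pc qc rpq.
    by rewrite pF' /= in pF *; rewrite pF.
  have qF' : ~~ N.ltb q.1 F by rewrite pF' in qF.
  apply/orP; right; case: ifP => [/allP H|_]; last first.
    by apply/allpairsPdep; exists p, q; rewrite !mem_filter pc qc rpq pF' qF'.
  have M t : t \in cv -> ~~ N.ltb t.1 F ->
     t.2 \in undup [seq i.2 | i <- [seq (x, col x) | x <- nrange V] & ~~ N.ltb i.1 F].
    by move=> tc tF; rewrite mem_undup; apply: map_f; rewrite mem_filter tF.
  by have /allP/(_ _ (M _ qc qF')) := H _ (M _ pc pF'); rewrite rpq.
apply: (@orbit_dec _ _ a (N.to_nat N0)
  [seq (N.to_nat b.1, [set i : 'I_V | N.of_nat i \in b.2]) | b <- bs]) => //.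
- lia.
- move=> k l x; apply: a1; rewrite !aE -shD; congr (sh _ _); lia.
- by move=> x; apply: a1; rewrite N2Nat.id.
- by move=> x y; rewrite !aE; apply: (rsh 1).
- move=> _ /mapP[b bB ->] /=; have /and5P[/N.ltb_lt b0 /eqP b4 /allP bV pw /allP bsh] := bsok b bB.
  have rb x y : x \in b.2 -> y \in b.2 -> x <> y -> r (col x) (col y).
    move: pw; rewrite -/(is_true _); elim: (b.2) => //= z t IH /andP[/allP zt /IH {}IH].
    rewrite !inE => /predU1P[->|xt] /predU1P[->|yt] xy; [by []|exact: zt|by rewrite rC; apply: zt|exact: IH].
  split=> [|| x y|x]; first lia.
  + have ub : uniq b.2.
      rewrite uniq_pairwise; apply: sub_pairwise pw => x y /=.
      by apply: contraTneq => ->; rewrite rI.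
    pose t : seq 'I_V := pmap insub (map N.to_nat b.2).
    have ut : uniq t by rewrite pmap_sub_uniq // map_inj_uniq ?ub // => x y /N2Nat.inj.
    have -> : #|[set i : 'I_V | N.of_nat i \in b.2]| = #|t|.
      apply: eq_card => i; rewrite inE mem_pmap_sub /=; apply/idP/mapP => [ib|[x xb ->]].
        by exists (N.of_nat i); rewrite ?Nat2N.id.
      by rewrite N2Nat.id.
    rewrite (card_uniqP ut) size_pmap_sub count_map (eq_in_count (a2 := predT)).
      by rewrite count_predT b4.
    by move=> x /bV /N.ltb_lt /= xV; lia.
  + by rewrite !inE => xb yb xy; apply: rb => // /Nat2N.inj /val_inj e; rewrite e eqxx in xy.
  + by rewrite !inE aE N2Nat.id => /bsh.
- have main x y : N.lt x V' -> N.lt y V' -> r (col x) (col y) -> N.lt x F \/ N.le F y ->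
     exists2 b, b \in bs & exists k u v, [/\ u \in b.2, v \in b.2, x = sh k u & y = sh k v].
    move=> xV yV rxy; have [xF _|xF] := N.ltb_spec x F.
      set t := to_start n st N0 x.
      have [|b bB [k [u [v [ub vb xk yk]]]]] := norm (sh t x) (sh t y) (shV _ _ xV) (shV _ _ yV).
        apply: (inE0 (sh t x, col (sh t x)) (sh t y, col (sh t y))); try by apply/cvE/shV.
        - by apply/implyP => _; apply/N.ltb_lt/(shift_start n0 Fn N0st csN).
        - by rewrite /= !(shift_ltF n0 Fn N0st csN); have /N.ltb_lt -> := xF.
        - by apply: shr => //; apply: nt.
      exists b => //; exists (N.add (N.sub N0 t) k), u, v; rewrite ub vb !shD -xk -yk.
      have tN : N.add (N.sub N0 t) t = N0 by apply: N.sub_add; apply: nt.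
      by rewrite -!shD tN !shI.
    case=> [|yF]; first lia; apply: norm => //.
    apply: (inE0 (x, col x) (y, col y)); rewrite ?cvE //=.
      by rewrite (proj2 (N.ltb_ge _ _) xF).
    by rewrite (proj2 (N.ltb_ge _ _) yF) implybT.
  have fin (x y : 'I_V) : (exists2 b, b \in bs & exists k u v, [/\ u \in b.2, v \in b.2,
      N.of_nat x = sh k u & N.of_nat y = sh k v]) ->
    exists2 p, p \in [seq (N.to_nat b.1, [set i : 'I_V | N.of_nat i \in b.2]) | b <- bs] &
     exists k u v, [/\ u \in p.2, v \in p.2, x = a k u & y = a k v].
    case=> b bB [k [u [v [ub vb xk yk]]]]; have /and5P[_ _ /allP bV _ _] := bsok b bB.
    have inb w : w \in b.2 -> exists i : 'I_V, N.of_nat i = w.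
      move=> /bV/N.ltb_lt wV; have wV' : N.to_nat w < V by lia.
      by exists (Ordinal wV') => /=; rewrite N2Nat.id.
    have [i iu] := inb u ub; have [j jv] := inb v vb.
    exists (N.to_nat b.1, [set i : 'I_V | N.of_nat i \in b.2]); first exact: map_f.
    exists (N.to_nat k), i, j; split; rewrite ?inE ?iu ?jv //.
      by rewrite (a1 (N.to_nat k) i x) // N2Nat.id iu.
    by rewrite (a1 (N.to_nat k) j y) // N2Nat.id jv.
  move=> x y rxy; have [xF|xF] := N.lt_ge_cases (N.of_nat x) F.
    by apply: fin; apply: main => //; left.
  have [yF|yF] := N.lt_ge_cases (N.of_nat y) F; last by apply: fin; apply: main => //; right.
  (* Only y lies on a track here, so the reversed pair is used. *)
  have [|p pS [k [u [v [? ? ? ?]]]]] := fin y x _; last by exists p => //; exists k, v, u.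
  by apply: main => //; [rewrite rC|left].
- by rewrite big_map.
Qed.
End Check.

(** * Encoding of the tabulated designs *)

Lemma gdd_rcons0 l : gdd (rcons l 0) <-> gdd l.
Proof.
suff E : nth 0 (rcons l 0) =1 nth 0 l by split; apply: gdd_nth.
by move=> k; rewrite nth_rcons; case: ltngtP => // [?|->]; rewrite nth_default // ltnW.
Qed.

Fixpoint quads (s : seq NN) : seq (seq NN) :=
  if s is [:: x, y, z, t & s'] then [:: x; y; z; t] :: quads s' else [::].

Definition base_blocks (p : seq (NN * seq NN)) : seq (NN * seq NN) :=
  flatten [seq [seq (b.1, q) | q <- quads b.2] | b <- p].

Fixpoint block_index (ss : seq NN) (x : NN) : NN :=
  if ss is s :: ss' then
    if N.ltb x s then 0%num else N.add 1 (block_index ss' (N.sub x s))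
  else 0%num.

Record design := Design {
  d_type : nat * nat * nat;     (* (u, g, m) for the type g^u m^1 *)
  d_tracks : NN * NN * NN;      (* number of groups on the tracks, track length, step *)
  d_rest : seq (seq NN);        (* cycle lengths on each further group *)
  d_blocks : seq (NN * seq NN)  (* orbit length, and base blocks one after the other *)
}.

(** Groups on the tracks are residues modulo u1, the others are consecutive intervals. The last test
    bounds the number of blocks: V^2 minus the sum of the squared group sizes is the number of
    ordered pairs to cover. For m = 0 the list [l] has no last group. *)
Definition design_ok (d : design) : bool :=
  let: (u, g, m) := d_type d in
  let: (u1, n, st) := d_tracks d in
  let F := N.mul u1 (N.of_nat g) in
  let sizes := map nsum (d_rest d) in
  let cs := flatten (d_rest d) in
  let V := N.to_nat (N.add F (nsum sizes)) in
  let col x := if N.ltb x F then N.modulo x u1 else N.add u1 (block_index sizes (N.sub x F)) in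
  let s c := if N.ltb c u1 then N.modulo (N.add c st) u1 else c in
  let l := if m == 0 then nseq u g else rcons (nseq u g) m in
  let bs := base_blocks (d_blocks d) in
  let N0 := N.div n st in
  [&& params_ok V F n st N0 cs col s,
     blocks_ok V F n st cs col (fun c d => ~~ N.eqb c d) bs,
     cover_ok V F n st N0 cs col (fun c d => ~~ N.eqb c d) bs,
     all (fun x => N.ltb (col x) (N.of_nat (size l))) (nrange V),
     [seq count (fun x => N.eqb (col x) (N.of_nat k)) (nrange V) | k <- iota 0 (size l)] == l &
     N.leb (N.add (N.mul 12 (nsum (map fst bs))) (nsum [seq N.mul (N.of_nat x) (N.of_nat x) | x <- l]))
       (N.mul (N.of_nat V) (N.of_nat V))].

Lemma card_count V (p : pred NN) :
  #|[pred i : 'I_V | p (N.of_nat i)]| = count p (nrange V).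
Proof.
rewrite /nrange count_map -val_enum_ord count_map cardE size_filter enumT.
exact: eq_count.
Qed.

Lemma nsumE (T : Type) (f : T -> NN) s : N.to_nat (nsum (map f s)) = \sum_(x <- s) N.to_nat (f x).
Proof. by elim: s => [|x s IH]; rewrite ?big_nil // big_cons /= N2Nat.inj_add IH. Qed.

Lemma card_diff_colour (T : finType) (c : T -> nat) l :
  (forall k, #|[pred x | c x == k]| = nth 0 l k) ->
  #|[pred q : T * T | c q.1 != c q.2]| + \sum_(x <- l) x * x = #|T| * #|T|.
Proof.
move=> H; rewrite -card_prod -(cardC [pred q : T * T | c q.1 != c q.2]); congr (_ + _).
have cl x : c x < size l.
  rewrite ltnNge; apply/negP => lc; have := H (c x); rewrite nth_default //.
  by move/eqP/pred0P/(_ x); rewrite /= eqxx.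
rewrite (big_nth 0) big_mkord; apply: esym.
transitivity (\sum_(x : T) \sum_(y : T | c x == c y) 1).
  rewrite [RHS]pair_big_dep -sum1_card; apply: eq_bigl => -[x y]; by rewrite !inE negbK.
rewrite (partition_big (fun x => Ordinal (cl x)) predT) //=.
apply: eq_bigr => k _; rewrite (eq_bigr (fun=> nth 0 l k)) => [|x /eqP <-] /=.
  by rewrite sum_nat_const -{2}H; congr (_ * _); apply: eq_card => x; rewrite -val_eqE.
by rewrite sum1_card -H; apply: eq_card => y; rewrite !inE eq_sym.
Qed.

Lemma design_gdd d : design_ok d ->
  let: (u, g, m) := d_type d in gdd (rcons (nseq u g) m).
Proof.
rewrite /design_ok; case: (d_type d) => [[u g] m]; case: (d_tracks d) => [[u1 n] st].
set F := N.mul u1 _; set cs := flatten _; set V := N.to_nat _; set col := fun x => _.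
set s := fun c : NN => _; set l := if _ then _ else _; set bs := base_blocks _.
case/and5P => pok bok cok /allP lt /andP[/eqP cl /N.leb_le cnt].
suff : gdd l by rewrite /l; case: eqP => // ->; rewrite gdd_rcons0.
pose c (i : 'I_V) : nat := N.to_nat (col (N.of_nat i)).
have cE k : #|[pred i : 'I_V | c i == k]| = nth 0 l k.
  have [kl|kl] := ltnP k (size l); last first.
    rewrite nth_default //; apply/eqP/pred0P => i /=; apply/negbTE.
    have iV : N.of_nat i \in nrange V by rewrite mem_nrange; apply/N.ltb_lt; have := ltn_ord i; lia.
    have ci : N.lt (col (N.of_nat i)) (N.of_nat (size l)) by apply/N.ltb_lt/lt.
    by apply/eqP => e; move: kl ci; rewrite -e /c; move: (col _) (size l) => z p; lia.
  rewrite -[in RHS]cl (nth_map 0) ?size_iota // nth_iota // add0n -card_count.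
  have eK (z : NN) : (N.to_nat z == k) = N.eqb z (N.of_nat k) by apply/eqP/N.eqb_spec; lia.
  by apply: eq_card => i; apply: eK.
have eN (x y : 'I_V) : ~~ N.eqb (col (N.of_nat x)) (col (N.of_nat y)) = (c x != c y).
  by congr negb; apply/N.eqb_spec/eqP => [e|/N2Nat.inj //]; exact: (congr1 N.to_nat e).
apply/(gdd_dec (P := predT) (c := c)) => [k|]; first by rewrite -cE.
apply: dec_eq (check_dec _ _ _ pok bok cok _) => [x y|x y|x|x y|].
- by rewrite eN /restr.
- by rewrite N.eqb_sym.
- by rewrite N.eqb_refl.
- by apply: contra => /N.eqb_spec ->; rewrite N.eqb_refl.
- have := card_diff_colour cE; rewrite card_ord => E.
  rewrite (eq_card (B := [pred q : 'I_V * 'I_V | c q.1 != c q.2])) => [|q]; last first.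
    by rewrite !inE -eN.
  rewrite -(leq_add2r (\sum_(x <- l) x * x)) E.
  have e1 := nsumE fst bs; have e2 := nsumE (fun x => N.mul (N.of_nat x) (N.of_nat x)) l.
  rewrite -e1 (eq_bigr (fun x => N.to_nat (N.mul (N.of_nat x) (N.of_nat x)))) => [|x _]; last lia.
  rewrite -e2; move: (nsum _) (nsum _) cnt => A B; nia.
Qed.

Lemma table_gdd (ds : seq design) : all design_ok ds ->
  forall u g m, (u, g, m) \in map d_type ds -> gdd (rcons (nseq u g) m).
Proof.
elim: ds => //= d ds IH /andP[/design_gdd dok /IH H] u g m.
by rewrite inE => /predU1P[e|/H //]; rewrite -e in dok.
Qed.

(** * Inflation and filling of groups *)

Lemma gdd1111 : gdd [:: 1; 1; 1; 1].
Proof.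
exists [set setT]; split=> [b|b x y _ _ _|x y _].
- rewrite inE => /eqP ->; rewrite cardsT card_tagged sumnE big_map enumT.
  by rewrite -enumT !big_enum /= !big_ord_recl big_ord0 /= !card_ord.
- apply: contra_neq => /= xy; case: x y xy => [i x] [j y] /= ij.
  subst j; congr Tagged; case: i x y => [[|[|[|[|//]]]]] ? /= x y;
  by rewrite (ord1 x) (ord1 y).
- exists setT; rewrite ?inE //; split=> // b'; by rewrite inE => /eqP.
Qed.

Lemma gdd_td n : oa 4 n -> gdd (nseq 4 n).
Proof.
move=> On.
have := @gdd_oa 4 n (fun _ _ => 1) On.
have E (m : nat) : [seq m | j <- enum 'I_4] = nseq 4 m.
  by rewrite (map_enum_ord 4 (fun=> m)) /mkseq /=.
have S : \sum_(x < n) 1 = n by rewrite sum_nat_const card_ord muln1.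
by rewrite S !E => /(_ (fun _ => gdd1111)).
Qed.

(** Each block is replaced by a transversal design on the four sets of n copies of its points. *)
Lemma dec_inflate (A : finType) (e : rel A) n : (forall a, ~~ e a a) ->
  oa 4 n -> dec e -> wdec (fun=> n) e.
Proof.
move=> eN On [B [B4 Be eB]].
pose f (b : {set A}) : rel A := if b \in B then restr (mem b) id else (fun _ _ => false).
apply: (@wdec_union _ _ _ _ f) => // [b x y|x y exy|b].
- by rewrite /f; case: ifP => // bB /and3P[xb yb xy]; apply: Be bB xb yb xy.
- have [b bB [xb yb bU]] := eB _ _ exy.
  have xy : x != y by apply: contraTneq exy => ->.
  exists b; first by rewrite /f bB /restr /= xb yb.
  by move=> b'; rewrite /f; case: ifP => // bB' /and3P[]; auto.
- rewrite /f; case: ifP => bB; last by apply: dec0.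
  have sz : size (enum b) = 4 by rewrite -cardE B4.
  pose c (a : A) : 'I_4 := inord (index a (enum b)).
  have cI a a' : a \in b -> a' \in b -> (c a == c a') = (a == a').
    move=> ab ab'; apply/eqP/eqP => [/(congr1 val)|-> //].
    rewrite /= !inordK -?sz ?index_mem ?mem_enum //.
    by move/(congr1 (nth a (enum b))); rewrite !nth_index ?mem_enum.
  have E (k : 'I_4) : \sum_(a | (a \in b) && (c a == k)) n = n.
    have a0 : A by case: (enum b) sz => [|a s].
    rewrite (big_pred1 (nth a0 (enum b) k)) // => a /=.
    have kb : nth a0 (enum b) k \in b by rewrite -mem_enum mem_nth ?sz.
    have ck : c (nth a0 (enum b) k) = k.
      by rewrite /c index_uniq ?enum_uniq ?sz ?inord_val.
    have [ab|ab] := boolP (a \in b); first by rewrite -{1}ck cI.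
    by apply/esym/eqP => ea; rewrite ea kb in ab.
  apply: (@wdec_eq _ _ (restr (mem b) c)) => [x y|].
    by rewrite /restr /=; case: (boolP (x \in b)) => // xb; case: (boolP (y \in b)) => // yb; rewrite cI.
  apply/(gdd_wdec E); have := gdd_td On.
  by rewrite (map_enum_ord 4 (fun=> n)).
Qed.

Lemma gdd_inflate l n : oa 4 n -> gdd l -> gdd (map (muln n) l).
Proof.
move=> On gl; pose T := {i : 'I_(size l) & 'I_(nth 0 l i)}.
have H : wdec (fun=> n) (fun x y : T => tag x != tag y).
  by apply: dec_inflate On gl => a; rewrite eqxx.
have E (k : 'I_(size l)) : \sum_(a : T | predT a && (tag a == k)) n = n * nth 0 l k.
  rewrite sum_nat_const mulnC; congr (n * _); rewrite -(card_gdd_fibre l k).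
  by apply: eq_card => a; rewrite !inE /= (inj_eq val_inj).
have -> : map (muln n) l = [seq n * nth 0 l k | k : 'I_(size l) <- enum 'I_(size l)].
  rewrite (map_enum_ord _ (fun k => n * nth 0 l k)) /mkseq (map_comp (muln n) (nth 0 l)).
  by rewrite -/(mkseq _ _) mkseq_nth.
by apply/(gdd_wdec E).
Qed.

Lemma map_nseq (T U : Type) (f : T -> U) n x : map f (nseq n x) = nseq n (f x).
Proof. by elim: n => //= n ->. Qed.

Lemma gdd_inflate1 u g m n : oa 4 n -> gdd (rcons (nseq u g) m) ->
  gdd (rcons (nseq u (n * g)) (n * m)).
Proof. by move=> On /(gdd_inflate On); rewrite map_rcons map_nseq. Qed.

Lemma gdd_flex1 u g n lo hi : oa u.+1 n ->
  (forall i, i <= hi -> gdd (rcons (nseq u g) (lo + 3 * i))) ->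
  forall t, t <= n * hi -> gdd (rcons (nseq u (n * g)) (n * lo + 3 * t)).
Proof.
move=> On H t tn; have := @gdd_flex (nseq u g) n lo hi.
by rewrite size_nseq map_nseq; apply.
Qed.

(** A group of size g * b i is cut into b i groups of size g and carries an ingredient together with
    m0 new points. All ingredients share the new points, which join the old last group. *)
Lemma gdd_fill n (b : 'I_n -> nat) g M m0 :
  gdd (rcons [seq g * b i | i <- enum 'I_n] M) ->
  (forall i, gdd (rcons (nseq (b i) g) m0)) ->
  gdd (rcons (nseq (\sum_i b i) g) (M + m0)).
Proof.
move=> HM Hf.
pose C : finType := {i : 'I_n & 'I_(b i)}.
(* The boolean separates the M old points of the last group ([true]) from the m0 new ones
   ([false]). *)
pose A : finType := (C + bool)%type.
pose w (a : A) := match a with inl _ => g | inr true => M | inr false => m0 end.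
pose c (a : A) : option C := match a with inl x => Some x | inr _ => None end.
have cC : #|C| = \sum_i b i.
  by rewrite card_tagged sumnE big_map big_enum /=; apply: eq_bigr => i _; rewrite card_ord.
have E (k : option C) : \sum_(a | predT a && (c a == k)) w a =
    (if k is Some _ then g else M + m0).
  rewrite big_sumType [X in _ + X = _]big_mkcond big_bool /=; case: k => [x|] /=.
    by rewrite !addn0 (big_pred1 x).
  by rewrite big_pred0.
rewrite -cC; apply/(@gdd_opt C g (M + m0) (fun k => if k is Some _ then g else M + m0)) => //.
apply/(gdd_wdec E).
pose P (i : option 'I_n) (a : A) := match i, a with
  | None, inl _ => true | None, inr t => t
  | Some i, inl x => tag x == i | Some i, inr t => ~~ t end.
pose c0 (a : A) : option 'I_n := match a with inl x => Some (tag x) | inr _ => None end.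
pose f i : rel A := if i is Some _ then restr (P i) c else restr (P i) c0.
apply: (@wdec_union _ _ _ _ f) => [a|i a a'|a a'|i].
- by rewrite /restr eqxx.
- case: i a a' => [i|] [x|t] [x'|t'] /and3P[] //=; rewrite /restr /= !(inj_eq (@Some_inj _)) //.
  by move=> _ _; apply: contra_neq => ->.
- case: a a' => [x|t] [x'|t']; rewrite /restr /= ?(inj_eq (@Some_inj _)) // => xx.
  + have [tt|tt] := eqVneq (tag x) (tag x').
      exists (Some (tag x)); first by rewrite /= /restr /= tt eqxx (inj_eq (@Some_inj _)).
      case=> [j|] /and3P[] //=; first by move=> /eqP ->.
      by rewrite tt eqxx.
    exists None; first by rewrite /= /restr /= (inj_eq (@Some_inj _)).
    by case=> [j|//] /and3P[/= /eqP e1 /eqP e2 _]; rewrite e1 e2 eqxx in tt.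
  + case: t' => [|]; [exists None => // | exists (Some (tag x)); first by rewrite /= /restr /= eqxx].
      by case=> [j|//] /and3P[].
    by case=> [j|] /and3P[] //= /eqP ->.
  + case: t xx => xx; [exists None => // | exists (Some (tag x')); first by rewrite /= /restr /= eqxx].
      by case=> [j|//] /and3P[].
    by case=> [j|] /and3P[] //= _ /eqP ->.
- case: i => [i|] /=.
    (* Points of other groups get [ord_max], which lies outside ['I_(b i)], so that [insub] returns
       [None] for them. *)
    pose D (x : C) : 'I_(b i).+1 := if tag x == i then inord (tagged x : nat) else ord_max.
    pose c1 (a : A) : option 'I_(b i) := if a is inl x then insub (val (D x)) else None.
    have E' (k : option 'I_(b i)) : \sum_(a | P (Some i) a && (c1 a == k)) w a =
       (if k is Some _ then g else m0).
      rewrite big_sumType [X in _ + X = _]big_mkcond big_bool /=; case: k => [j|] /=.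
        rewrite !addn0 (big_pred1 (Tagged (fun i => 'I_(b i)) j)) // => -[i' x] /=.
        rewrite /D /=; case: eqP => [ii|ii] /=; last by apply/esym/eqP => -[/ii].
        subst i'; rewrite inordK ?ltnS ?(ltnW (ltn_ord _)) // valK (inj_eq (@Some_inj _)).
        by rewrite eq_Tagged.
      rewrite big1 // => -[i' x] /=; rewrite /D /=; case: eqP => // ii; subst i'.
      by rewrite inordK ?ltnS ?(ltnW (ltn_ord _)) // valK.
    apply: (@wdec_eq _ _ (restr (P (Some i)) c1)).
      have cK (x : 'I_(b i)) : insub (nat_of_ord (inord x : 'I_(b i).+1)) = Some x.
        by rewrite inordK ?ltnS ?(ltnW (ltn_ord _)) // valK.
      case=> [[i1 x]|t] [[i2 y]|t']; rewrite /restr /= /D /= //.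
      + case: (eqVneq i1 i) => // e1; case: (eqVneq i2 i) => // e2; subst i1 i2.
        by rewrite !cK !(inj_eq (@Some_inj _)) eq_Tagged.
      + by case: (eqVneq i1 i) => // e1; subst i1; rewrite cK.
      + by case: (eqVneq i2 i) => // e2; subst i2; rewrite cK.
    apply/(gdd_wdec E')/(@gdd_opt 'I_(b i) g m0) => //; rewrite card_ord; exact: Hf.
  have E' (k : option 'I_n) : \sum_(a | P None a && (c0 a == k)) w a =
     (if k is Some i then g * b i else M).
    rewrite big_sumType [X in _ + X = _]big_mkcond big_bool /=; case: k => [j|] /=.
      rewrite !addn0 sum_nat_const mulnC; congr (g * _).
      rewrite -[RHS]card_ord -(card_codom (f := fun x : 'I_(b j) => Tagged (fun i => 'I_(b i)) x)).
        apply: eq_card => -[i' x]; rewrite unfold_in /=.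
        apply/eqnP/codomP => [/val_inj ii|[y /(congr1 tag) /= ->]] //.
        by subst i'; exists x.
      by move=> x y /eqP; rewrite eq_Tagged /= => /eqP.
    by rewrite big_pred0 // addn0.
  by apply/(gdd_wdec E')/gdd_option.
Qed.

(** * Arrays from finite fields and MacNeish's product *)

Definition oa_on k (T : finType) : Prop := exists f : T -> T -> 'I_k -> T,
  forall i j a b a' b', i != j ->
    f a b i = f a' b' i -> f a b j = f a' b' j -> a = a' /\ b = b'.

Lemma oa_on_oa k (T : finType) : oa_on k T -> oa k #|T|.
Proof.
case=> f Hf; exists (fun a b i => enum_rank (f (enum_val a) (enum_val b) i)).
move=> i j a b a' b' ij /enum_rank_inj ei /enum_rank_inj ej.
by have [/enum_val_inj -> /enum_val_inj ->] := Hf _ _ _ _ _ _ ij ei ej.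
Qed.

Lemma oa_mul k m n : oa k m -> oa k n -> oa k (m * n).
Proof.
case=> f Hf [g Hg].
suff /oa_on_oa : oa_on k ('I_m * 'I_n)%type by rewrite card_prod !card_ord.
exists (fun a b i => (f a.1 b.1 i, g a.2 b.2 i)).
move=> i j [a1 a2] [b1 b2] [a1' a2'] [b1' b2'] /= ij [fi gi] [fj gj].
by have [-> ->] := Hf _ _ _ _ _ _ ij fi fj; have [-> ->] := Hg _ _ _ _ _ _ ij gi gj.
Qed.

Import GRing.Theory.

(** Rows are the affine functions x |-> b + x d evaluated at k field elements, so two rows agreeing
    twice are equal. The slope d is the class, and slope 0 gives the constant rows. *)
Lemma roa_field k (F : finFieldType) : k <= #|F| -> roa k #|F|.
Proof.
move=> kF; pose c (j : 'I_k) : F := enum_val (widen_ord kF j).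
have cI i j : c i = c j -> i = j.
  by move=> /enum_val_inj /(congr1 val) /= /val_inj.
exists (fun d b j => enum_rank (enum_val b + c j * enum_val d)%R).
  split=> [i j d b d' b' ij /enum_rank_inj ei /enum_rank_inj ej|d j b b' /enum_rank_inj].
    have : ((c i - c j) * (enum_val d - enum_val d') = 0)%R.
      have K (u v t : F) : (u - v = (t + u) - (t + v))%R by rewrite opprD addrACA subrr add0r.
      rewrite mulrBr !mulrBl (K (c i * _)%R _ (enum_val b)) (K _ (c j * enum_val d')%R (enum_val b')).
      by rewrite ei ej subrr.
    move/eqP; rewrite mulf_eq0 !subr_eq0 => /orP[/eqP/cI e|/eqP/enum_val_inj dd].
      by rewrite e eqxx in ij.
    by move: ei; rewrite dd => /addIr /enum_val_inj.
  by move=> /addIr /enum_val_inj.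
by exists (enum_rank 0%R) => b j; rewrite enum_rankK mulr0 addr0 enum_valK.
Qed.

Lemma roa_prime_power k p m : prime p -> 0 < m -> k <= p ^ m -> roa k (p ^ m).
Proof.
move=> pp m0; have [F _ <-] := PrimePowerField pp m0; exact: roa_field.
Qed.

Lemma oa1 k : oa k 1.
Proof. by exists (fun _ _ _ => ord0) => i j a b a' b' *; rewrite !ord1. Qed.

(** MacNeish's product over the prime powers in n. The field of order p^l gives p^l + 1 columns, one
    of them being the class index. *)
Lemma oa_macneish k n : 0 < n ->
  (forall p, p \in primes n -> k <= (p ^ logn p n).+1) -> oa k n.
Proof.
move=> n0 H; rewrite [n]prod_prime_decomp // prime_decompE big_map /=.
have : all (fun p => prime p && (0 < logn p n)) (primes n).
  by apply/allP => p pn; rewrite logn_gt0 pn andbT; move: pn; rewrite mem_primes => /and3P[].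
elim: (primes n) H => [|p s IH] H /=; first by rewrite big_nil => _; apply: oa1.
case/andP=> /andP[pp l0] /IH {}IH; rewrite big_cons; apply: oa_mul; last first.
  by apply: IH => r rs; apply: H; rewrite inE rs orbT.
have := H p (mem_head _ _); case: k {H IH} => [|k] kp.
  by exists (fun _ a _ => a) => -[].
by apply/roa_oa/roa_prime_power.
Qed.

(** * Holey designs and graphs pulled back along a colouring *)

Lemma gdd_nz l l' : filter (leq 1) l = filter (leq 1) l' -> gdd l -> gdd l'.
Proof.
have E s : perm_eq s (filter (leq 1) s ++ nseq (count (fun x => ~~ (0 < x)) s) 0).
  elim: s => //= x s IH; case: x => [|x] /=; last by rewrite perm_cons.
  apply: (@perm_trans _ (0 :: (filter (leq 1) s ++ nseq (count (fun x => ~~ (0 < x)) s) 0))).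
    by rewrite perm_cons.
  by rewrite (permEl (perm_catCA [:: 0] _ _)).
have Z s k : gdd (s ++ nseq k 0) <-> gdd s.
  suff H : nth 0 (s ++ nseq k 0) =1 nth 0 s by split; apply: gdd_nth.
  move=> i; rewrite nth_cat; case: ltnP => // si.
  by rewrite nth_nseq if_same nth_default.
move=> e /(gdd_perm (E l)) /Z; rewrite e => /Z H.
by apply: gdd_perm (H _); rewrite perm_sym; apply: E.
Qed.

Lemma wdec_emb (A A' : finType) (w : A -> nat) (w' : A' -> nat) (e : rel A) (e' : rel A')
    (f : A -> A') (fw : forall a, w a = w' (f a)) :
  injective f -> (forall x y, e x y = e' (f x) (f y)) ->
  (forall x y, e' x y -> exists z t, x = f z /\ y = f t) ->
  wdec w e -> wdec w' e'.
Proof.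
move=> fI fe ef.
pose F (p : {a : A & 'I_(w a)}) : {a : A' & 'I_(w' a)} :=
  Tagged (fun a => 'I_(w' a)) (cast_ord (fw (tag p)) (tagged p)).
apply: (dec_inj (f := F)) => [[a x] [b y]|[a x] [b y]|[a x] [b y]] /=.
- move=> e0; have ab : a = b by apply: fI; apply: (congr1 tag e0).
  subst b; move/eqP: e0; rewrite eq_Tagged /= => /eqP /cast_ord_inj -> //.
- exact: fe.
- move=> /ef [z [t [az bt]]]; subst a b.
  exists (Tagged (fun a => 'I_(w a)) (cast_ord (esym (fw z)) x)),
         (Tagged (fun a => 'I_(w a)) (cast_ord (esym (fw t)) y)).
  by rewrite /F /= !cast_ordKV.
Qed.

Lemma sum_option (T : finType) (F : option T -> nat) :
  \sum_a F a = F None + \sum_x F (Some x).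
Proof.
rewrite (bigD1 None) //; congr (_ + _); rewrite (reindex_omap some id) => [|[]//].
by apply: eq_bigl => x; rewrite /= eqxx.
Qed.

(* The groups are the fibres of grp; blocks avoid pairs in a common fibre of hole,
   and each such fibre is filled with a design of type (s w)^v m^1 on the
   new points. *)
Lemma gdd_holes (T : finType) u nh (grp : T -> 'I_u) (hole : T -> 'I_nh) w c0 v s m :
  0 < s -> oa 4 s ->
  dec (fun x y => (grp x != grp y) && (hole x != hole y)) ->
  (forall k, #|[pred x | grp x == k]| = c0) ->
  (forall h, [seq k <- [seq #|[pred x | (hole x == h) && (grp x == k)]| | k <- enum 'I_u] | 0 < k]
     = nseq v w) -> 0 < w ->
  gdd (rcons (nseq v (s * w)) m) -> gdd (rcons (nseq u (s * c0)) m).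
Proof.
move=> s0 Os De cg ch w0 gv.
pose A : finType := option T.
pose wA (a : A) := if a is Some _ then s else m.
pose c (a : A) : option 'I_u := if a is Some x then Some (grp x) else None.
have sumA (Q : pred A) : \sum_(a | Q a) wA a = (if Q None then m else 0) + \sum_(x | Q (Some x)) s.
  by rewrite big_mkcond sum_option /= -big_mkcond.
have E (k : option 'I_u) : \sum_(a | predT a && (c a == k)) wA a = if k is Some _ then s * c0 else m.
  rewrite sumA /=; case: k => [k|] /=; last by rewrite big_pred0 ?addn0.
  rewrite sum_nat_const mulnC add0n -(cg k); congr (s * _); apply: eq_card.
rewrite -[X in nseq X _]card_ord.
apply/(@gdd_opt 'I_u (s * c0) m (fun k => if k is Some _ then s * c0 else m)) => //.
apply/(gdd_wdec E).
pose P h (a : A) := if a is Some x then hole x == h else true.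
pose f (i : option 'I_nh) : rel A := match i with Some h => restr (P h) c
  | None => fun a b => match a, b with Some x, Some y => (grp x != grp y) && (hole x != hole y)
     | _, _ => false end end.
apply: (@wdec_union _ _ _ _ f) => [a|i a a'|a a'|i].
- by rewrite /restr eqxx.
- case: i => [h|]; first by move=> /and3P[].
  by case: a a' => [x|] [y|] //= /andP[xy _]; rewrite /restr /= ?(inj_eq (@Some_inj _)).
- case: a a' => [x|] [y|] //; rewrite /restr /= ?(inj_eq (@Some_inj _)) // => xy.
  + have [hh|hh] := eqVneq (hole x) (hole y).
      exists (Some (hole y)); first by rewrite /= /restr /= hh eqxx ?(inj_eq (@Some_inj _)).
      case=> [h|] /=; last by rewrite hh eqxx andbF.
      by move=> /and3P[/= _ /eqP ->].
    exists None; first by rewrite /= xy hh.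
    by case=> [h|//] /and3P[/= /eqP e1 /eqP e2 _]; rewrite e1 e2 eqxx in hh.
  + exists (Some (hole x)); first by rewrite /= /restr /= eqxx.
    by case=> [h|//] /and3P[/= /eqP ->].
  + exists (Some (hole y)); first by rewrite /= /restr /= eqxx.
    by case=> [h|//] /and3P[/= _ /eqP ->].
- case: i => [h|] /=; last first.
    apply: (@wdec_emb T A (fun=> s) wA (fun x y => (grp x != grp y) && (hole x != hole y)) _ some) => //.
    + by move=> x y [].
    + by case=> [x|] [y|] // _; exists x, y.
    + by apply: dec_inflate De => // a; rewrite eqxx.
  have E' (k : option 'I_u) : \sum_(a | P h a && (c a == k)) wA a =
      if k is Some k then s * #|[pred x | (hole x == h) && (grp x == k)]| else m.
    rewrite sumA /=; case: k => [k|] /=; last by rewrite big_pred0 ?addn0 // => x; rewrite andbF.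
    rewrite sum_nat_const mulnC add0n; congr (s * _); apply: eq_card.
  apply/(gdd_wdec E')/gdd_option => /=; apply: gdd_nz gv.
  rewrite !filter_rcons.
  rewrite (map_comp (muln s) (fun k => #|[pred x | (hole x == h) && (grp x == k)]|)).
  rewrite (filter_map (muln s)) (eq_filter (a2 := leq 1)) => [|x] /=; last by rewrite muln_gt0 s0.
  by rewrite ch map_nseq filter_nseq muln_gt0 s0 w0 mul1n.
Qed.

(** Adjacency depends on colours alone, so a colour-preserving bijection transports blocks; unlike
    in [dec_restr], the relation between colours is arbitrary. *)
Lemma dec_fibre (T T' : finType) (C : eqType) (r : rel C) (c : T -> C) (c' : T' -> C) :
  (forall k, #|[pred x | c x == k]| = #|[pred x | c' x == k]|) ->
  dec (fun x y => r (c x) (c y)) -> dec (fun x y => r (c' x) (c' y)).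
Proof.
move=> H; have [|f [fI fS fc]] := @fibre_bij T T' predT predT C c c'; first exact: H.
apply: (@dec_inj _ _ _ _ (fun x => val (f (Sub x isT)))) => [x y|x y|x y _].
- by move/val_inj/fI/(congr1 val).
- by rewrite !fc.
- have [[z zP] xz] := fS (Sub x isT); have [[t tP] yt] := fS (Sub y isT).
  exists z, t; rewrite [isT](bool_irrelevance _ zP) -xz.
  by rewrite [zP](bool_irrelevance _ tP) -yt.
Qed.

Lemma wdec_fibre (T A : finType) (r : rel A) (c : T -> A) w :
  (forall a, #|[pred x | c x == a]| = w a) ->
  dec (fun x y => r (c x) (c y)) -> wdec w r.
Proof.
move=> H; apply: dec_fibre => a; rewrite H (card_weight w (pred1 a)) big_pred1_eq //.
Qed.

Lemma card_edges V (e : rel NN) :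
  #|[pred q : 'I_V * 'I_V | e (N.of_nat q.1) (N.of_nat q.2)]| =
  N.to_nat (nsum [seq N.of_nat (count (e x) (nrange V)) | x <- nrange V]).
Proof.
rewrite nsumE big_map -val_enum_ord big_map big_enum /=.
transitivity (\sum_(x < V) \sum_(y < V | e (N.of_nat x) (N.of_nat y)) 1).
  by rewrite pair_big_dep -sum1_card; apply: eq_bigl.
apply: eq_bigr => x _; rewrite Nat2N.id -card_count sum1_card.
exact: eq_card.
Qed.

(** The graph need not be complete multipartite here, so its edges are counted directly and not
    through group sizes. *)
Definition develop_ok V F n N0 cs (C : eqType) (col : NN -> C) r s bs :=
  [&& params_ok V F n 1 N0 cs col s, blocks_ok V F n 1 cs col r bs,
     cover_ok V F n 1 N0 cs col r bs &
     N.leb (N.mul 12 (nsum (map fst bs)))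
       (nsum [seq N.of_nat (count (fun y => r (col x) (col y)) (nrange V)) | x <- nrange V])].

Lemma develop_dec V F n N0 cs (C : eqType) (col : NN -> C) r s bs :
  symmetric r -> irreflexive r -> (forall c d, r (s c) (s d) -> r c d) ->
  develop_ok V F n N0 cs col r s bs ->
  dec (fun x y : 'I_V => r (col (N.of_nat x)) (col (N.of_nat y))).
Proof.
move=> rC rI rs /and4P[p1 p2 p3 /N.leb_le p4]; apply: check_dec rC rI rs p1 p2 p3 _.
rewrite (card_edges V (fun x y => r (col x) (col y))).
have e1 := nsumE fst bs; rewrite -e1; move: (nsum _) (nsum _) p4 => A B; lia.
Qed.

(** [sg] and [sh] are the actions of the automorphism on groups and holes. Each hole must meet
    exactly v groups, in w points each, so that one ingredient fills all holes. *)
Definition check_holes V F n N0 cs (grp hole sg sh : NN -> NN) u c0 nh v w bs :=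
  [&& develop_ok V F n N0 cs (fun x => (grp x, hole x))
     (fun c d => ~~ N.eqb c.1 d.1 && ~~ N.eqb c.2 d.2) (fun c => (sg c.1, sh c.2)) bs,
   all (fun x => N.ltb (grp x) (N.of_nat u) && N.ltb (hole x) (N.of_nat nh)) (nrange V),
   all (fun k => count (fun x => N.eqb (grp x) (N.of_nat k)) (nrange V) == c0) (iota 0 u) &
   all (fun h => filter (leq 1)
     [seq count (fun x => N.eqb (hole x) (N.of_nat h) && N.eqb (grp x) (N.of_nat k))
       (nrange V) | k <- iota 0 u] == nseq v w) (iota 0 nh)].

Lemma holes_gdd V F n N0 cs grp hole sg sh u c0 nh v w bs :
  check_holes V F n N0 cs grp hole sg sh u c0 nh v w bs ->
  0 < w -> forall s m, 0 < s -> oa 4 s ->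
  gdd (rcons (nseq v (s * w)) m) -> gdd (rcons (nseq u (s * c0)) m).
Proof.
case/and4P => ck /allP lt /allP cg /allP ch w0 s m s0 Os.
have r (i : 'I_V) : N.of_nat i \in nrange V by rewrite /nrange map_f ?mem_iota ?add0n /=.
have lg (i : 'I_V) : N.to_nat (grp (N.of_nat i)) < u.
  by have /andP[/BinNat.N.ltb_lt ? _] := lt _ (r i); lia.
have lh (i : 'I_V) : N.to_nat (hole (N.of_nat i)) < nh.
  by have /andP[_ /BinNat.N.ltb_lt ?] := lt _ (r i); lia.
have eN (x : NN) (k : nat) : (N.to_nat x == k) = N.eqb x (N.of_nat k).
  by apply/eqP/BinNat.N.eqb_spec; lia.
apply: (@gdd_holes _ u nh (fun i => Ordinal (lg i)) (fun i => Ordinal (lh i))) => //.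
- apply: dec_eq (develop_dec _ _ _ ck) => [x y|x y|x|x y] /=.
  + by rewrite -!(inj_eq val_inj) /= !eN !N2Nat.id.
  + by rewrite (N.eqb_sym x.1) (N.eqb_sym x.2).
  + by rewrite N.eqb_refl.
  + by case/andP => xy1 xy2; apply/andP; split; [move: xy1|move: xy2];
    apply: contra => /N.eqb_spec ->; rewrite N.eqb_refl.
- move=> k; rewrite -(eqP (cg k _)) ?mem_iota ?ltn_ord // -card_count.
  by apply: eq_card => x; rewrite !inE -(inj_eq val_inj) /= eN.
- move=> h; rewrite -(eqP (ch h _)) ?mem_iota ?ltn_ord // -val_enum_ord -map_comp.
  congr filter; apply: eq_map => k /=; rewrite -card_count.
  by apply: eq_card => x; rewrite !inE -!(inj_eq val_inj) /= !eN.
Qed.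

(* Each point of T has weight 6 + 3: six ordinary points, and three points any two of
   which are never joined. *)
Definition frame (T : finType) (C : eqType) (h : T -> C) : Prop :=
  wdec (fun a : T * bool => if a.2 then 6 else 3)
    (fun a b => (h a.1 != h b.1) && (a.2 || b.2)).

(** * Frames and the extremal types 6^n (3(n-1))^1 *)

Definition check_frame V F n N0 cs (grp : NN -> NN) (fin : pred NN) sg k bs :=
  [&& develop_ok V F n N0 cs (fun x => (grp x, fin x))
     (fun c d => ~~ N.eqb c.1 d.1 && (c.2 || d.2)) (fun c => (sg c.1, c.2)) bs,
   all (fun x => N.ltb (grp x) (N.of_nat k)) (nrange V) &
   all (fun i => (count (fun x => N.eqb (grp x) (N.of_nat i) && fin x) (nrange V) == 6) &&
     (count (fun x => N.eqb (grp x) (N.of_nat i) && ~~ fin x) (nrange V) == 3)) (iota 0 k)].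

Lemma check_frame_frame V F n N0 cs grp fin sg k bs :
  check_frame V F n N0 cs grp fin sg k bs -> frame (fun i : 'I_k => i).
Proof.
case/and3P => ck /allP lt /allP cn.
have r (i : 'I_V) : N.of_nat i \in nrange V by rewrite /nrange map_f ?mem_iota ?add0n /=.
have lg (i : 'I_V) : N.to_nat (grp (N.of_nat i)) < k.
  by have /N.ltb_lt ? := lt _ (r i); lia.
have eN (x : NN) (j : nat) : (N.to_nat x == j) = N.eqb x (N.of_nat j).
  by apply/eqP/BinNat.N.eqb_spec; lia.
apply: (wdec_fibre (c := fun i : 'I_V => (Ordinal (lg i), fin (N.of_nat i)))) => [[i t]|] /=.
  have /andP[/eqP c6 /eqP c3] := cn i ltac:(by rewrite mem_iota /=).
  case: t; [rewrite -[RHS]c6|rewrite -[RHS]c3]; rewrite -card_count; apply: eq_card => x;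
  by rewrite !inE xpair_eqE -(inj_eq val_inj) /= eN; case: (fin _).
apply: dec_eq (develop_dec _ _ _ ck) => [x y|x y|x|x y] /=.
+ by rewrite -!(inj_eq val_inj) /= !eN !N2Nat.id.
+ by rewrite (N.eqb_sym x.1) orbC.
+ by rewrite N.eqb_refl.
+ by case/andP => xy ->; rewrite andbT; apply: contra xy => /N.eqb_spec ->; rewrite N.eqb_refl.
Qed.

Lemma frame_inflate k n : oa 4 n -> frame (fun i : 'I_k => i) ->
  frame (fun p : 'I_k * 'I_n => p.1).
Proof.
move=> On fk; pose w (a : 'I_k * bool) := if a.2 then 6 else 3.
pose w' (a : 'I_k * 'I_n * bool) := if a.2 then 6 else 3.
pose r (a b : 'I_k * bool) := (a.1 != b.1) && (a.2 || b.2).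
have : wdec (fun=> n) (fun x y : {a & 'I_(w a)} => r (tag x) (tag y)).
  by apply: dec_inflate On fk => a; rewrite eqxx.
apply: (dec_fibre (r := r) (c := fun x : {b : {a & 'I_(w a)} & 'I_n} => tag (tag x))
   (c' := fun x : {a & 'I_(w' a)} => ((tag x).1.1, (tag x).2))) => -[i t].
rewrite (card_weight (fun=> n) (fun b : {a & 'I_(w a)} => tag b == (i, t))).
rewrite (card_weight w' (fun a : 'I_k * 'I_n * bool => (a.1.1, a.2) == (i, t))).
rewrite sum_nat_const (card_weight w (pred1 (i, t))) big_pred1_eq.
rewrite (eq_bigr (fun=> w (i, t))) => [|[[j x] t'] /eqP[_ ->] //].
rewrite sum_nat_const mulnC; congr (_ * _).
rewrite -[LHS]card_ord -(card_codom (f := fun x : 'I_n => (i, x, t))); last by move=> x y [].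
apply: eq_card => -[[j x] t'].
apply/codomP/idP => [[y [-> _ ->]]|/andP[/eqP /= -> /eqP /= ->]]; last by exists x.
by rewrite unfold_in /= !eqxx.
Qed.

(** The last group is as large as possible, so every block meets it. Without it, triples on 6^n
    remain, and each deleted point yields a parallel class: this is a resolvable 3-GDD of type
    6^n. *)
Definition X6 n := gdd (rcons (nseq n 6) (3 * n.-1)).

Lemma sum_pair_bool (T : finType) (F : T * bool -> nat) :
  \sum_a F a = \sum_x F (x, true) + \sum_x F (x, false).
Proof.
rewrite (eq_bigr (fun p => (fun x t => F (x, t)) p.1 p.2)) => [|[] //].
rewrite -(pair_bigA _ (fun x t => F (x, t))) -big_split.
by apply: eq_bigr => x _; rewrite big_bool.
Qed.

Lemma filter_map_enum (T : finType) (P : pred T) c (f : T -> nat) :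
  (forall x, f x = if P x then c.+1 else 0) ->
  filter (leq 1) (map f (enum T)) = nseq #|[pred x | P x]| c.+1.
Proof.
move=> H; have -> : #|[pred x | P x]| = count P (Finite.enum T).
  by rewrite cardE size_filter; apply: eq_count.
by rewrite enumT; elim: (Finite.enum T) => //= x s ->; rewrite H; case: (P x).
Qed.

(** The points of the three-point parts are the partial parallel classes of a 3-frame, each missing
    one fibre of h. A further group of size 6 is added; each fibre with this group is filled by the
    extremal design for one group more than the fibre has points. The three-point parts together
    form the last group. *)
Lemma X6_frame (T C : finType) (h : T -> C) : frame h ->
  (forall k, X6 #|[pred x | h x == k]|.+1) -> X6 #|T|.+1.
Proof.
move=> fh Hk.
pose A : finType := (T * bool + unit)%type.
pose wA (a : A) := match a with inl (_, t) => if t then 6 else 3 | inr _ => 6 end.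
pose c (a : A) : option (option T) := match a with
  | inl (p, t) => if t then Some (Some p) else None | inr _ => Some None end.
have sumA (Q : pred A) : \sum_(a | Q a) wA a = \sum_(x | Q (inl (x, true))) 6
     + \sum_(x | Q (inl (x, false))) 3 + (if Q (inr tt) then 6 else 0).
  by rewrite big_mkcond big_sumType /= sum_pair_bool (big_pred1 tt) => [|[] //]; rewrite -!big_mkcond.
have E k : \sum_(a | predT a && (c a == k)) wA a = if k is Some _ then 6 else 3 * #|T|.
  rewrite sumA /=; case: k => [[x|]|] /=.
  - by rewrite (big_pred1 x) // big_pred0.
  - by rewrite !big_pred0.
  - by rewrite big_pred0 // sum_nat_const mulnC addn0.
suff /(gdd_wdec E) : wdec wA (restr predT c).
  rewrite gdd_option [X in gdd (rcons X _)](_ : _ = nseq #|T|.+1 6) //.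
  rewrite -[#|T|.+1](card_option T) cardE; elim: (enum _) => //= a l ->//.
pose P k (a : A) := match a with inl (x, _) => h x == k | inr _ => true end.
pose f (i : option C) : rel A := match i with Some k => restr (P k) c
  | None => fun a b => match a, b with inl (x, t), inl (y, s) => (h x != h y) && (t || s)
     | _, _ => false end end.
apply: (@wdec_union _ _ _ _ f) => [a|i a a'|a a'|i].
- by rewrite /restr eqxx.
- case: i => [k|]; first by move=> /and3P[].
  case: a a' => [[x t]|?] [[y s]|?] //= /andP[xy ts]; rewrite /restr /=.
  case: t ts => //=; case: s => //= _; apply: contra_neq xy => -[->] //.
- case: a a' => [[x t]|[]] [[y s]|[]] //; rewrite /restr /= => xy.
  + have [hh|hh] := eqVneq (h x) (h y).
      exists (Some (h y)); first by rewrite /= /restr /= hh eqxx.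
      case=> [k|] /=; last by rewrite hh eqxx.
      by move=> /and3P[/= _ /eqP ->].
    exists None; first by rewrite /= hh; case: t s xy => [] [].
    by case=> [k|//] /and3P[/= /eqP e1 /eqP e2 _]; rewrite e1 e2 eqxx in hh.
  + exists (Some (h x)); first by rewrite /= /restr /= eqxx.
    by case=> [k|//] /and3P[/= /eqP ->].
  + exists (Some (h y)); first by rewrite /= /restr /= eqxx.
    by case=> [k|//] /and3P[/= _ /eqP ->].
- case: i => [k|] /=; last first.
    apply: (@wdec_emb (T * bool)%type A (fun a => if a.2 then 6 else 3) wA
      (fun a b => (h a.1 != h b.1) && (a.2 || b.2)) _ inl _ _ _ _ fh) => [[x []] //|x y [] //|[x t] [y s] //|].
    by case=> [[x t]|?] [[y s]|?] //= _; exists (x, t), (y, s).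
  have E' (j : option (option T)) : \sum_(a | P k a && (c a == j)) wA a =
      match j with Some (Some x) => if h x == k then 6 else 0 | Some None => 6
        | None => 3 * #|[pred x | h x == k]| end.
    rewrite sumA /=; case: j => [[x|]|] /=.
    + rewrite [X in _ + X + _]big_pred0 => [|y]; last by rewrite andbF.
      rewrite !addn0 (eq_bigl (fun y => (h x == k) && (y == x))) => [|y].
        by case: (h x == k); rewrite /= ?big_pred1_eq ?big_pred0_eq.
      by apply/andP/andP => -[e1 e2]; move: (eqP e2) e1 => /= [->].
    + by rewrite !big_pred0 => [|x|x]; rewrite ?andbF.
    + rewrite big_pred0 => [|x]; last by rewrite andbF.
      rewrite add0n addn0 (eq_bigl (fun x => h x == k)) => [|x]; last by rewrite andbT.
      by rewrite sum_nat_const mulnC.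
  apply/(gdd_wdec E'); rewrite !gdd_option.
  apply: gdd_nz (Hk k); rewrite !filter_rcons.
  rewrite (@filter_map_enum _ (fun c : option T => if c is Some x then h x == k else true) 5) => [|[x|] //].
  rewrite filter_nseq mul1n; suff -> : #|[pred c : option T | if c is Some x then h x == k else true]|
    = #|[pred x | h x == k]|.+1 by [].
  by rewrite -!sum1_card [LHS]big_mkcond sum_option /= -big_mkcond.
Qed.

(** Wilson's construction with truncated groups: as the first four groups are complete, each row
    keeps between 4 and r points, and it carries a frame with one fibre per point. *)
Lemma frame_td r x (sz : 'I_r -> nat) : oa r x ->
  (forall j : 'I_r, j < 4 -> sz j = x) -> 4 <= r ->
  (forall k, 4 <= k <= r -> frame (fun i : 'I_k => i)) ->
  frame (fun p : {p : 'I_r * 'I_x | p.2 < sz p.1} => (val p).1).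
Proof.
case=> F HF s4 r4 Hk; pose T := {p : 'I_r * 'I_x | p.2 < sz p.1}.
pose on (ab : 'I_x * 'I_x) (p : T) := (val p).2 == F ab.1 ab.2 (val p).1.
pose f (ab : 'I_x * 'I_x) : rel (T * bool) := fun p q =>
  [&& on ab p.1, on ab q.1, (val p.1).1 != (val q.1).1 & p.2 || q.2].
apply: (@wdec_union _ _ _ _ f) => [[p t]|ab p q|[p t] [q s] /= /andP[pq ts]|[a b]].
- by rewrite eqxx.
- by move=> /and4P[_ _ -> ->].
- have [a [b [ea eb]]] := oa_surj (fun a b a' b' => HF _ _ a b a' b' pq) (val p).2 (val q).2.
  exists (a, b); first by rewrite /f /on /= ea eb !eqxx pq ts.
  case=> a' b' /and4P[/eqP /= pa /eqP /= qa _ _].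
  by have [||-> ->] := HF _ _ a' b' a b pq; rewrite -?pa -?qa ?ea ?eb.
- pose S := [pred j | F a b j < sz j].
  have S4 : 4 <= #|S| <= r.
    rewrite andbC; have := max_card S; rewrite card_ord => -> /=.
    rewrite -[X in X <= _]card_ord -(card_codom (f := widen_ord r4)) => [|i j]; last first.
      by move/(congr1 val) => /= /val_inj.
    apply/subset_leq_card/subsetP => _ /codomP[i ->]; rewrite inE.
    by rewrite s4 //= ltn_ord.
  pose g (i : 'I_#|S| * bool) : T * bool :=
    (Sub (enum_val i.1, F a b (enum_val i.1)) (enum_valP i.1), i.2).
  apply: (@wdec_emb _ _ (fun a => if a.2 then 6 else 3) _
      (fun a b => (a.1 != b.1) && (a.2 || b.2)) _ g _ _ _ _ (Hk _ S4)) => //.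
  + by move=> [i t] [j s] /= [/enum_val_inj -> _ ->].
  + move=> [i t] [j s]; rewrite /f /on /= !eqxx /=.
    by rewrite (inj_eq enum_val_inj).
  + have on_im p t : on (a, b) p -> exists z, (p, t) = g z.
      move=> /eqP /= op; have pS : (val p).1 \in S by rewrite inE -op (valP p).
      exists (enum_rank_in pS (val p).1, t); congr pair; apply: val_inj.
      by rewrite /= !enum_rankK_in // -op; case: (val p).
    case=> p t [q s] /and4P[/= /on_im op /on_im oq _ _].
    by have [z ->] := op t; have [z' ->] := oq s; exists z, z'.
Qed.

Lemma X6_td r x (sz : 'I_r -> nat) : oa r x ->
  (forall j, sz j <= x) -> (forall j : 'I_r, j < 4 -> sz j = x) -> 4 <= r ->
  (forall k, 4 <= k <= r -> frame (fun i : 'I_k => i)) ->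
  (forall j, X6 (sz j).+1) -> X6 (\sum_j sz j).+1.
Proof.
move=> Or sx s4 r4 Hk HX.
have col j : #|[pred p : {p : 'I_r * 'I_x | p.2 < sz p.1} | (val p).1 == j]| = sz j.
  pose g (i : 'I_(sz j)) : {p : 'I_r * 'I_x | p.2 < sz p.1} :=
    Sub (j, widen_ord (sx j) i) (ltn_ord i).
  rewrite -[RHS]card_ord -(card_codom (f := g)) => [|i i'].
    apply: eq_card => -[[j' i] /= ij]; apply/eqP/codomP => [/= jj|[z ->] //].
    by subst j'; exists (Ordinal ij); apply: val_inj; congr pair; apply: val_inj.
  by move/(congr1 (fun z => val (val z).2)) => /= /val_inj.
have <- : #|{: {p : 'I_r * 'I_x | p.2 < sz p.1}}| = \sum_j sz j.
  rewrite -sum1_card (partition_big (fun p => (val p).1) predT) //=.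
  by apply: eq_bigr => j _; rewrite sum1_card -[RHS]col.
by apply: X6_frame (frame_td Or s4 r4 Hk) _ => j; rewrite col.
Qed.

Lemma X6_inflate k n : oa 4 n -> frame (fun i : 'I_k => i) -> X6 n.+1 -> X6 (k * n).+1.
Proof.
move=> On fk Xn; rewrite -[k]card_ord -{1}[n]card_ord -card_prod.
apply: X6_frame (frame_inflate On fk) _ => i; suff -> : #|[pred p : 'I_k * 'I_n | p.1 == i]| = n by [].
rewrite -[RHS]card_ord -(card_codom (f := fun x : 'I_n => (i, x))) => [|x y [] //].
by apply: eq_card => -[j x]; apply/eqP/codomP => [/= ->|[y [] //]]; exists x.
Qed.

Lemma oa_primes k n : 0 < n -> (forall p, prime p -> p %| n -> k <= p.+1) -> oa k n.
Proof.
move=> n0 H; apply: oa_macneish => // p; rewrite mem_primes => /and3P[pp _ pn].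
apply: leq_trans (H p pp pn) _; rewrite ltnS.
have : 0 < logn p n by rewrite logn_gt0 mem_primes pp n0.
by case: (logn p n) => // l _; rewrite expnS leq_pmulr // expn_gt0 prime_gt0.
Qed.

Lemma oa6 x : 0 < x -> coprime 6 x -> oa 6 x.
Proof.
move=> x0 c; apply: oa_primes => // p pp px; rewrite leqNgt ltnS; apply/negP => p5.
have: p \in [:: 0; 1; 2; 3; 4] by move: p5; case: (p) => [|[|[|[|[|[]]]]]].
rewrite !inE => /or3P[/eqP e|/eqP e|]; [by rewrite e in pp|by rewrite e in pp|].
case/or3P => /eqP e; [| |by rewrite e in pp]; rewrite e in px.
  by have := coprime_dvdr px c.
by have := coprime_dvdr px c.
Qed.

Lemma nseq_enum n (T : Type) (x : T) : [seq x | _ : 'I_n <- enum 'I_n] = nseq n x.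
Proof. by rewrite -[n in RHS](size_enum_ord n); elim: (enum _) => //= i s ->. Qed.

Lemma gdd_fill1 v w g M m0 : gdd (rcons (nseq v (g * w)) M) ->
  gdd (rcons (nseq w g) m0) -> gdd (rcons (nseq (v * w) g) (M + m0)).
Proof.
move=> gv gw; rewrite -[v in v * w]card_ord -sum_nat_const.
by apply: gdd_fill => //; rewrite nseq_enum.
Qed.

(** Induction with n - 1 = 4x + y: four groups of size x, and y points spread over two further
    groups. A group size must be 0 or at least 3 for the induction to apply to it, hence 3 <= y <=
    2x. *)
Lemma X6_all : (forall k, 4 <= k <= 7 -> frame (fun i : 'I_k => i)) ->
  (forall n, 4 <= n <= 15 -> X6 n) -> X6 23 -> forall n, 4 <= n -> X6 n.
Proof.
move=> F4 B B23.
have X1 : X6 1.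
  by apply/gdd_rcons0/dec0 => -[i x] [j y] /=; rewrite (ord1 i) (ord1 j) eqxx.
have o43 : oa 4 3 by apply/roa_oa/(@roa_prime_power 3 3 1).
have o44 : oa 4 4 by apply/roa_oa/(@roa_prime_power 3 2 2).
have o54 : oa 5 4 by apply/roa_oa/(@roa_prime_power 4 2 2).
have td4 y : y \in [:: 0; 3; 4] -> (y = 0 \/ X6 y.+1) -> X6 (16 + y).+1.
  move=> yi Xy; pose sz (j : 'I_5) := if j < 4 then 4 else y.
  have -> : 16 + y = \sum_j sz j by rewrite !big_ord_recl big_ord0 /sz /=; lia.
  apply: (X6_td o54) => // [j|j|k /andP[k4 k5]|j].
  - by rewrite /sz; case: ifP => // _; move: yi; rewrite !inE; lia.
  - by rewrite /sz => ->.
  - by apply: F4; rewrite k4 (leq_trans k5).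
  - by rewrite /sz; case: ifP => // _; [apply: B|case: Xy => [->|]].
have st x y n : oa 6 x -> 5 <= x -> 3 <= y <= 2 * x -> n = 4 * x + y ->
   (forall m, 4 <= m <= n -> X6 m) -> X6 n.+1.
  move=> Ox x5 yx -> IH.
  (* If y exceeds x it is halved; both halves are at least 3 because x >= 5. *)
  pose sz (j : 'I_6) := if j < 4 then x else if y <= x then (if j == 4 :> nat then y else 0)
     else if j == 4 :> nat then y - y./2 else y./2.
  have -> : 4 * x + y = \sum_j sz j.
    by rewrite !big_ord_recl big_ord0 /sz /=; case: leqP => yx'; lia.
  apply: X6_td Ox _ _ _ _ _ => // [j|j|k /andP[k4 k6]|j].
  - by rewrite /sz; case: ifP => // _; case: (leqP y x); case: eqP => //; lia.
  - by rewrite /sz => ->.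
  - by apply: F4; rewrite k4 (leq_trans k6).
  - have [->//|] := posnP (sz j); move=> j0; apply: IH; move: j0.
    by rewrite /sz; case: ifP => _; [lia|case: (leqP y x); case: eqP; lia].
elim/ltn_ind=> n IH n4.
have [n15|n16] := leqP n 15; first by apply: B; rewrite n4.
have IH' m : 4 <= m <= n.-1 -> X6 m by move=> /andP[m4 mn]; apply: IH; lia.
have [n23|n24] := leqP n 23.
  (* Here n - 1 < 23 = 4 * 5 + 3, so the scheme with x >= 5 does not apply yet. *)
  have : n \in [:: 16; 17; 18; 19; 20; 21; 22; 23] by rewrite !inE; lia.
  rewrite !inE => /or4P[|||/or4P[|||/orP[]]] => /eqP ->.
  - apply: (@gdd_fill1 4 4 6 36 9); last exact: B.
    by have := gdd_inflate1 o44 (B 4 isT).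
  - by apply: (@td4 0) => //; left.
  - apply: (@gdd_fill1 3 6 6 36 15); last exact: B.
    by apply: (@gdd_td 36); apply: (@oa_mul 4 4 9) => //; apply: (@oa_mul 4 3 3).
  - by apply: (@X6_inflate 6 3) => //; [apply: F4|apply: B].
  - by apply: (@td4 3) => //; right; apply: B.
  - by apply: (@td4 4) => //; right; apply: B.
  - by apply: (@X6_inflate 7 3) => //; [apply: F4|apply: B].
  - by [].
have -> : n = n.-1.+1 by lia.
have [n30|n31] := leqP n.-1 30.
  apply: (st 5 (n.-1 - 20)) => //; [exact: oa6|lia|lia].
have [n42|n43] := leqP n.-1 42.
  apply: (st 7 (n.-1 - 28)) => //; [exact: oa6|lia|lia].
have [n48|n49] := leqP n.-1 48.
  apply: (st 8 (n.-1 - 32)) => //; [|lia|lia].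
  by apply: (@oa_macneish 6 8) => // p; rewrite inE => /eqP ->.
have [n50|n51] := leqP n.-1 50.
  apply: (st 11 (n.-1 - 44)) => //; [exact: oa6|lia|lia].
(* One of four consecutive integers is coprime to 6; this keeps y <= 18, while x >= 9. *)
have [x [xc xl xu]] : exists x, [/\ coprime 6 x, x <= (n.-1 - 3) %/ 4 & (n.-1 - 3) %/ 4 <= x + 3].
  set k := _ %/ 4; have k12 : 12 <= k by rewrite /k; lia.
  have M a b : coprime 6 (a %% 6) -> b <= 3 -> k = a + b -> exists x, [/\ coprime 6 x, x <= k & k <= x + 3].
    by rewrite coprime_modr => ca b3 ->; exists a; split=> //; lia.
  have : k %% 6 < 6 by rewrite ltn_mod.
  case E : (k %% 6) => [|[|[|[|[|[|//]]]]]] _.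
  - apply: (M (k - 1) 1) => //; last lia; suff -> : (k - 1) %% 6 = 5 by []; lia.
  - apply: (M k 0) => //; last lia; by rewrite E.
  - apply: (M (k - 1) 1) => //; last lia; suff -> : (k - 1) %% 6 = 1 by []; lia.
  - apply: (M (k - 2) 2) => //; last lia; suff -> : (k - 2) %% 6 = 1 by []; lia.
  - apply: (M (k - 3) 3) => //; last lia; suff -> : (k - 3) %% 6 = 1 by []; lia.
  - apply: (M k 0) => //; last lia; by rewrite E.
by apply: (st x (n.-1 - 4 * x)) => //; [apply: oa6 => //; lia|lia|lia|lia].
Qed.

(** * Passage between [is_GDD] and colourings *)

Section GroupIndex.
Variables (T : finType) (K : pred nat) (G B : {set {set T}}).
Hypothesis GDD : is_GDD K G B.

Definition gidx (x : T) : nat := index (pblock G x) (enum G).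

Let partG : partition G setT. Proof. by case: GDD. Qed.
Let pbG x : pblock G x \in G.
Proof. by rewrite pblock_mem // (cover_partition partG) inE. Qed.
Let pbGe x : pblock G x \in enum G. Proof. by rewrite mem_enum. Qed.

Lemma eq_gidx x y : (gidx x == gidx y) = (pblock G x == pblock G y).
Proof.
apply/eqP/eqP => [|xy]; last by rewrite /gidx xy.
by rewrite /gidx => /(congr1 (nth set0 (enum G))); rewrite !nth_index.
Qed.

Lemma card_gidx k : #|[pred x | gidx x == k]| = nth 0 [seq #|A : {set T}| | A <- enum G] k.
Proof.
have [kG|Gk] := ltnP k (size (enum G)); last first.
  rewrite nth_default ?size_map //; apply/eqP/pred0P => x /=; apply/negbTE.
  by rewrite neq_ltn (leq_trans _ Gk) // index_mem.
rewrite (nth_map set0) //; apply: eq_card => x; rewrite inE.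
have kG' : nth set0 (enum G) k \in G by rewrite -mem_enum mem_nth.
have tG := partition_trivIset partG.
apply/eqP/idP => [<-|xk].
  by rewrite nth_index // mem_pblock (cover_partition partG) inE.
by rewrite /gidx (def_pblock tG kG' xk) index_uniq ?enum_uniq.
Qed.

Lemma gidx_block b x y : b \in B -> x \in b -> y \in b -> x != y -> gidx x != gidx y.
Proof.
case: GDD => _ _ _ H bB xb yb xy; rewrite eq_gidx; apply/negP => e.
by have := H x y xy; rewrite e => /(_ b bB); rewrite xb yb.
Qed.

Lemma gidx_join x y : gidx x != gidx y -> exists2 b, b \in B & [/\ x \in b, y \in b &
  forall b', b' \in B -> x \in b' -> y \in b' -> b' = b].
Proof.
case: GDD => _ _ _ H; rewrite eq_gidx => xy.
have := H x y; rewrite (negbTE xy) => /(_ (contraNneq _ xy))/eqP/cards1P[] => [->//|b /setP E].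
have := E b; rewrite !inE eqxx => /and3P[bB xb yb]; exists b => //; split=> // b' b'B xb' yb'.
by apply/eqP; have := E b'; rewrite !inE b'B xb' yb'.
Qed.

End GroupIndex.

Lemma gdd_of_GDD l : GDD_exists (pred1 4) l -> gdd l.
Proof.
case=> n [G [B [GDD pl]]]; apply: gdd_perm pl _.
apply/(gdd_dec (P := predT) (c := gidx G)) => [k|]; first exact: (card_gidx GDD).
exists B; split=> [b bB|b x y bB xb yb xy|x y /and3P[_ _ xy]].
- by case: GDD => _ _ /(_ b bB)/eqP.
- exact: (gidx_block GDD bB).
- exact: (gidx_join GDD).
Qed.

(** Positive sizes make every colour class a part of the partition, and two groups provide a pair to
    cover, so that there is a block. *)
Lemma GDD_of_gdd l : all (leq 1) l -> 1 < size l -> gdd l -> GDD_exists (pred1 4) l.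
Proof.
move=> l1 sl gl; pose T : finType := {i : 'I_(size l) & 'I_(nth 0 l i)}.
pose N := #|T|; pose c (x : 'I_N) : 'I_(size l) := tag (enum_val x).
have cc (k : 'I_(size l)) : #|[pred x | c x == k]| = nth 0 l k.
  rewrite -(card_gdd_fibre l k) -[RHS](card_image (@enum_rank_inj T)); apply: eq_card => x.
  apply/idP/imageP => [xk|[y yk ->]]; last by rewrite inE /c enum_rankK -val_eqE.
  by exists (enum_val x); rewrite ?enum_valK // inE val_eqE.
have [B [B4 Be eB]] : dec (fun x y => c x != c y).
  apply: (dec_inj (@enum_rank_inj T)) gl => [x y|x y _]; first by rewrite /c !enum_rankK.
  by exists (enum_val x), (enum_val y); rewrite !enum_valK.
have ne (k : 'I_(size l)) : exists x, c x = k.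
  have : 0 < #|[pred x | c x == k]| by rewrite cc (allP l1) // mem_nth.
  by case/card_gt0P => x; rewrite inE => /eqP; exists x.
pose G := preim_partition c [set: 'I_N].
have pG : partition G setT by apply: preim_partitionP.
have pb x y : (pblock G x == pblock G y) = (c x == c y).
  rewrite eq_pblock ?(partition_trivIset pG) ?(cover_partition pG) ?inE //.
  by rewrite pblock_equivalence_partition ?inE // => u v w _ _ _; split=> // /eqP ->.
exists N, G, B; split.
  split=> // [|b bB|x y xy].
  - have [x x0] := ne (Ordinal (ltnW sl)); have [y y1] := ne (Ordinal sl).
    by have [|b bB _] := eB x y; [rewrite x0 y1|apply/set0Pn; exists b].
  - by rewrite inE B4.
  - rewrite pb; case: ifP => [/eqP cxy b bB|/negbT /eB[b bB [xb yb bU]]].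
      by apply/negP => /andP[xb yb]; have := Be b x y bB xb yb xy; rewrite cxy eqxx.
    rewrite (_ : [set _ in B | _] = [set b]) ?cards1 //; apply/setP => b'; rewrite !inE.
    by apply/and3P/eqP => [[]|-> //]; apply: bU.
pose F (k : 'I_(size l)) := [set x | c x == k].
have cF k : #|F k| = nth 0 l k by rewrite cardsE cc.
have El : map (fun A : {set 'I_N} => #|A|) (map F (enum 'I_(size l))) = l.
  rewrite -map_comp (eq_map (g := fun k : 'I_(size l) => nth 0 l k)) => [|k]; last exact: cF.
  by rewrite map_enum_ord mkseq_nth.
rewrite -[X in perm_eq _ X]El; apply: perm_map; apply: uniq_perm; first exact: enum_uniq.
  rewrite map_inj_uniq ?enum_uniq // => i j; have [x <-] := ne i => /setP/(_ x).
  by rewrite !inE eqxx => /esym/eqP.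
move=> A; rewrite mem_enum; apply/imsetP/mapP => [[x _ ->]|[k _ ->]].
  exists (c x); rewrite ?mem_enum //; apply/setP => y; rewrite !inE.
  by rewrite eq_sym.
have [x <-] := ne k; exists x; rewrite ?inE //; apply/setP => y; rewrite !inE.
by rewrite eq_sym.
Qed.

(** A block has k points in distinct groups, so it meets each of the k groups once. Row (a, b) is
    the block through point a of the first group and point b of the second; rows agreeing in two
    columns come from one block. *)
Lemma oa_of_GDD k q : 1 < k -> GDD_exists (pred1 k) (nseq k q) -> oa k q.
Proof.
move=> k1 [n [G [B [GDD pl]]]].
have sz : [seq #|A : {set 'I_n}| | A <- enum G] = nseq k q.
  have /all_pred1P -> : all (pred1 q) [seq #|A : {set 'I_n}| | A <- enum G].
    by rewrite (perm_all _ pl) all_nseq /= eqxx orbT.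
  by rewrite (perm_size pl) size_nseq.
have ck x : gidx G x < k.
  have := card_gidx GDD (gidx G x); rewrite sz nth_nseq; case: ltnP => // _.
  by move/eqP/pred0P/(_ x); rewrite /= eqxx.
pose c x := Ordinal (ck x).
have [|p [pI pS pc]] := @fibre_bij ('I_k * 'I_q)%type 'I_n predT predT _ fst c.
  move=> i; transitivity q.
    rewrite -[RHS]card_ord -(card_codom (f := fun x : 'I_q => (i, x))) => [|x y [] //].
    apply: eq_card => -[j x]; apply/eqP/codomP => [/= ->|[y [] //]]; by exists x.
  have := card_gidx GDD i; rewrite sz nth_nseq ltn_ord => <-.
  by apply: eq_card => x; rewrite !inE.
pose P i x := val (p (Sub (i, x) isT)).
have PI i x i' x' : P i x = P i' x' -> (i, x) = (i', x').
  by move/val_inj/pI/(congr1 val).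
have PS y : exists i x, y = P i x.
  have [[[i x] t] e] := pS (Sub y isT); exists i, x; rewrite /P [isT](bool_irrelevance _ t) -e //.
have Pc i x : c (P i x) = i by rewrite /P pc.
have jn i x j y : i != j -> exists2 b, b \in B & [/\ P i x \in b, P j y \in b &
  forall b', b' \in B -> P i x \in b' -> P j y \in b' -> b' = b].
  by move=> ij; apply: (gidx_join GDD); apply: contra ij => /eqP e; rewrite -(Pc i x) -(Pc j y) -val_eqE /= e.
have k0 : 0 < k by apply: ltnW.
pose i0 := Ordinal k0; pose i1 := Ordinal k1.
have H (ab : 'I_q * 'I_q) : exists g : 'I_k -> 'I_q, [/\ g i0 = ab.1, g i1 = ab.2 &
    exists2 b, b \in B & forall i, P i (g i) \in b].
  have [|b bB [b0 b1 _]] := jn i0 ab.1 i1 ab.2 => //.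
  have bI : {in b &, injective c}.
    move=> x y xb yb /(congr1 val) /= e; apply/eqP; apply: contraT => xy.
    by have := gidx_block GDD bB xb yb xy; rewrite e eqxx.
  have bT : c @: b = setT.
    apply/eqP; rewrite eqEcard subsetT cardsT card_ord (card_in_imset bI).
    by case: GDD => _ _ /(_ b bB) /eqP e _; rewrite e leqnn.
  have /fin_all_exists[g Hg] i : exists x, P i x \in b.
    have : i \in c @: b by rewrite bT.
    case/imsetP => y yb ->; have [j [x e]] := PS y; exists x.
    by rewrite e Pc -e.
  exists g; split; last by exists b.
  - by have /PI[] := bI _ _ (Hg i0) b0 (etrans (Pc _ _) (esym (Pc _ _))).
  - by have /PI[] := bI _ _ (Hg i1) b1 (etrans (Pc _ _) (esym (Pc _ _))).
have [g Hg] := fin_all_exists H.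
exists (fun a b => g (a, b)) => i j a b a' b' ij gi gj.
have [e0 e1 [K KB HK]] := Hg (a, b); have [e0' e1' [K' K'B HK']] := Hg (a', b').
have KK : K = K'.
  have [L LB [_ _ LU]] := jn i (g (a, b) i) j (g (a, b) j) ij.
  by rewrite (LU K) // (LU K') // ?gi ?gj.
have same l : g (a, b) l = g (a', b') l.
  apply/eqP; apply: contraT => ne; have := HK l; rewrite KK => h.
  have := gidx_block GDD K'B h (HK' l); have := congr1 val (etrans (Pc l (g (a, b) l)) (esym (Pc l (g (a', b') l)))).
  move=> /= -> /(_ _) /negP[] //; apply: contra ne => /eqP/PI[] -> //.
by move: (same i0) (same i1); rewrite e0 e0' e1 e1'.
Qed.

(** * Base blocks of the small ingredients *)

Definition table : seq design := ([::
Design (4, 3, 3)%nat (4, 4, 1) [::[::2;1]] [::(4, [::0;1;6;13;0;7;10;14;4;9;10;12]);(2, [::0;2;9;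
11]);(1, [::4;5;6;7])];
Design (4, 6, 3)%nat (4, 12, 4) [::[::3]] [::(3, [::0;1;7;14;0;2;13;23;0;3;18;25;0;5;10;26;0;6;9;11;
0;15;21;22;0;17;19;24;1;2;19;20;1;11;12;26;1;15;18;24;1;16;22;23;2;3;17;26;2;11;16;21;2;12;15;25;3;
12;14;21;12;13;22;24])];
Design (4, 6, 6)%nat (4, 12, 4) [::[::3;3]] [::(3, [::0;1;11;27;0;2;9;28;0;3;10;29;0;5;15;26;0;6;13;
23;0;7;17;18;0;14;21;24;0;19;22;25;1;2;20;24;1;3;18;26;1;7;14;16;1;10;12;19;1;15;22;28;2;3;17;25;2;
11;12;26;2;13;15;29;3;20;21;27;12;14;15;27;12;17;23;24;12;18;21;29])];
Design (4, 6, 9)%nat (4, 8, 1) [::[::8;1]] [::(8, [::0;1;22;29;0;2;17;25;0;3;9;30;0;10;11;26;0;13;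
19;32;0;15;18;24;8;10;17;28;8;11;21;30;16;17;19;29])];
Design (4, 9, 0)%nat (4, 12, 1) [::] [::(12, [::0;1;27;34;0;2;19;25;0;5;14;15;0;13;23;30;0;18;29;31;
12;17;26;27]);(3, [::0;3;6;9;12;15;18;21;24;27;30;33])];
Design (4, 9, 3)%nat (4, 36, 6) [::[::3]] [::(6, [::0;1;26;31;0;2;29;37;0;3;10;13;0;5;11;22;0;6;23;
25;0;7;34;36;0;9;14;35;0;21;27;38;1;2;11;36;1;3;14;20;1;8;10;15;1;16;23;37;2;3;5;28;2;15;16;38;3;16;
17;22]);(3, [::0;15;18;33;1;4;19;22;2;17;20;35])];
Design (4, 9, 6)%nat (4, 36, 2) [::[::3;3]] [::(18, [::0;2;11;17;0;3;14;40;0;5;10;36;0;6;27;29;0;7;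
33;41;0;13;35;38]);(9, [::0;1;18;19])];
Design (4, 9, 9)%nat (4, 36, 4) [::[::3;3;3]] [::(9, [::0;1;18;37;0;2;7;41;0;3;6;44;0;5;26;27;0;9;
14;39;0;10;17;19;0;11;30;38;0;13;23;36;0;15;21;22;0;25;34;43;0;29;35;42;0;31;33;40;1;14;27;38;1;15;
26;42;1;19;34;39])];
Design (4, 9, 12)%nat (4, 36, 1) [::[::12]] [::(36, [::0;1;15;38;0;2;31;36;0;3;13;43;0;6;25;45]);
(9, [::0;9;18;27])];
Design (4, 12, 15)%nat (4, 12, 1) [::[::6;6;3]] [::(12, [::0;1;26;54;0;2;45;48;0;5;22;57;0;13;30;53;
0;14;19;50;0;15;46;61;0;18;47;55;0;21;27;42;0;23;33;62;0;29;38;60;0;31;37;56;0;34;35;49;0;39;41;51;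
12;13;38;51;12;14;35;56;12;25;27;57;12;26;39;62;12;31;42;53;12;46;47;58;24;29;46;48;24;38;43;59]);
(3, [::0;3;6;9;12;15;18;21;24;27;30;33;36;39;42;45])];
Design (4, 12, 18)%nat (4, 16, 1) [::[::8;4;4;1;1]] [::(16, [::0;1;47;60;0;2;27;58;0;3;42;51;0;5;22;
62;0;6;43;59;0;7;26;53;0;18;29;50;0;21;34;65;0;23;41;49;0;30;45;52;0;31;38;64;0;33;35;55;16;17;23;
57;16;18;35;61;16;19;41;52;16;37;42;55;16;43;46;62;32;33;39;58])];
Design (4, 18, 0)%nat (4, 36, 2) [::] [::(18, [::0;1;23;46;0;2;37;63;0;3;22;29;0;5;10;51;0;6;33;59;
0;9;39;70;0;11;66;69;0;13;55;62;0;15;21;42;0;19;50;57;0;25;43;58;0;35;38;49;0;45;54;67;1;3;44;54;1;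
36;38;71;36;37;58;67;36;42;59;61]);(9, [::0;18;47;65;1;19;48;66])];
Design (4, 18, 3)%nat (4, 24, 1) [::[::2;1]] [::(24, [::0;1;7;58;0;2;49;63;0;3;38;65;0;5;15;42;0;11;
41;54;0;25;34;59;0;26;29;31;0;33;43;50;0;39;53;74;0;45;46;73;0;47;69;70;0;55;66;72;24;30;41;59;24;
50;67;69;24;54;57;63])];
Design (4, 18, 6)%nat (4, 72, 2) [::[::6]] [::(36, [::0;1;54;75;0;2;13;51;0;3;6;77;0;5;31;62;0;7;21;
50;0;9;26;63;0;14;53;59;0;17;42;67;0;23;38;65;0;33;35;76;0;61;71;73])];
Design (4, 18, 12)%nat (4, 36, 2) [::[::3;3;3;3]] [::(18, [::0;1;23;26;0;2;15;74;0;3;54;80;0;5;62;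
82;0;6;25;59;0;7;50;61;0;9;14;51;0;17;63;81;0;21;43;76;0;27;65;77;0;29;35;70;0;38;45;79;0;39;58;75;
0;41;42;47;0;46;55;72;0;57;71;78;0;66;69;83;1;3;64;78;1;11;70;74;1;40;66;77;1;46;67;81;1;48;50;63;1;
51;54;68;36;37;63;74;36;42;65;67]);(9, [::0;18;49;67;1;19;38;56])];
Design (4, 18, 15)%nat (4, 72, 2) [::[::3;3;3;3;3]] [::(36, [::0;1;46;86;0;2;53;82;0;3;38;72;0;5;54;
71;0;6;19;69;0;7;58;75;0;9;50;80;0;10;35;65;0;11;29;42;0;15;61;78;0;33;67;77;0;39;49;85;0;43;57;73;
0;45;47;83])];
Design (4, 18, 21)%nat (4, 72, 4) [::[::9;3;3;3;3]] [::(18, [::0;1;39;70;0;2;13;63;0;3;46;76;0;5;27;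
77;0;6;15;85;0;7;22;74;0;9;43;79;0;10;29;84;0;11;53;86;0;14;59;90;0;17;34;89;0;18;19;87;0;21;66;75;
0;23;30;80;0;25;62;78;0;26;65;73;0;31;41;82;0;33;42;47;0;35;54;81;0;37;58;83;0;38;61;71;0;45;50;92;
0;49;67;72;0;51;57;88;0;55;69;91;1;2;71;82;1;3;58;87;1;7;42;80;1;14;27;74;1;26;47;91;1;30;55;84;1;
43;66;73])];
Design (4, 18, 24)%nat (4, 72, 4) [::[::9;9;3;3]] [::(18, [::0;1;19;86;0;2;31;88;0;3;69;74;0;5;26;
77;0;6;33;43;0;7;25;66;0;9;14;72;0;10;71;87;0;11;17;73;0;13;46;94;0;15;45;81;0;18;21;79;0;22;29;89;
0;23;50;85;0;27;61;82;0;30;47;90;0;34;67;93;0;35;49;95;0;37;54;84;0;38;57;83;0;39;62;76;0;41;42;92;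
0;51;70;80;0;53;55;91;0;58;59;78;0;63;65;75;1;10;51;92;1;14;23;89;1;15;62;73;1;26;47;93;1;27;30;72;
1;31;38;81;1;35;50;80;1;58;63;83])];
Design (5, 3, 6)%nat (4, 4, 1) [::[::2;1];[::4;2]] [::(4, [::0;1;12;16;0;5;11;19;0;6;7;17;0;9;10;18;
4;9;13;16;4;11;14;17]);(2, [::0;2;14;20;4;6;12;19;8;10;13;19])];
Design (5, 6, 0)%nat (5, 15, 1) [::] [::(15, [::0;1;4;28;0;2;8;16;0;17;19;26;0;18;21;22])];
Design (5, 6, 9)%nat (5, 5, 1) [::[::5;1;1;1;1]] [::(5, [::0;1;9;18;0;2;11;30;0;6;12;35;0;7;21;38;0;
13;27;37;0;16;19;31;0;22;29;36;0;23;26;34;0;24;28;32;5;6;23;33;5;7;29;31;5;12;16;36;5;13;14;30;5;17;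
26;28;5;18;21;37;10;12;23;24;10;16;17;30;10;18;26;38;10;27;28;33;15;21;27;35;15;22;24;31])];
Design (5, 6, 12)%nat (5, 10, 1) [::[::10;1;1]] [::(10, [::0;1;7;32;0;2;16;30;0;11;24;39;0;12;28;37;
0;13;22;41;0;17;29;36;0;18;26;34;0;19;23;40;0;21;27;33;10;11;13;33;10;14;21;31;20;21;23;34])];
Design (5, 12, 0)%nat (5, 20, 1) [::] [::(20, [::0;1;8;24;0;2;21;29;0;3;9;47;0;4;46;52;0;22;56;59;0;
26;53;54;0;28;49;57;0;31;33;34;0;32;38;51;0;37;41;43;20;24;31;42;20;43;52;56])];
Design (5, 24, 3)%nat (5, 120, 2) [::[::3]] [::(60, [::0;1;14;27;0;2;81;93;0;3;12;34;0;4;46;87;0;6;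
37;73;0;7;99;122;0;8;26;77;0;9;57;58;0;11;43;117;0;16;54;113;0;17;36;88;0;19;21;63;0;23;29;96;0;28;
61;72;0;39;56;121;1;5;23;57;1;9;25;63])];
Design (5, 24, 6)%nat (5, 120, 2) [::[::3;3]] [::(60, [::0;1;19;112;0;2;83;119;0;3;61;121;0;4;43;
122;0;6;38;97;0;7;41;94;0;11;22;68;0;12;48;99;0;13;54;107;0;14;31;37;0;16;58;102;0;21;89;125;0;24;
71;93;0;28;77;101;0;29;103;111;0;56;113;124;1;3;67;109;1;5;77;93])];
Design (5, 24, 9)%nat (5, 60, 1) [::[::3;3;3]] [::(60, [::0;1;114;127;0;2;14;118;0;3;21;92;0;4;28;
77;0;6;88;97;0;7;38;64;0;8;49;67;0;9;102;108;0;13;76;125;0;16;33;112;0;23;61;69;0;26;107;121;0;62;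
74;103;0;66;68;120;0;72;94;123;0;83;84;111;0;87;101;128;60;63;81;97;60;64;77;113])];
Design (6, 4, 4)%nat (6, 6, 2) [::[::3;1]] [::(3, [::0;1;2;23;0;3;16;20;0;7;9;25;0;8;22;26;0;10;11;
27;0;13;17;24;0;14;15;19;1;3;10;25;1;6;11;16;1;9;12;17;1;15;22;27;1;20;21;26;6;8;17;19;6;9;13;22;6;
14;21;24;7;14;23;26;7;18;21;22;12;15;20;24]);(1, [::12;14;16;27;19;21;23;27])];
Design (6, 4, 7)%nat (6, 12, 6) [::[::2;2;2;1]] [::(2, [::0;1;10;20;0;2;15;30;0;3;22;26;0;4;5;21;0;
7;17;25;0;8;16;24;0;9;23;29;0;11;19;27;0;13;14;28;1;2;3;5;1;4;9;28;1;8;18;29;1;11;22;30;1;12;17;27;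
1;14;15;26;1;16;21;25;2;4;11;29;2;9;19;26;2;10;23;27;2;13;16;18;2;17;21;24;3;4;19;25;3;11;14;24;3;
12;16;23;3;18;20;30;4;12;20;24;4;13;23;30;4;15;18;27;5;12;15;29;5;14;22;27;5;18;19;24;13;15;17;20;
13;21;22;29;14;16;17;29])];
Design (6, 4, 10)%nat (6, 24, 6) [::[::2;1;1;1;1;1;1;1;1]] [::(4, [::0;1;2;30;0;3;13;33;0;4;20;24;0;
5;9;25;0;7;10;32;0;8;23;29;0;11;19;26;0;14;21;28;0;15;16;27;0;17;22;31;1;3;10;29;1;5;21;24;1;8;9;31;
1;11;14;27;1;16;20;25;1;22;23;28;2;4;15;26;2;5;16;33;2;11;21;32;3;5;22;30])];
Design (6, 6, 0)%nat (6, 12, 2) [::] [::(6, [::0;1;2;33;0;3;5;22;0;4;21;32;0;7;15;34;0;9;25;26;0;13;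
14;23;0;16;20;35;0;19;27;29;1;5;14;27;1;12;26;34;1;15;23;24;1;16;17;32;12;14;19;35;12;15;29;32;24;
25;29;34])];
Design (6, 6, 3)%nat (6, 12, 1) [::[::1;1;1]] [::(12, [::0;1;8;15;0;2;28;35;0;3;13;23;0;16;27;36;0;
17;25;37;0;21;34;38;0;29;31;32;12;13;21;28;12;17;26;34])];
Design (6, 6, 6)%nat (6, 18, 2) [::[::3;3]] [::(9, [::0;1;22;40;0;2;7;21;0;3;29;31;0;4;13;41;0;8;34;
35;0;11;33;36;0;15;17;28;0;20;25;37;0;23;32;38;1;5;20;28;1;9;26;36;1;21;35;39;18;20;33;40;18;21;22;
29])];
Design (6, 6, 9)%nat (6, 12, 1) [::[::6;2;1]] [::(12, [::0;1;10;32;0;4;17;37;0;5;28;40;0;14;27;42;0;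
15;16;23;0;19;21;38;0;20;29;43;0;22;26;44;0;25;33;36;12;15;35;39;12;26;27;40;12;29;31;34])];
Design (6, 6, 12)%nat (6, 18, 2) [::[::3;3;3;3]] [::(9, [::0;1;8;44;0;2;15;41;0;3;32;45;0;4;35;37;0;
5;20;27;0;7;21;34;0;9;17;47;0;19;28;42;0;22;23;36;0;25;26;46;0;29;33;39;1;3;20;39;1;5;21;37;1;22;26;
43;1;24;32;36;1;27;29;42;18;20;33;40;18;21;29;46])];
Design (6, 6, 15)%nat (6, 18, 2) [::[::3;3;3;3;3]] [::(9, [::0;1;11;43;0;2;23;40;0;3;34;36;0;4;32;
48;0;5;7;46;0;8;27;45;0;9;25;50;0;13;20;37;0;15;35;41;0;17;31;38;0;22;26;42;0;29;33;44;1;5;24;41;1;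
18;34;45;1;22;29;48;1;23;28;50;1;27;30;42;18;19;26;40;18;21;23;47;18;27;35;38])];
Design (6, 8, 5)%nat (6, 12, 1) [::[::3;1;1]] [::(12, [::0;1;35;39;0;2;9;43;0;4;32;49;0;13;16;44;0;
14;21;25;0;15;17;50;0;19;20;33;0;22;31;45;0;23;37;52;0;26;27;47;0;29;40;51;12;27;29;32;12;31;44;49;
12;34;39;41;12;37;45;46;24;39;46;49]);(4, [::12;16;20;51;24;28;32;52])];
Design (6, 8, 11)%nat (6, 24, 1) [::[::6;3;2]] [::(24, [::0;1;38;54;0;2;34;45;0;3;7;49;0;5;15;44;0;
11;33;50;0;25;47;55;0;26;40;41;0;27;31;53;0;28;35;57;24;27;32;51]);(8, [::0;8;16;58])];
Design (6, 8, 14)%nat (6, 24, 1) [::[::6;3;3;2]] [::(24, [::0;1;9;50;0;2;31;56;0;3;13;46;0;4;25;52;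
0;5;28;60;0;7;44;58;0;26;40;59;0;27;32;51;0;34;41;55;0;35;38;39;24;26;35;52]);(8, [::24;32;40;61])];
Design (6, 8, 17)%nat (6, 24, 1) [::[::12;3;2]] [::(24, [::0;1;10;52;0;2;21;55;0;4;41;43;0;7;40;62;
0;11;31;56;0;25;38;63;0;26;34;48;0;27;47;50;0;28;35;59;0;29;32;49;0;45;46;60;24;29;39;57]);(8, [::0;
8;16;64])];
Design (6, 8, 20)%nat (5, 20, 1) [::[::4;4];[::20]] [::(20, [::0;1;39;61;0;2;6;64;0;3;44;48;0;7;41;
63;0;8;31;54;0;9;33;59;0;21;46;57;0;22;34;52;0;26;37;51;0;27;28;55;0;29;47;53;0;32;40;49;0;36;43;67;
20;22;26;61;20;23;47;52;20;27;41;60])];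
Design (6, 16, 10)%nat (6, 96, 1) [::[::6;3;1]] [::(96, [::0;1;9;80;0;2;52;63;0;3;13;40;0;4;55;62;0;
5;28;75;0;14;29;99;0;19;76;96;0;22;53;104]);(32, [::0;32;64;105])];
Design (6, 16, 13)%nat (6, 48, 1) [::[::8;3;2]] [::(48, [::0;1;28;77;0;2;41;75;0;3;95;103;0;4;91;
106;0;5;38;96;0;8;19;88;0;13;65;74;0;14;51;71;0;17;62;70;0;22;63;68;0;23;58;101;0;50;64;67;0;55;56;
97;0;59;86;107;0;79;81;104;48;52;59;81;48;58;83;103]);(16, [::0;16;32;108;48;64;80;102])];
Design (6, 16, 19)%nat (6, 48, 1) [::[::6;6;6;1]] [::(48, [::0;1;38;97;0;2;45;89;0;4;21;59;0;7;57;
107;0;8;53;64;0;9;70;105;0;13;33;82;0;14;79;110;0;19;52;104;0;22;80;113;0;23;63;111;0;51;77;85;0;62;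
75;95;0;67;68;98;0;71;94;99;0;73;76;83;0;74;91;100;48;50;77;112;48;52;91;103]);(16, [::0;16;32;114;
48;64;80;114])];
Design (6, 16, 22)%nat (6, 96, 1) [::[::6;3;3;3;3;3;1]] [::(96, [::0;1;9;28;0;2;37;113;0;3;26;41;0;
4;21;43;0;5;34;102;0;7;52;98;0;10;50;116;0;11;25;108;0;13;33;96;0;16;47;105]);(32, [::0;32;64;
117])];
Design (6, 16, 25)%nat (6, 48, 1) [::[::24;1]] [::(48, [::0;1;83;106;0;2;37;94;0;3;59;76;0;4;14;117;
0;5;85;104;0;7;50;69;0;8;29;96;0;9;95;119;0;15;55;107;0;17;68;114;0;20;87;98;0;22;71;74;0;23;81;108;
0;53;93;111;0;61;89;118;0;63;70;100;0;64;77;79;0;65;75;101;48;49;70;111;48;52;91;116;48;59;73;104]);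
(16, [::0;16;32;120;48;64;80;120])];
Design (6, 16, 31)%nat (6, 48, 1) [::[::24;3;3;1]] [::(48, [::0;1;57;112;0;2;71;110;0;3;13;88;0;4;
74;97;0;5;26;107;0;7;40;98;0;9;23;99;0;11;61;124;0;17;63;82;0;19;83;104;0;20;79;122;0;49;76;93;0;51;
73;119;0;52;80;116;0;53;58;121;0;55;62;123;0;67;81;118;0;68;91;96;0;77;92;101;0;86;89;103;0;87;95;
113;48;49;58;107;48;50;61;104]);(16, [::0;16;32;126;48;64;80;126])];
Design (6, 16, 34)%nat (6, 96, 1) [::[::6;6;6;6;6;3;1]] [::(96, [::0;1;82;103;0;2;58;127;0;3;73;122;
0;4;9;43;0;7;59;118;0;8;29;106;0;10;61;124;0;11;31;115;0;13;41;111;0;16;79;99;0;19;69;97;0;22;47;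
113]);(32, [::0;32;64;129])];
Design (6, 16, 37)%nat (6, 48, 1) [::[::12;12;6;3;3;1]] [::(48, [::0;1;5;123;0;2;93;109;0;3;71;115;
0;7;15;117;0;9;74;96;0;10;86;98;0;11;25;120;0;13;88;104;0;17;67;126;0;19;77;102;0;20;55;69;0;21;85;
108;0;22;79;129;0;51;61;130;0;52;87;105;0;53;62;116;0;56;82;128;0;59;63;106;0;70;95;97;0;73;92;118;
0;80;81;101;0;89;94;113;48;50;65;124;48;51;59;120;48;55;76;113]);(16, [::0;16;32;132;48;64;80;
132])];
Design (6, 24, 0)%nat (6, 144, 2) [::] [::(72, [::0;1;38;143;0;2;89;115;0;3;14;37;0;4;13;32;0;5;69;
127;0;7;80;137;0;8;83;99;0;10;43;86;0;11;15;67;0;16;55;95;0;17;25;123;0;19;82;135;0;20;65;97;0;21;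
31;46;0;22;51;110;0;26;73;100;0;27;50;109;0;35;40;103;0;41;92;141;0;61;111;131])];
Design (6, 24, 3)%nat (6, 72, 1) [::[::3]] [::(72, [::0;1;11;117;0;2;40;81;0;3;28;55;0;4;92;93;0;5;
19;142;0;7;57;80;0;8;29;76;0;9;110;143;0;13;74;118;0;16;103;128;0;23;121;130;0;26;111;125;0;31;86;
94;0;33;83;124;0;35;139;144;0;75;109;136;0;77;82;146;0;97;100;129;0;115;131;141;72;74;123;127;72;79;
94;131])];
Design (6, 24, 6)%nat (6, 72, 1) [::[::3;3]] [::(72, [::0;1;39;53;0;2;79;145;0;3;110;118;0;4;44;75;
0;5;46;55;0;7;98;149;0;8;82;133;0;10;37;95;0;11;80;123;0;13;100;105;0;15;83;116;0;16;81;122;0;21;73;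
76;0;23;86;142;0;25;129;136;0;29;117;128;0;89;93;121;0;94;113;139;0;97;131;144;0;109;134;147;72;73;
86;135;72;74;94;129])];
Design (6, 24, 9)%nat (6, 72, 1) [::[::6;3]] [::(72, [::0;1;111;152;0;2;10;69;0;4;20;39;0;7;57;116;
0;9;122;130;0;11;86;115;0;14;45;147;0;17;100;134;0;21;49;112;0;25;80;95;0;26;103;124;0;29;85;118;0;
32;119;133;0;34;107;139;0;74;93;94;0;76;92;137;0;79;125;129;0;81;136;143;0;82;141;149;0;88;123;146;
0;97;106;148;0;99;140;150;72;74;97;141])];
Design (6, 24, 12)%nat (6, 144, 1) [::[::12]] [::(144, [::0;1;39;82;0;2;17;75;0;3;7;92;0;5;79;124;0;
8;64;91;0;9;23;49;0;10;41;152;0;11;98;150;0;13;34;50;0;19;47;144;0;22;115;153;0;32;76;109])];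
Design (6, 24, 15)%nat (6, 72, 1) [::[::3;3;3;3;3]] [::(72, [::0;1;41;69;0;2;135;142;0;5;51;80;0;7;
23;57;0;8;43;117;0;9;88;104;0;10;116;158;0;11;100;147;0;13;77;98;0;14;33;83;0;17;111;151;0;20;139;
153;0;25;81;144;0;27;73;130;0;76;86;115;0;82;93;107;0;87;110;113;0;91;143;156;0;92;123;145;0;97;99;
137;0;105;127;150;0;112;131;155;0;121;134;149;0;124;125;129;72;80;107;135])];
Design (6, 24, 18)%nat (6, 144, 1) [::[::3;3;3;3;3;3]] [::(144, [::0;1;71;147;0;2;63;113;0;3;109;
118;0;4;89;129;0;5;110;117;0;8;21;77;0;10;51;97;0;11;25;145;0;16;116;152;0;17;37;82;0;22;80;158;0;
23;76;153;0;43;92;160])];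
Design (6, 24, 21)%nat (6, 72, 1) [::[::3;3;3;3;3;3;3]] [::(72, [::0;1;15;64;0;2;94;115;0;3;13;29;0;
4;32;51;0;5;79;146;0;7;45;130;0;11;86;157;0;17;82;154;0;20;124;150;0;22;121;164;0;31;122;160;0;33;
89;139;0;35;111;148;0;73;125;141;0;77;103;145;0;80;117;119;0;81;134;156;0;83;93;140;0;87;100;162;0;
88;131;153;0;95;98;112;0;97;129;147;0;101;142;161;0;105;110;133;0;107;118;152;0;109;116;143;0;127;
135;136])];
Design (6, 24, 24)%nat (6, 144, 1) [::[::3;3;3;3;3;3;3;3]] [::(144, [::0;1;32;153;0;2;15;53;0;3;28;
49;0;4;33;109;0;5;19;160;0;7;110;146;0;8;17;81;0;10;37;87;0;11;55;162;0;16;86;158;0;20;79;167;0;22;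
45;97;0;26;82;151;0;40;83;149])];
Design (6, 24, 27)%nat (6, 72, 1) [::[::18;9]] [::(72, [::0;1;113;160;0;2;76;167;0;3;50;65;0;4;63;
133;0;5;88;135;0;8;77;118;0;11;98;148;0;14;94;149;0;16;45;154;0;17;38;73;0;19;125;151;0;20;115;168;
0;23;104;152;0;26;131;169;0;28;121;163;0;31;122;157;0;32;100;143;0;33;97;158;0;35;127;134;0;75;79;
89;0;82;101;146;0;85;86;123;0;103;116;119;0;109;117;137;0;124;139;164;72;74;123;144;72;77;104;146;
72;81;98;157;72;83;122;167])];
Design (6, 24, 30)%nat (6, 144, 1) [::[::9;3;3;3;3;3;3;3]] [::(144, [::0;1;58;117;0;2;17;123;0;3;50;
148;0;4;44;150;0;5;19;156;0;7;33;70;0;8;83;99;0;9;41;80;0;10;62;162;0;11;67;159;0;13;35;166;0;20;49;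
171;0;25;93;147;0;31;65;154;0;43;89;168])];
Design (6, 24, 33)%nat (6, 72, 1) [::[::24;3;3;3]] [::(72, [::0;1;57;122;0;2;25;142;0;3;62;139;0;4;
50;113;0;5;37;148;0;7;93;157;0;8;115;170;0;9;100;101;0;11;106;151;0;14;83;94;0;17;38;161;0;19;143;
176;0;20;81;156;0;27;89;155;0;28;85;146;0;29;82;154;0;31;110;171;0;33;130;162;0;73;76;99;0;74;111;
165;0;75;104;145;0;87;119;163;0;88;116;169;0;98;123;158;0;103;105;112;0;118;128;172;0;127;131;174;
72;77;85;99;72;87;106;145;72;88;105;167;72;92;123;149])];
Design (6, 24, 36)%nat (6, 144, 1) [::[::9;9;9;9]] [::(144, [::0;1;45;52;0;2;58;178;0;3;67;169;0;4;
111;144;0;5;76;177;0;8;29;154;0;9;74;121;0;10;59;168;0;11;27;130;0;13;53;151;0;15;98;145;0;17;106;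
158;0;19;39;82;0;22;50;175;0;26;57;156;0;34;109;162])];
Design (6, 24, 39)%nat (6, 72, 1) [::[::24;6;6;3]] [::(72, [::0;1;20;41;0;2;63;170;0;3;67;158;0;4;
128;169;0;7;45;77;0;10;123;181;0;13;57;159;0;14;95;144;0;16;91;122;0;17;88;166;0;22;85;160;0;23;109;
112;0;25;92;136;0;26;73;147;0;29;103;178;0;33;134;152;0;35;140;174;0;76;110;148;0;79;130;172;0;80;
99;151;0;82;125;161;0;83;129;182;0;87;127;156;0;93;118;157;0;94;131;164;0;97;117;177;0;98;115;137;0;
100;107;165;0;116;121;153;0;133;141;176;72;73;129;164;72;74;135;172;72;76;86;99])];
Design (6, 24, 42)%nat (6, 144, 1) [::[::6;6;6;6;6;6;6]] [::(144, [::0;1;3;64;0;4;125;144;0;5;100;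
147;0;7;40;181;0;8;70;178;0;9;118;163;0;10;68;175;0;11;124;161;0;13;51;185;0;14;99;169;0;15;47;88;0;
16;53;158;0;17;122;170;0;21;55;98;0;25;94;152;0;27;92;164;0;28;57;153])];
Design (6, 24, 45)%nat (6, 72, 1) [::[::18;9;9;3;3;3]] [::(72, [::0;1;38;111;0;2;59;158;0;3;50;179;
0;4;53;146;0;5;130;181;0;7;46;173;0;8;139;165;0;9;104;133;0;10;98;183;0;11;128;150;0;14;99;144;0;16;
43;152;0;17;122;168;0;20;51;82;0;28;93;188;0;32;81;167;0;74;112;161;0;75;77;149;0;76;127;163;0;79;
86;180;0;80;100;155;0;83;123;186;0;87;106;171;0;89;116;151;0;91;141;170;0;92;101;115;0;94;129;140;0;
97;107;164;0;109;142;178;0;113;118;177;0;119;136;184;0;135;143;159;72;73;141;155;72;85;100;179;72;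
88;119;149])];
Design (7, 2, 0)%nat (7, 7, 1) [::] [::(7, [::0;1;3;13;0;8;9;11])];
Design (7, 3, 3)%nat (7, 7, 1) [::[::1;1;1]] [::(7, [::0;1;5;20;0;8;18;23;0;9;10;12;0;11;16;22;0;13;
17;21;7;15;16;20])];
Design (7, 3, 9)%nat (7, 7, 1) [::[::7;1;1]] [::(7, [::0;1;5;22;0;8;17;23;0;9;15;25;0;10;20;27;0;11;
19;28;0;12;16;29;0;13;18;26;7;8;12;26;14;15;17;26])];
Design (7, 6, 0)%nat (7, 7, 1) [::] [::(7, [::0;1;16;24;0;2;12;31;0;3;20;33;0;8;25;38;0;9;32;34;0;
11;19;36;0;13;37;39;0;18;40;41;0;22;26;27;7;8;17;20;7;9;27;36;7;10;22;34;7;18;23;29;14;15;24;41;14;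
16;27;31;14;30;33;39;21;29;30;40;21;31;36;39])];
Design (7, 6, 9)%nat (7, 7, 1) [::[::7;1;1]] [::(7, [::0;1;9;44;0;2;13;31;0;3;22;45;0;10;16;41;0;12;
24;25;0;15;19;27;0;17;30;46;0;18;33;50;0;20;32;49;0;23;34;39;0;36;40;48;0;37;38;47;7;8;19;45;7;9;17;
48;7;10;33;39;7;16;22;34;7;23;41;47;7;24;37;49;7;25;40;50;7;29;31;43;14;15;38;42;14;16;25;46;14;24;
36;41;14;30;31;40;21;23;31;48;21;24;30;43;28;31;39;46])];
Design (7, 6, 18)%nat (7, 7, 1) [::[::7;7;1;1;1;1]] [::(7, [::0;1;19;43;0;2;31;47;0;3;9;52;0;8;16;
54;0;10;26;55;0;11;34;57;0;12;36;59;0;15;33;50;0;17;39;51;0;20;25;48;0;22;40;44;0;23;38;53;0;24;30;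
58;0;27;37;56;0;32;41;46;7;8;10;44;7;16;24;49;7;17;37;58;7;18;33;45;7;19;29;51;7;20;32;56;7;22;26;
47;7;25;41;42;7;27;31;54;7;34;39;55;7;36;40;46;14;15;17;47;14;23;24;43;14;25;34;59;14;27;39;57;14;
30;40;50;14;37;38;51;21;23;31;49;21;33;41;52;28;29;31;46;28;39;41;48])];
Design (7, 12, 0)%nat (7, 28, 1) [::] [::(28, [::0;1;39;54;0;2;60;71;0;3;55;64;0;4;44;83;0;5;34;78;
0;6;18;37;0;8;17;65;0;13;67;72;0;30;32;80;0;33;50;62;0;36;48;74;0;41;66;68;0;43;46;51;0;45;75;81;28;
29;60;75;28;32;50;73;28;37;61;71;56;57;65;81])];
Design (7, 24, 3)%nat (7, 84, 1) [::[::3]] [::(84, [::0;1;125;168;0;2;38;54;0;3;11;26;0;4;33;57;0;5;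
45;121;0;6;25;155;0;9;89;120;0;10;113;142;0;12;94;104;0;13;50;151;0;17;90;123;0;18;136;152;0;20;107;
159;0;22;100;108;0;41;88;122;0;85;97;144;0;93;102;150;0;95;99;153;0;96;115;156;0;109;110;148;0;114;
117;137;0;127;145;167;0;128;141;143;0;129;135;146;0;158;163;169])];
Design (7, 24, 6)%nat (7, 168, 1) [::[::3;3]] [::(168, [::0;1;62;163;0;2;46;71;0;3;85;145;0;4;24;
114;0;8;123;139;0;9;27;130;0;10;32;173;0;11;68;104;0;12;51;92;0;13;72;102;0;15;55;149;0;17;50;137;0;
43;95;170])];
Design (7, 24, 9)%nat (7, 84, 1) [::[::3;3;3]] [::(84, [::0;1;6;31;0;2;148;172;0;3;89;118;0;4;111;
117;0;8;88;100;0;9;27;136;0;10;43;153;0;11;45;58;0;12;93;141;0;15;44;67;0;16;87;169;0;19;135;144;0;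
20;94;159;0;22;130;176;0;24;103;106;0;36;131;156;0;38;104;128;0;85;124;137;0;96;114;122;0;97;102;
174;0;99;145;149;0;101;142;162;0;121;151;152;0;123;138;160;0;132;134;170;0;157;167;171;84;95;135;
152])];
Design (7, 24, 12)%nat (7, 168, 1) [::[::3;3;3;3]] [::(168, [::0;1;59;125;0;2;26;153;0;3;74;162;0;4;
143;176;0;5;73;179;0;8;19;173;0;10;72;117;0;12;60;76;0;13;99;145;0;18;50;129;0;20;47;101;0;22;55;
138;0;31;65;169;0;37;75;115])];
Design (7, 24, 15)%nat (7, 84, 1) [::[::3;3;3;3;3]] [::(84, [::0;1;88;168;0;2;55;124;0;3;40;148;0;4;
104;162;0;5;62;107;0;6;141;152;0;8;111;144;0;9;74;89;0;11;94;178;0;12;30;139;0;13;38;174;0;15;51;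
110;0;16;106;182;0;17;60;113;0;20;85;121;0;23;116;138;0;26;123;160;0;32;114;171;0;34;120;165;0;39;
156;157;0;92;130;177;0;125;128;155;0;132;151;169;0;142;159;180;0;150;163;173;84;86;90;158;84;89;113;
153;84;92;115;175;84;93;125;143])];
Design (8, 3, 0)%nat (8, 8, 2) [::] [::(4, [::0;2;12;19;0;3;13;14;0;7;18;21;0;9;11;23;0;15;20;22;1;
3;15;16;1;8;14;18;1;10;19;21;8;11;21;22]);(2, [::0;1;4;5;8;9;12;13;16;17;20;21])];
Design (8, 3, 3)%nat (8, 24, 2) [::[::3]] [::(12, [::0;1;2;26;0;3;7;10;0;4;9;19;0;11;13;24]);
(3, [::0;6;12;18;1;7;13;19])];
Design (8, 3, 6)%nat (8, 8, 2) [::[::2;2;2]] [::(4, [::0;1;11;18;0;2;14;28;0;3;22;25;0;5;23;27;0;7;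
21;24;0;10;17;20;0;15;19;26;1;3;16;29;1;8;15;21;1;12;13;26;8;10;13;25;8;17;19;28;8;20;22;27;9;11;22;
29;9;18;19;24]);(2, [::0;4;9;13;1;5;10;14;16;19;20;23])];
Design (8, 3, 9)%nat (8, 8, 1) [::[::8;1]] [::(8, [::0;1;21;27;0;3;18;28;0;9;15;29;0;10;17;32;0;11;
14;24;0;12;22;31;0;13;19;30;8;9;20;24;16;17;19;24]);(4, [::8;12;17;21]);(2, [::0;2;4;6])];
Design (8, 6, 0)%nat (8, 48, 2) [::] [::(24, [::0;1;4;42;0;2;19;37;0;3;29;39;0;5;9;30;0;11;25;31;0;
12;33;34;0;13;15;20])];
Design (8, 6, 3)%nat (8, 16, 1) [::[::1;1;1]] [::(16, [::0;1;20;45;0;2;6;13;0;17;28;30;0;18;39;50;0;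
21;22;31;0;23;34;36;0;25;42;49;0;26;33;46;0;27;37;48;0;29;35;41;0;38;43;47;16;20;34;35])];
Design (8, 6, 6)%nat (8, 24, 2) [::[::3;3]] [::(12, [::0;1;28;45;0;2;36;46;0;4;35;49;0;5;9;53;0;6;
19;29;0;7;10;25;0;11;17;30;0;23;38;48;0;26;33;52;0;27;41;51;0;37;42;43;1;3;24;48;1;11;37;39;1;26;30;
53;1;31;32;34;1;36;42;47;24;33;37;49]);(6, [::0;3;12;15;24;27;36;39])];
Design (8, 6, 9)%nat (8, 48, 3) [::[::4;2;2;1]] [::(16, [::0;1;15;36;0;2;9;38;0;3;10;54;0;4;19;53;0;
5;6;31;0;11;22;56;0;14;37;43;0;17;23;48;0;18;46;51;0;20;35;52;0;26;44;50;1;2;11;46;1;8;29;54;1;10;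
31;49;1;13;44;47])];
Design (8, 6, 12)%nat (8, 48, 2) [::[::3;3;3;3]] [::(24, [::0;1;7;30;0;2;23;49;0;3;6;39;0;4;14;51;0;
5;43;58;0;9;13;55;0;11;28;59;0;12;29;47;0;15;26;54;0;27;41;50;1;3;23;51])];
Design (8, 6, 15)%nat (8, 16, 1) [::[::8;1;1;1;1;1;1;1]] [::(16, [::0;1;38;48;0;2;28;52;0;3;9;44;0;
4;43;49;0;5;25;51;0;17;47;58;0;18;27;30;0;19;46;59;0;21;42;61;0;22;45;57;0;23;36;60;0;29;33;62;0;31;
34;56;16;17;22;52;16;18;33;49;16;34;38;41;16;42;44;53;32;33;38;53])];
Design (8, 6, 18)%nat (8, 16, 2) [::[::4;4;4;4;1;1]] [::(8, [::0;1;31;48;0;2;25;63;0;3;42;65;0;4;18;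
59;0;5;7;17;0;6;26;52;0;9;36;55;0;11;28;61;0;13;39;54;0;15;21;60;0;19;41;58;0;22;43;47;0;27;34;49;0;
29;46;64;0;33;44;56;0;35;37;51;0;38;45;50;1;5;38;49;1;7;36;59;1;16;20;62;1;19;22;53;1;21;30;58;1;24;
47;64;1;26;39;50;1;28;32;54;1;35;45;63;1;37;42;57;16;17;38;42;16;18;33;57;16;19;46;61;16;21;27;48;
16;22;34;50;16;25;35;65;16;31;43;53;17;19;32;59;17;21;35;55;17;36;37;61;32;34;47;52;32;35;42;61])];
Design (8, 6, 21)%nat (8, 16, 1) [::[::8;4;2;2;2;2;1]] [::(16, [::0;1;37;62;0;2;23;59;0;3;17;51;0;4;
11;50;0;6;44;56;0;18;28;53;0;19;22;60;0;20;41;66;0;25;47;64;0;26;43;67;0;27;45;49;0;29;33;65;0;31;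
34;68;0;35;46;61;0;39;42;52;16;17;45;63;16;18;23;57;16;20;47;48;16;39;41;55;16;42;46;53;32;33;39;
58])];
Design (9, 2, 2)%nat (9, 9, 3) [::[::1;1]] [::(3, [::0;1;13;15;0;2;16;19;0;4;8;10;0;5;11;12;0;7;14;
17;1;2;8;12;1;9;14;19;2;10;14;18;9;10;11;13]);(1, [::0;3;6;18;1;4;7;18;9;12;15;18])];
Design (9, 2, 5)%nat (9, 9, 3) [::[::3;1;1]] [::(3, [::0;1;5;8;0;2;15;20;0;4;17;21;0;7;10;19;0;11;
13;16;0;12;14;18;1;2;17;18;1;9;16;19;1;11;12;15;2;9;10;21;2;12;16;22;2;13;14;19]);(1, [::0;3;6;22;1;
4;7;22;11;14;17;22])];
Design (9, 2, 8)%nat (9, 18, 6) [::[::3;3;1;1]] [::(3, [::0;1;8;22;0;2;5;25;0;3;6;19;0;4;11;24;0;7;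
17;21;0;10;14;20;0;13;16;23;1;2;3;20;1;5;7;19;1;9;14;24;1;15;16;25;2;4;14;22;2;9;17;19;3;5;17;23;3;
9;16;22;4;5;10;18])];
Design (9, 3, 0)%nat (9, 9, 3) [::] [::(3, [::0;1;8;12;0;2;7;24;0;3;14;19;0;4;5;26;0;10;16;22;0;13;
20;21;0;15;17;23;1;4;16;20;1;9;15;25;1;11;14;22;1;17;21;24;2;5;13;17;2;9;16;21;2;12;25;26;2;18;19;
22;9;10;17;20;9;13;14;24;18;20;23;25])];
Design (9, 4, 4)%nat (9, 36, 2) [::[::3;1]] [::(18, [::0;1;5;31;0;2;10;25;0;3;11;38;0;4;21;36;0;6;
13;20;0;19;33;35]);(6, [::0;12;24;39;1;13;25;39])];
Design (9, 4, 7)%nat (9, 9, 1) [::[::3;1;1;1;1]] [::(9, [::0;1;20;25;0;2;12;31;0;4;30;36;0;11;34;39;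
0;13;15;26;0;14;21;41;0;16;17;37;0;22;32;33;0;23;28;40;9;13;33;35;9;19;26;37;9;21;34;42;9;23;24;30;
18;30;35;37]);(3, [::0;3;6;42;9;12;15;40;18;21;24;39;27;30;33;41])];
Design (9, 4, 10)%nat (9, 18, 1) [::[::6;3;1]] [::(18, [::0;1;11;36;0;2;23;40;0;3;25;32;0;4;20;30;0;
5;24;42;0;28;33;44;0;31;35;39;18;19;34;37]);(6, [::0;6;12;45;18;24;30;45])];
Design (9, 4, 13)%nat (9, 9, 1) [::[::9;3;1]] [::(9, [::0;1;25;43;0;2;32;40;0;4;15;23;0;10;13;37;0;
12;29;44;0;14;21;45;0;16;17;46;0;20;26;39;0;22;35;47;0;28;31;41;0;33;34;36;9;11;31;40;9;13;34;39;9;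
19;23;43;9;20;21;37;9;22;28;33;9;24;32;48;18;20;34;41;18;28;30;47]);(3, [::0;3;6;48])];
Design (9, 4, 16)%nat (9, 36, 3) [::[::3;3;3;3;3;1]] [::(12, [::0;1;8;36;0;2;17;38;0;3;7;45;0;5;6;
43;0;10;16;37;0;11;21;48;0;12;25;40;0;14;28;42;0;19;32;51;0;20;23;46;0;22;34;49;0;29;31;41;1;2;26;
39;1;4;32;44;1;5;22;45;1;11;17;49])];
Design (9, 6, 0)%nat (9, 54, 1) [::] [::(54, [::0;1;16;51;0;2;33;43;0;5;22;29;0;6;14;26])];
Design (9, 6, 24)%nat (9, 18, 1) [::[::9;9;3;2;1]] [::(18, [::0;1;51;54;0;2;41;60;0;3;46;59;0;4;35;
64;0;5;40;73;0;7;44;70;0;8;22;66;0;19;33;61;0;20;23;55;0;21;28;57;0;24;48;75;0;25;26;72;0;29;34;65;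
0;30;42;76;0;38;52;68;0;47;49;71;18;20;46;66;18;26;37;69;18;38;49;72;18;39;52;57;18;40;41;68;18;43;
51;58;18;50;53;61]);(6, [::0;6;12;77;18;24;30;77;36;42;48;77])];
Design (9, 8, 11)%nat (9, 36, 1) [::[::9;2]] [::(36, [::0;1;48;79;0;2;37;44;0;3;14;43;0;4;19;75;0;5;
39;67;0;6;56;58;0;7;20;66;0;8;57;68;0;10;51;77;0;38;53;72;0;55;61;73;0;64;69;82;36;37;56;69;36;46;
58;78]);(12, [::0;12;24;81])];
Design (9, 8, 14)%nat (9, 36, 1) [::[::6;3;3;2]] [::(36, [::0;1;5;16;0;2;66;79;0;3;71;72;0;6;29;44;
0;8;67;76;0;10;57;60;0;14;53;73;0;17;43;82;0;37;49;65;0;40;69;78;0;41;46;81;0;42;61;84;0;48;52;58;0;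
55;56;70;36;38;49;72]);(12, [::0;12;24;85])];
Design (9, 8, 17)%nat (9, 36, 1) [::[::3;3;3;3;3;2]] [::(36, [::0;1;52;78;0;2;50;84;0;3;8;23;0;4;42;
75;0;6;62;70;0;7;17;83;0;11;43;60;0;14;67;72;0;37;69;79;0;39;44;86;0;40;47;74;0;41;66;87;0;46;58;61;
0;55;65;71;0;57;59;76;36;37;50;81]);(12, [::0;12;24;88])];
Design (9, 8, 23)%nat (9, 36, 1) [::[::6;6;6;3;2]] [::(36, [::0;1;31;47;0;2;40;76;0;3;22;81;0;4;57;
77;0;7;28;85;0;10;71;80;0;11;70;93;0;12;42;49;0;13;56;90;0;16;67;86;0;39;58;69;0;41;62;89;0;44;60;
79;0;48;50;75;0;55;68;72;0;64;65;91;36;39;67;89;36;40;50;78]);(12, [::36;48;60;94])];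
Design (9, 8, 26)%nat (9, 36, 1) [::[::9;3;3;3;3;3;2]] [::(36, [::0;1;29;74;0;2;13;93;0;3;24;67;0;4;
60;92;0;5;58;80;0;6;44;76;0;10;65;86;0;14;51;88;0;16;50;82;0;17;69;96;0;39;59;78;0;40;47;83;0;41;62;
77;0;42;46;48;0;49;66;87;0;57;68;90;0;61;71;84;36;37;50;93;36;39;67;74]);(12, [::36;48;60;96])];
Design (9, 8, 29)%nat (9, 36, 1) [::[::9;9;9;2]] [::(36, [::0;1;39;42;0;2;62;79;0;3;13;82;0;4;71;93;
0;5;22;91;0;6;70;83;0;7;28;76;0;11;43;73;0;16;56;97;0;37;49;81;0;44;65;89;0;46;59;84;0;47;61;94;0;
48;53;72;0;50;51;100;0;52;69;74;0;55;57;85;0;58;66;92;36;40;47;74;36;42;62;90]);(12, [::0;12;24;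
99])];
Design (9, 12, 0)%nat (9, 54, 1) [::] [::(54, [::0;1;34;105;0;2;16;44;0;3;7;60;0;5;66;78;0;6;41;88;
0;8;83;97;0;11;70;87;0;15;37;95;0;23;69;102;0;24;55;68;0;25;65;67;0;56;86;91;0;62;77;93;0;64;84;92;
0;74;103;106;54;55;61;65])];
Design (9, 16, 19)%nat (9, 72, 1) [::[::3;3;3;3;3;3;1]] [::(72, [::0;1;14;144;0;2;91;94;0;3;47;68;0;
5;55;148;0;6;29;85;0;8;104;120;0;10;74;160;0;11;41;88;0;12;121;125;0;15;102;131;0;16;82;114;0;19;
129;150;0;20;103;115;0;26;106;158;0;32;93;101;0;33;100;111;0;34;86;107;0;35;105;153;0;75;76;155;0;
84;122;137;0;97;130;132;0;118;143;161;0;123;140;151;0;127;134;157;72;77;118;148;72;78;92;122;72;82;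
95;144]);(24, [::0;24;48;162;72;96;120;162])];
Design (9, 16, 22)%nat (9, 144, 1) [::[::3;3;3;3;3;3;3;1]] [::(144, [::0;1;52;87;0;2;10;162;0;3;107;
123;0;4;59;158;0;5;30;69;0;6;82;124;0;7;29;148;0;11;88;111;0;12;46;61;0;13;60;79;0;14;127;160;0;28;
71;145;0;32;106;154;0;41;91;150]);(48, [::0;48;96;165])];
Design (9, 16, 25)%nat (9, 72, 1) [::[::3;3;3;3;3;3;3;3;1]] [::(72, [::0;1;124;156;0;2;121;151;0;3;
28;43;0;4;84;136;0;5;22;144;0;6;74;104;0;7;46;116;0;8;73;133;0;10;21;110;0;12;103;143;0;13;118;164;
0;14;49;159;0;16;85;129;0;19;111;166;0;20;87;95;0;30;106;112;0;31;93;149;0;34;77;155;0;78;107;167;0;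
79;96;130;0;83;120;122;0;86;97;153;0;88;138;162;0;94;101;150;0;102;127;157;0;114;128;147;72;73;76;
129;72;77;103;146;72;82;95;159]);(24, [::0;24;48;168;72;96;120;168])];
Design (9, 16, 31)%nat (9, 72, 1) [::[::24;3;3;1]] [::(72, [::0;1;131;168;0;2;59;149;0;3;34;153;0;4;
32;160;0;5;42;119;0;6;23;101;0;7;109;158;0;8;60;88;0;10;139;145;0;11;138;157;0;14;39;125;0;16;136;
140;0;19;113;171;0;21;50;143;0;26;75;165;0;73;87;106;0;74;79;85;0;76;84;148;0;82;137;169;0;83;118;
172;0;89;115;166;0;91;141;142;0;92;112;144;0;96;128;164;0;97;107;154;0;98;123;161;0;103;110;133;0;
104;116;132;0;105;134;155;72;74;87;157;72;75;113;154]);(24, [::0;24;48;174;72;96;120;174])];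
Design (9, 16, 34)%nat (9, 144, 1) [::[::12;3;3;3;3;3;3;3;1]] [::(144, [::0;1;25;57;0;2;64;162;0;3;
43;109;0;4;41;151;0;5;89;115;0;6;67;150;0;7;19;130;0;8;23;102;0;10;68;170;0;11;28;171;0;13;59;174;0;
16;47;165;0;20;73;157;0;22;74;159;0;30;69;154;0;44;93;149]);(48, [::0;48;96;177])];
Design (9, 16, 37)%nat (9, 72, 1) [::[::24;6;6;1]] [::(72, [::0;1;57;101;0;2;94;105;0;3;136;175;0;4;
87;161;0;5;84;145;0;6;43;129;0;7;20;95;0;8;121;176;0;10;107;146;0;11;49;155;0;12;74;153;0;14;53;173;
0;17;82;142;0;21;112;127;0;22;115;170;0;25;98;163;0;26;111;179;0;28;132;138;0;30;80;156;0;31;102;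
166;0;32;109;151;0;76;141;147;0;78;140;148;0;89;118;169;0;96;130;149;0;114;119;139;0;120;124;158;0;
128;131;152;72;73;128;168;72;74;102;125;72;80;113;164;72;85;122;174;72;86;112;145]);(24, [::0;24;48;
180;72;96;120;180])];
Design (9, 16, 43)%nat (9, 72, 1) [::[::18;9;3;3;3;3;3;1]] [::(72, [::0;1;16;165;0;2;87;152;0;3;109;
160;0;4;33;119;0;5;37;149;0;6;77;89;0;7;129;139;0;8;30;155;0;10;51;102;0;11;28;162;0;12;25;145;0;14;
88;178;0;19;112;182;0;20;133;141;0;23;98;173;0;26;96;174;0;34;134;184;0;73;138;180;0;76;95;137;0;78;
104;154;0;79;116;177;0;80;130;158;0;82;97;153;0;84;118;176;0;91;114;131;0;94;125;168;0;101;103;146;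
0;105;111;159;0;107;136;166;0;110;124;185;0;120;140;172;0;127;128;163;72;75;88;145;72;76;123;163;72;
77;116;157]);(24, [::0;24;48;186;72;96;120;186])];
Design (9, 16, 46)%nat (9, 144, 1) [::[::9;9;9;9;6;3;1]] [::(144, [::0;1;21;88;0;2;37;182;0;3;55;85;
0;4;12;149;0;5;19;184;0;6;137;156;0;10;129;151;0;11;39;167;0;16;76;153;0;17;115;169;0;22;73;161;0;
23;70;186;0;24;50;103;0;31;111;175;0;32;101;168;0;34;83;176;0;38;78;179;0;42;100;144]);(48, [::0;48;
96;189])];
Design (9, 16, 49)%nat (9, 72, 1) [::[::24;18;6;1]] [::(72, [::0;1;137;140;0;2;10;182;0;3;104;181;0;
4;42;144;0;5;75;190;0;6;13;149;0;11;82;103;0;12;91;177;0;14;107;156;0;15;47;154;0;16;77;162;0;17;43;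
129;0;19;116;169;0;20;125;165;0;21;130;158;0;22;100;170;0;23;83;152;0;28;76;123;0;31;87;187;0;33;
122;157;0;35;73;173;0;74;138;176;0;80;85;159;0;84;115;119;0;88;141;189;0;94;111;147;0;96;134;179;0;
98;114;171;0;102;113;188;0;106;118;185;0;121;127;151;0;124;131;175;72;73;101;159;72;74;131;164;72;
82;105;152;72;86;118;161;72;92;114;168]);(24, [::0;24;48;192;72;96;120;192])];
Design (9, 16, 55)%nat (9, 72, 1) [::[::24;24;6;1]] [::(72, [::0;1;96;174;0;2;68;181;0;3;38;165;0;5;
13;188;0;7;123;146;0;10;51;150;0;11;104;160;0;12;109;122;0;14;44;186;0;15;130;148;0;16;101;197;0;17;
91;177;0;19;106;187;0;20;112;155;0;22;82;194;0;23;76;107;0;25;89;171;0;26;94;182;0;29;86;100;0;32;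
80;152;0;33;102;178;0;73;137;154;0;75;113;176;0;77;127;161;0;78;133;195;0;79;83;192;0;88;118;167;0;
98;131;166;0;103;114;153;0;105;142;145;0;111;134;156;0;119;124;191;0;121;128;158;0;138;139;189;72;
74;125;191;72;75;104;169;72;78;98;181;72;82;129;158;72;84;128;188]);(24, [::0;24;48;198;72;96;120;
198])];
Design (9, 16, 58)%nat (9, 144, 1) [::[::36;6;6;6;3;1]] [::(144, [::0;1;120;169;0;2;113;172;0;3;128;
147;0;4;61;183;0;5;106;193;0;6;34;171;0;7;129;181;0;8;37;192;0;10;49;159;0;11;53;156;0;12;70;100;0;
13;93;188;0;14;60;164;0;17;79;160;0;20;97;199;0;21;89;189;0;23;92;174;0;26;104;148;0;32;73;162;0;35;
94;177]);(48, [::0;48;96;201])];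
Design (9, 16, 61)%nat (9, 72, 1) [::[::24;9;9;6;6;3;3;1]] [::(72, [::0;1;97;181;0;2;130;163;0;3;76;
148;0;4;25;174;0;5;66;162;0;7;86;166;0;8;114;194;0;10;102;200;0;12;121;146;0;13;39;172;0;14;105;187;
0;15;56;164;0;17;112;189;0;19;49;179;0;20;123;127;0;22;122;177;0;28;138;193;0;29;116;155;0;32;75;
201;0;34;119;171;0;35;83;196;0;74;111;198;0;77;143;147;0;78;142;203;0;80;93;183;0;82;104;165;0;84;
125;185;0;88;137;154;0;89;129;167;0;94;136;152;0;98;131;151;0;101;139;188;0;113;133;160;0;118;132;
186;0;124;140;175;0;134;141;153;72;73;133;174;72;74;89;178;72;75;119;195;72;77;98;171;72;82;101;
151]);(24, [::0;24;48;204;72;96;120;204])];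
Design (10, 6, 27)%nat (9, 27, 1) [::[::3;3];[::27]] [::(27, [::0;1;7;70;0;2;57;79;0;3;28;81;0;4;14;
71;0;5;39;66;0;8;46;76;0;11;43;86;0;12;41;85;0;30;49;80;0;31;53;82;0;33;37;72;0;35;55;60;0;40;42;74;
0;44;54;64;0;47;56;83;0;48;51;62;0;50;59;65;27;28;39;76;27;33;40;73;27;37;59;82])];
Design (11, 6, 0)%nat (11, 33, 1) [::] [::(33, [::0;1;28;37;0;2;45;62;0;3;10;19;0;4;58;65;0;8;21;47;
0;15;50;63;0;34;38;57;0;40;41;49;0;46;52;64;0;51;53;56])];
Design (11, 6, 30)%nat (10, 60, 2) [::[::3;3];[::30]] [::(30, [::0;1;37;68;0;2;34;89;0;3;31;71;0;4;
52;77;0;5;54;80;0;7;13;66;0;9;16;70;0;14;43;86;0;15;24;76;0;17;62;90;0;18;41;93;0;19;45;73;0;21;60;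
69;0;22;49;78;0;25;61;87;0;33;55;74;0;35;65;91;0;39;57;95;0;47;64;85;0;59;63;82;1;3;47;72;1;5;53;
87])];
Design (12, 3, 0)%nat (12, 36, 4) [::] [::(9, [::0;1;4;23;0;2;5;22;0;3;13;21;0;6;8;17;0;7;15;26;0;
10;11;16;0;14;18;27;0;25;29;35;1;2;17;30;1;3;6;35;1;10;15;31])];
Design (12, 6, 33)%nat (11, 33, 1) [::[::3;3];[::33]] [::(33, [::0;1;27;96;0;2;69;94;0;3;56;91;0;4;
12;77;0;5;47;89;0;9;46;80;0;10;38;78;0;13;66;85;0;14;45;81;0;15;49;75;0;16;52;82;0;35;50;83;0;39;63;
76;0;40;41;97;0;43;62;74;0;48;60;87;0;51;54;103;0;57;65;86;0;58;67;90;0;59;71;79;33;35;62;76;33;38;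
67;88;33;40;56;84;33;46;71;104])];
Design (13, 3, 0)%nat (13, 39, 1) [::] [::(39, [::0;1;9;34;0;2;12;23;0;3;7;22])];
Design (13, 6, 0)%nat (13, 39, 1) [::] [::(39, [::0;1;29;46;0;2;5;53;0;4;16;66;0;6;44;64;0;7;21;49;
0;8;30;71;0;15;74;76;0;19;55;73;0;40;47;70;0;43;60;68;0;57;69;72;39;40;44;50])];
Design (13, 6, 36)%nat (13, 13, 1) [::[::13;1;1;1;1;1;1;1;1;1;1;1;1;1;1;1;1;1;1;1;1;1;1;
1]] [::(13, [::0;1;47;81;0;2;59;89;0;3;7;86;0;5;21;82;0;14;74;107;0;15;24;78;0;17;73;106;0;18;19;84;
0;20;58;99;0;22;41;92;0;23;30;108;0;25;27;112;0;28;32;85;0;29;67;103;0;31;77;105;0;33;75;98;0;34;63;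
95;0;35;51;96;0;36;71;110;0;37;45;88;0;38;42;101;0;40;70;113;0;43;62;97;0;44;61;104;0;48;53;109;0;
49;72;94;0;50;60;100;0;54;76;102;0;55;66;111;0;56;68;91;0;64;69;93;13;15;18;86;13;19;56;88;13;27;51;
102;13;29;72;100;13;30;70;97;13;31;75;104;13;32;55;94;13;34;48;111;13;35;41;93;13;36;58;113;13;37;
49;91;13;38;74;109;13;40;62;110;13;42;54;105;13;43;59;103;13;44;50;90;13;46;53;98;13;47;68;95;13;57;
76;101;13;60;67;96;13;61;77;85;13;66;71;83;26;27;37;85;26;31;76;86;26;32;59;88;26;41;44;89;26;46;73;
99;26;48;56;106;26;49;64;107;26;54;58;80;26;57;60;78;26;63;67;92;39;40;44;81;39;41;76;90;39;53;68;
108;39;63;77;112;39;67;70;83;39;71;72;78;52;53;60;80;52;54;75;90;65;67;71;89])];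
Design (14, 6, 39)%nat (13, 39, 1) [::[::3;3];[::39]] [::(39, [::0;1;44;112;0;2;34;122;0;3;66;94;0;
4;59;110;0;6;17;85;0;8;76;95;0;9;23;89;0;10;41;100;0;12;45;121;0;15;75;116;0;18;64;96;0;19;79;103;0;
40;51;115;0;42;82;104;0;47;69;102;0;48;49;92;0;50;77;99;0;53;74;98;0;54;61;114;0;56;71;86;0;57;73;
113;0;58;80;108;0;62;83;97;0;67;81;93;39;41;45;87;39;42;73;112;39;48;58;105;39;53;80;91])];
Design (15, 6, 42)%nat (14, 84, 2) [::[::3;3];[::42]] [::(42, [::0;1;36;97;0;2;80;117;0;3;85;94;0;5;
41;104;0;7;52;113;0;8;35;107;0;9;26;125;0;10;86;105;0;11;34;90;0;12;71;91;0;13;21;106;0;15;24;123;0;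
16;46;118;0;17;19;114;0;18;40;102;0;20;77;109;0;23;63;130;0;25;45;126;0;29;53;108;0;31;43;122;0;33;
89;131;0;37;55;96;0;47;88;98;0;51;81;101;0;65;69;120;0;73;83;128;0;79;87;92;1;7;33;125;1;17;39;131;
1;35;85;108])];
Design (17, 3, 0)%nat (17, 51, 1) [::] [::(51, [::0;1;5;32;0;2;28;39;0;3;33;41;0;6;35;42])];
Design (17, 6, 0)%nat (17, 51, 1) [::] [::(51, [::0;1;19;80;0;2;6;76;0;3;10;87;0;5;27;69;0;8;36;98;
0;9;67;97;0;11;55;82;0;12;72;101;0;13;53;86;0;14;30;57;0;20;52;65;0;25;66;81;0;54;59;99;0;63;75;100;
51;52;59;61;51;54;70;74])];
Design (19, 6, 0)%nat (19, 57, 1) [::] [::(57, [::0;1;37;108;0;2;68;112;0;3;18;46;0;4;88;98;0;5;91;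
97;0;6;64;80;0;7;59;61;0;8;90;101;0;9;31;41;0;12;72;79;0;13;30;62;0;23;70;100;0;24;63;105;0;65;85;
113;0;69;102;103;0;73;78;99;0;75;83;87;57;60;82;100])];
Design (20, 3, 0)%nat (19, 57, 1) [::[::3]] [::(57, [::0;1;28;53;0;2;13;57;0;3;18;24;0;7;16;47;0;8;
20;43])];
Design (23, 6, 66)%nat (22, 132, 2) [::[::3;3];[::66]] [::(66, [::0;1;62;143;0;2;14;191;0;3;8;139;0;
4;36;168;0;5;23;141;0;6;25;189;0;7;87;164;0;9;48;152;0;10;83;181;0;11;98;165;0;13;51;159;0;15;72;
153;0;16;46;145;0;17;58;140;0;18;97;171;0;20;121;185;0;21;123;161;0;24;106;156;0;27;47;180;0;28;57;
163;0;31;109;174;0;33;105;170;0;35;38;148;0;37;95;160;0;39;64;199;0;40;81;146;0;42;131;172;0;43;49;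
202;0;52;136;158;0;53;135;197;0;54;113;200;0;55;119;196;0;56;117;155;0;63;103;187;0;65;67;142;0;69;
85;138;0;77;134;157;0;99;132;147;0;111;125;154;0;115;133;179;1;5;33;149;1;9;99;194;1;11;57;155;1;13;
97;174;1;25;51;141;1;63;135;183])]])%num.

Lemma table_ok : all design_ok table.
Proof. by vm_compute. Qed.

Lemma known u g m : (u, g, m) \in map d_type table -> gdd (rcons (nseq u g) m).
Proof. exact: table_gdd table_ok u g m. Qed.

(** Keys (k, n): k fibres of one point each, of which n are permuted cyclically and at most one is
    fixed. *)
Definition frame_blocks : seq (nat * nat * seq (NN * seq NN)) := ([::
((4, 3)%nat, [::(3, [::0;4;26;30;0;5;22;32;0;7;14;33;0;8;13;34;0;10;23;28;0;11;25;29;0;16;20;27;0;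
17;19;31;3;7;20;29;3;8;19;28;3;10;17;35;3;11;16;33;3;13;26;27;3;14;22;31;6;10;26;31;6;11;22;27;6;16;
23;30;6;17;25;32;9;13;20;30;9;14;19;32;12;16;26;28;12;17;22;29]);(1, [::0;1;2;35;3;4;5;34;6;7;8;35;
9;10;11;34;12;13;14;35;15;16;17;34])]);((5, 5)%nat, [::(5, [::0;1;22;33;0;2;13;36;0;6;7;43;0;8;14;
42;0;9;27;31;0;12;28;44;0;16;18;34;0;17;24;41;0;19;26;38;0;23;29;37;5;7;18;39;5;12;24;43;5;13;17;31;
5;14;26;33;5;19;23;36;5;21;22;34;5;27;29;38;10;11;29;32;10;12;23;39;10;16;17;44;10;18;24;36;15;23;
26;32;15;28;29;41;20;22;29;43])]);((6, 5)%nat, [::(5, [::0;1;17;44;0;2;8;34;0;7;38;45;0;9;18;51;0;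
11;29;53;0;12;14;41;0;13;31;47;0;19;27;52;0;21;37;49;0;22;36;46;0;23;42;48;0;24;33;50;0;26;28;39;5;
6;22;34;5;7;13;39;5;12;43;46;5;14;23;52;5;16;18;44;5;17;24;53;5;26;42;50;5;27;41;47;5;28;32;49;5;29;
38;48;10;11;27;39;10;16;32;48;10;17;31;45;10;18;37;50;10;19;43;49;10;21;23;34;10;22;29;51;15;16;24;
37;15;21;38;47;15;26;27;33;15;29;32;46;20;21;29;42;20;26;43;45])]);((7, 7)%nat, [::(7, [::0;1;18;44;
0;2;11;52;0;3;32;51;0;8;16;53;0;10;15;58;0;12;36;59;0;13;33;57;0;19;34;60;0;20;25;45;0;22;31;47;0;
23;40;46;0;24;27;61;0;26;30;62;0;37;39;48;0;38;41;54;7;8;23;47;7;9;18;45;7;10;40;60;7;17;41;51;7;20;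
24;53;7;25;36;44;7;26;39;50;7;27;32;54;7;29;30;59;7;31;33;48;14;15;23;61;14;16;32;45;14;17;27;53;14;
31;36;58;14;33;39;44;14;34;37;52;14;40;41;59;21;22;37;61;21;23;29;53;21;31;40;43;28;31;39;
51])])])%num.

(** Keys (u, w, n): double group divisible designs with u groups of 4w points and four holes, each
    meeting every group in w points; n groups are permuted cyclically. *)
Definition htd_blocks : seq (nat * nat * nat * seq (NN * seq NN)) := ([::
((6, 2, 5)%nat, [::(5, [::0;11;29;46;0;12;24;33;0;13;21;32;0;14;26;47;0;16;38;45;0;17;28;34;0;18;27;
31;0;19;37;44;0;22;39;42;0;23;36;43;5;11;33;44;5;12;23;39;5;13;22;36;5;14;32;45;5;16;24;47;5;17;29;
38;5;18;26;37;5;19;21;46;5;27;34;43;5;28;31;42;10;26;39;41;10;29;36;40;15;21;34;40;15;24;31;41])]);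
((6, 4, 5)%nat, [::(5, [::0;21;49;77;0;22;46;95;0;23;69;91;0;24;56;68;0;26;48;94;0;27;54;93;0;28;57;
61;0;29;42;63;0;31;44;92;0;32;51;79;0;33;47;64;0;34;73;90;0;36;59;78;0;37;58;74;0;38;67;88;0;39;62;
89;0;41;72;85;0;43;76;87;0;52;66;86;0;53;71;84;5;21;44;63;5;22;43;79;5;23;72;89;5;24;67;90;5;26;54;
62;5;27;51;92;5;28;74;88;5;29;41;73;5;31;53;95;5;32;59;94;5;33;42;66;5;34;47;68;5;36;49;93;5;37;56;
64;5;38;52;69;5;39;78;91;5;46;77;86;5;48;61;84;5;57;71;87;5;58;76;85;10;21;54;94;10;22;41;69;10;23;
57;74;10;24;63;88;10;26;49;68;10;27;48;64;10;28;77;90;10;29;72;91;10;31;59;67;10;32;56;93;10;33;79;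
89;10;34;46;78;10;36;58;92;10;37;44;95;10;38;47;71;10;39;52;73;10;42;76;84;10;43;61;86;10;51;62;87;
10;53;66;85;15;21;43;93;15;22;49;92;15;23;52;76;15;24;57;78;15;26;59;95;15;27;46;74;15;28;42;79;15;
29;68;89;15;31;54;73;15;32;53;69;15;33;62;91;15;34;77;88;15;36;44;72;15;37;41;94;15;38;64;90;15;39;
51;63;15;47;61;85;15;48;66;87;15;56;67;84;15;58;71;86;20;46;72;82;20;51;73;80;20;52;61;81;20;56;63;
83;25;41;68;80;25;51;77;83;25;56;78;81;25;57;66;82;30;41;63;82;30;42;71;83;30;46;73;81;30;56;62;80;
35;41;67;81;35;46;68;83;35;47;76;80;35;51;78;82])]);((9, 1, 8)%nat, [::(8, [::0;9;27;34;0;10;21;25;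
0;11;23;30;0;12;19;29;0;13;22;35;0;14;20;26;0;15;17;28;0;18;31;33;8;21;30;32])]);
((9, 2, 9)%nat, [::(9, [::0;19;51;57;0;20;49;62;0;21;43;56;0;22;48;69;0;23;47;71;0;24;44;58;0;25;42;
65;0;26;38;68;0;28;40;59;0;29;39;70;0;30;41;67;0;31;37;61;0;32;52;55;0;33;46;66;0;34;53;60;0;35;50;
64;9;19;47;69;9;20;44;64;9;21;51;67;9;22;41;65;9;23;39;60;9;24;46;56;9;25;50;55;9;26;40;57;9;28;53;
61;9;29;43;68;9;30;38;58;9;31;52;71;9;32;49;66;9;33;37;62;9;34;48;59;9;35;42;70])]);
((12, 1, 11)%nat, [::(11, [::0;12;26;42;0;13;25;40;0;14;31;47;0;15;28;38;0;16;24;37;0;17;32;41;0;18;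
23;35;0;19;39;46;0;20;27;34;0;21;30;36;0;29;43;45;11;32;40;44])]);((12, 2, 11)%nat, [::(11, [::0;23;
52;86;0;24;64;74;0;25;50;68;0;26;45;87;0;27;58;75;0;28;51;95;0;29;61;78;0;30;54;83;0;31;57;76;0;32;
48;94;0;34;65;70;0;35;56;81;0;36;71;92;0;37;63;79;0;38;67;93;0;39;47;73;0;40;53;72;0;41;46;82;0;42;
59;80;0;43;49;69;0;60;84;90;0;62;85;91;11;23;54;81;11;24;45;70;11;25;82;93;11;26;52;68;11;27;78;92;
11;28;58;84;11;29;64;83;11;30;57;71;11;31;48;69;11;32;60;80;11;34;63;75;11;35;53;85;11;36;61;79;11;
37;56;76;11;38;47;86;11;39;62;94;11;40;50;67;11;41;65;72;11;42;46;87;11;43;59;95;11;49;73;91;11;51;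
74;90;22;56;69;89;22;58;73;88;33;45;80;88;33;47;84;89])]);((15, 1, 15)%nat, [::(15, [::0;16;41;52;0;
17;31;54;0;18;37;51;0;19;42;46;0;20;40;58;0;21;38;47;0;22;43;53;0;23;36;57;0;24;35;48;0;25;34;50;0;
26;33;55;0;27;39;59;0;28;44;56;0;29;32;49])]);((15, 2, 15)%nat, [::(15, [::0;31;88;109;0;32;86;103;
0;33;72;98;0;34;70;97;0;35;85;93;0;36;77;108;0;37;81;91;0;38;69;119;0;39;87;116;0;40;73;110;0;41;63;
96;0;42;65;99;0;43;71;114;0;44;78;117;0;46;74;113;0;47;79;111;0;48;83;94;0;49;89;101;0;50;66;104;0;
51;68;112;0;52;62;102;0;53;80;115;0;54;61;107;0;55;84;106;0;56;82;100;0;57;76;95;0;58;64;92;0;59;67;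
118;15;31;89;98;15;32;64;96;15;33;68;109;15;34;74;116;15;35;81;119;15;36;83;97;15;37;77;117;15;38;
65;100;15;39;76;92;15;40;69;91;15;41;67;115;15;42;61;110;15;43;79;107;15;44;82;103;15;46;73;94;15;
47;71;118;15;48;87;113;15;49;85;112;15;50;70;108;15;51;62;93;15;52;66;106;15;53;84;104;15;54;72;101;
15;55;88;95;15;56;78;111;15;57;80;114;15;58;86;99;15;59;63;102])]);((18, 1, 17)%nat, [::(17, [::0;
18;38;61;0;19;37;66;0;20;36;62;0;21;44;60;0;22;35;55;0;23;48;63;0;24;46;71;0;25;49;53;0;26;45;58;0;
27;56;70;0;28;40;59;0;29;50;64;0;30;39;57;0;31;42;67;0;32;47;52;0;33;43;54;0;41;65;69;17;48;58;
68])]);((18, 2, 17)%nat, [::(17, [::0;35;100;122;0;36;95;132;0;37;79;143;0;38;107;140;0;39;89;131;0;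
40;98;106;0;41;94;118;0;42;82;112;0;43;70;108;0;44;77;121;0;45;83;126;0;46;92;135;0;47;69;142;0;48;
110;141;0;49;96;127;0;50;87;133;0;52;97;117;0;53;71;128;0;54;101;134;0;55;91;109;0;56;93;129;0;57;
78;124;0;58;81;130;0;59;90;111;0;60;86;116;0;61;72;125;0;62;84;123;0;63;73;105;0;64;88;104;0;65;80;
115;0;66;75;120;0;67;99;113;0;74;114;138;0;76;103;139;17;35;80;134;17;36;88;111;17;37;84;117;17;38;
74;126;17;39;76;112;17;40;95;107;17;41;98;113;17;42;73;128;17;43;69;133;17;44;89;108;17;45;101;106;
17;46;90;122;17;47;71;121;17;48;97;132;17;49;92;103;17;50;82;130;17;52;83;105;17;53;78;115;17;54;96;
142;17;55;124;141;17;56;72;114;17;57;81;123;17;58;77;135;17;59;99;129;17;60;87;125;17;61;94;104;17;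
62;100;109;17;63;75;118;17;64;86;143;17;65;127;140;17;66;79;110;17;67;70;116;17;91;131;139;17;93;
120;138;34;69;110;137;34;80;108;136;51;86;127;136;51;97;125;137])])])%num.

Definition k21_blocks : seq (nat * seq (NN * seq NN)) := ([::
(1%nat, [::(21, [::0;1;48;79;0;2;28;56;0;3;55;68;0;4;24;43;0;5;30;80;0;6;38;82;0;8;35;70;0;9;40;50;
0;10;59;66;0;23;53;71;0;33;45;69;0;34;37;39;0;46;57;61;0;64;72;73;21;22;31;47;21;25;76;79;21;27;44;
45;21;29;56;82;21;53;55;67;21;62;70;81;21;64;68;83;42;45;50;67;42;51;78;83])]);(2%nat, [::(21, [::0;
1;34;53;0;2;108;164;0;3;48;120;0;4;31;128;0;5;24;97;0;6;96;156;0;8;75;110;0;9;69;138;0;10;72;163;0;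
22;116;149;0;23;39;115;0;25;65;113;0;26;58;139;0;29;30;82;0;32;36;160;0;37;74;155;0;38;61;88;0;41;
94;127;0;44;68;77;0;46;91;143;0;47;60;112;0;49;89;142;0;51;102;141;0;54;73;140;0;55;66;125;0;56;87;
118;0;59;76;79;0;62;85;133;0;70;135;146;0;80;136;159;0;95;119;122;0;98;132;166;0;99;101;154;0;103;
111;152;0;104;109;124;0;131;148;157;0;134;161;167;21;23;87;143;21;24;69;99;21;27;117;135;21;29;54;
89;21;30;48;159;21;31;51;142;21;45;76;104;21;47;56;65;21;49;156;167;21;52;75;161;21;55;58;80;21;59;
138;157;21;67;112;164;21;68;81;91;21;70;110;163;21;72;123;162;21;77;97;108;21;83;106;154;21;88;103;
125;21;90;124;131;21;98;101;116;21;119;145;153;21;120;122;133;21;127;136;152;21;140;146;155;42;43;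
89;155;42;44;104;123;42;46;145;148;42;47;53;163;42;68;100;140;42;69;95;96;42;71;159;167;42;76;130;
138;42;78;110;111;42;79;116;156;42;91;108;137;42;97;146;166;42;109;118;122;42;117;127;131;42;119;
124;162;63;64;110;134;63;65;102;125;63;67;127;166;63;68;74;142;63;87;112;158;63;88;97;101;63;96;148;
152;63;98;103;141;63;118;145;167;84;94;141;151;84;114;159;164;84;117;129;134;84;148;166;167;105;115;
130;162;105;127;145;146])])])%num.

Definition k27_blocks : seq (nat * seq (NN * seq NN)) := ([::
(1%nat, [::(36, [::0;1;51;78;0;2;13;103;0;3;85;95;0;5;73;88;0;6;64;72;0;7;55;76;0;10;59;62;0;14;47;
84;0;15;40;71;0;17;70;79;0;36;42;100;0;37;75;97;0;38;60;107;0;39;68;87;0;41;43;54;0;44;80;86;0;45;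
74;91;0;46;65;99;0;57;89;96;0;63;93;94;0;66;67;81;36;46;95;98;36;51;76;107;36;77;79;90])]);
(2%nat, [::(36, [::0;1;116;184;0;2;91;176;0;3;25;204;0;5;169;211;0;6;149;192;0;7;108;165;0;10;90;
156;0;13;110;155;0;15;37;121;0;17;70;194;0;38;55;160;0;39;139;210;0;41;105;200;0;42;83;88;0;43;73;
103;0;46;125;197;0;47;122;181;0;49;135;153;0;50;71;84;0;51;77;205;0;57;134;154;0;59;86;212;0;61;75;
170;0;62;79;151;0;65;132;138;0;66;113;118;0;67;136;159;0;69;100;171;0;72;173;199;0;74;97;207;0;76;
78;167;0;81;114;145;0;82;143;157;0;85;161;163;0;87;94;195;0;92;111;130;0;93;124;193;0;95;177;202;0;
96;106;150;0;98;119;196;0;99;112;198;0;101;127;144;0;102;162;172;0;104;208;209;0;107;152;185;0;109;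
120;123;0;117;191;214;0;126;166;189;0;128;175;190;0;129;180;187;0;131;147;188;0;140;141;148;0;168;
182;203;36;37;80;148;36;38;127;212;36;39;61;168;36;41;175;205;36;42;156;185;36;43;72;201;36;46;126;
192;36;49;74;191;36;73;84;87;36;75;94;128;36;76;135;162;36;78;117;181;36;81;155;178;36;83;134;160;
36;88;129;157;36;90;153;202;36;91;137;180;36;92;154;211;36;93;144;151;36;95;152;183;36;104;105;184;
36;107;118;193;36;108;163;209;36;110;133;171;36;112;114;203;36;121;197;199;36;123;130;159;36;131;
166;213;36;132;142;186;36;138;198;208;36;140;172;173;36;143;149;188;36;146;167;204;72;87;109;193;72;
114;155;160;72;115;145;175;72;122;143;156;72;137;204;210;72;138;185;190;72;164;183;202;72;181;192;
195;108;145;156;159;108;147;166;200])])])%num.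

(* Points are numbered track by track; a group is a residue modulo the track length n,
   except for a last group fixed by the automorphism when n < u. *)
Definition residue (F n x : NN) : NN := if N.ltb x F then N.modulo x n else n.
Definition track (F n x : NN) : NN := if N.ltb x F then N.div x n else N.sub x F.
Definition rot (n c : NN) : NN := if N.ltb c n then N.modulo (N.add c 1) n else c.

Definition frame_ok (d : nat * nat * seq (NN * seq NN)) : bool :=
  let: (k, n', p) := d in
  let n := N.of_nat n' in let F := N.mul 9 n in
  check_frame (9 * k) F n n (nseq (9 * (k - n')) 1%num) (residue F n)
    (fun x => N.ltb (track F n x) 6) (rot n) k (base_blocks p).

Definition htd_ok (d : nat * nat * nat * seq (NN * seq NN)) : bool :=
  let: (u, w, n', p) := d in
  let n := N.of_nat n' in let F := N.mul (N.of_nat (4 * w)) n in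
  check_holes (4 * w * u) F n n (nseq (4 * w * (u - n')) 1%num) (residue F n)
    (fun x => N.div (track F n x) (N.of_nat w)) (rot n) id u (4 * w) 4 u w (base_blocks p).

(** The set 0, 1, 2, 4 is a difference set modulo 7. Hole h meets the groups whose residue modulo 7
    lies in its translate by h: four residues with three groups each, hence 12 groups, in w points
    each. The summand 7 avoids truncated subtraction. *)
Definition k21_ok (d : nat * seq (NN * seq NN)) : bool :=
  let: (w, p) := d in let V := N.of_nat (84 * w) in
  let hole x := N.modulo (N.sub (N.add x 7) (nth 0%num [:: 0; 1; 2; 4]%num
     (N.to_nat (N.div x (N.mul 21 (N.of_nat w)))))) 7 in
  check_holes (84 * w) V 21 21 [::] (fun x => N.modulo x 21) hole (rot 21) (rot 7)
    21 (4 * w) 7 12 w (base_blocks p).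

(** The 27 groups form three bundles of nine, each with four holes of its own. Residues modulo 9 and
    4 are independent on a cycle of length 36, so a hole meets each of its nine groups in w
    points. *)
Definition k27_ok (d : nat * seq (NN * seq NN)) : bool :=
  let: (w, p) := d in let V := N.of_nat (108 * w) in
  let r x := N.div x (N.mul 36 (N.of_nat w)) in
  let step m c := N.add (N.mul m (N.div c m)) (N.modulo (N.add c 1) m) in
  check_holes (108 * w) V 36 36 [::] (fun x => N.add (N.mul 9 (r x)) (N.modulo x 9))
    (fun x => N.add (N.mul 4 (r x)) (N.modulo x 4)) (step 9%num) (step 4%num)
    27 (4 * w) 12 9 w (base_blocks p).

Lemma frames_ok : all frame_ok frame_blocks. Proof. by vm_compute. Qed.
Lemma htds_ok : all htd_ok htd_blocks. Proof. by vm_compute. Qed.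
Lemma k21s_ok : all k21_ok k21_blocks. Proof. by vm_compute. Qed.
Lemma k27s_ok : all k27_ok k27_blocks. Proof. by vm_compute. Qed.

Lemma frames k : 4 <= k <= 7 -> frame (fun i : 'I_k => i).
Proof.
move=> k47; have : k \in map (fun d => d.1.1) frame_blocks.
  by rewrite !inE; case: k k47 => [|[|[|[|[|[|[|[|]]]]]]]].
elim: frame_blocks frames_ok => //= -[[k' n] p] s IH /andP[/check_frame_frame fk /IH H].
by rewrite inE => /predU1P[->|/H].
Qed.

Lemma htd_gdd u w : (u, w) \in map (fun d => d.1.1) htd_blocks ->
  0 < w -> forall s m, 0 < s -> oa 4 s ->
  gdd (rcons (nseq u (s * w)) m) -> gdd (rcons (nseq u (s * (4 * w))) m).
Proof.
elim: htd_blocks htds_ok => //= -[[[u' w'] n] p] s IH /andP[/holes_gdd hk /IH H].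
by rewrite inE => /predU1P[[-> ->]|/H].
Qed.

Lemma k21_gdd w : w \in [:: 1; 2] -> forall s m, 0 < s -> oa 4 s ->
  gdd (rcons (nseq 12 (s * w)) m) -> gdd (rcons (nseq 21 (s * (4 * w))) m).
Proof.
rewrite -[[:: 1; 2]]/(map fst k21_blocks) => wi; have w0 : 0 < w.
  by move: wi; rewrite !inE => /orP[] /eqP ->.
elim: k21_blocks k21s_ok wi => //= -[w' p] s IH /andP[/holes_gdd hk /IH H].
by rewrite inE => /predU1P[/= e|/H //]; rewrite -e in hk; apply: hk.
Qed.

Lemma k27_gdd w : w \in [:: 1; 2] -> forall s m, 0 < s -> oa 4 s ->
  gdd (rcons (nseq 9 (s * w)) m) -> gdd (rcons (nseq 27 (s * (4 * w))) m).
Proof.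
rewrite -[[:: 1; 2]]/(map fst k27_blocks) => wi; have w0 : 0 < w.
  by move: wi; rewrite !inE => /orP[] /eqP ->.
elim: k27_blocks k27s_ok wi => //= -[w' p] s IH /andP[/holes_gdd hk /IH H].
by rewrite inE => /predU1P[/= e|/H //]; rewrite -e in hk; apply: hk.
Qed.

(** * Ranges for the size of the last group *)

Definition P u g m := gdd (rcons (nseq u g) m).

Lemma rcons_nseq (A : Type) n (x : A) : rcons (nseq n x) x = nseq n.+1 x.
Proof. by elim: n => //= n ->. Qed.

Lemma P_last u g : P u.+1 g 0 -> P u g g.
Proof. by rewrite /P gdd_rcons0 rcons_nseq. Qed.

Lemma P_next u g : P u g g -> P u.+1 g 0.
Proof. by rewrite /P gdd_rcons0 rcons_nseq. Qed.

Lemma P_infl n u g m : oa 4 n -> P u g m -> P u (n * g) (n * m).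
Proof. exact: gdd_inflate1. Qed.

(** The step is 3 because a point outside the last group has degree g(u - 1) + m, and every block
    through it covers three neighbours. *)
Definition rng u g lo hi := forall i, i <= hi -> P u g (lo + 3 * i).
Definition upto u g hi := rng u g 0 hi.

Lemma rngW u g lo hi lo' hi' : lo <= lo' -> lo = lo' %[mod 3] ->
  lo' + 3 * hi' <= lo + 3 * hi -> rng u g lo hi -> rng u g lo' hi'.
Proof.
move=> l1 l2 l3 H i hi_; rewrite (_ : lo' + 3 * i = lo + 3 * ((lo' - lo) %/ 3 + i)); last lia.
by apply: H; lia.
Qed.

Lemma rng_cat u g lo hi lo' hi' hi2 : lo = lo' %[mod 3] -> lo <= lo' -> lo' <= lo + 3 * hi.+1 ->
  lo + 3 * hi2 <= lo' + 3 * hi' -> rng u g lo hi -> rng u g lo' hi' -> rng u g lo hi2.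
Proof.
move=> l1 l2 l3 l4 H H' i ii; have [ih|ih] := leqP i hi; first exact: H.
rewrite (_ : lo + 3 * i = lo' + 3 * (i - (lo' - lo) %/ 3)); last lia.
by apply: H'; lia.
Qed.

Lemma rng_flex u g lo hi n : oa u.+1 n -> rng u g lo hi -> rng u (n * g) (n * lo) (n * hi).
Proof. by move=> On H i ii; apply: gdd_flex1 On H _ ii. Qed.

Lemma rng_mix k s n lo hi M : roa k n.+1 -> rng k s lo hi -> P n.+1 s M ->
  rng n.+1 (k * s) (M + n * lo) (n * hi).
Proof.
move=> Or H HM t tn; have [w Hw sw] := sum_progression lo 3 tn.
rewrite -addnA -sw mulnC -(sumn_nseq s k).
apply: gdd_mix; first by rewrite size_nseq.
  by move=> x; have [i ii ->] := Hw x; apply: H.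
by move=> x; rewrite mem_nseq => /andP[_ /eqP ->].
Qed.

Lemma P_fill v w g M m0 : P v (g * w) M -> P w g m0 -> P (v * w) g (M + m0).
Proof. exact: gdd_fill1. Qed.

Lemma P_td n : oa 4 n -> P 3 n n.
Proof. exact: gdd_td. Qed.

Lemma roa_prime k p : prime p -> k <= p -> roa k p.
Proof. by move=> pp kp; rewrite -[p]expn1; apply: roa_prime_power; rewrite // expn1. Qed.

Lemma oa_field k p m : prime p -> 0 < m -> k <= p ^ m -> oa k.+1 (p ^ m).
Proof. by move=> pp m0 kp; apply/roa_oa/roa_prime_power. Qed.

Lemma oa54 : oa 5 4. Proof. exact: (@oa_field 4 2 2). Qed.
Lemma oa58 : oa 5 8. Proof. exact: (@oa_field 4 2 3). Qed.
Lemma oa43 : oa 4 3. Proof. exact: (@oa_field 3 3 1). Qed.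
Lemma oa44 : oa 4 4. Proof. exact: oa_le oa54. Qed.
Lemma oa78 : oa 7 8. Proof. exact: (@oa_field 6 2 3). Qed.

Lemma rng3_4 : upto 4 3 1.
Proof. by move=> [|[|//]] _; [apply: (P_next (P_td oa43)) | apply: known]. Qed.

(** The range starts at 3: type 6^4 would be a pair of orthogonal Latin squares of order 6. *)
Lemma rng6_4 : rng 4 6 3 2.
Proof. by move=> [|[|[|//]]] _; apply: known. Qed.

Lemma rng9_4 : upto 4 9 4.
Proof. by move=> [|[|[|[|[|//]]]]] _; apply: known. Qed.

Lemma rng12_4 : upto 4 12 6.
Proof.
apply: (@rng_cat 4 12 0 4 15 1) => //; first exact: (rng_flex oa54 rng3_4).
by move=> [|[|//]] _; apply: known.
Qed.

Lemma rng24_4 : upto 4 24 12.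
Proof.
apply: (@rng_cat 4 24 0 8 12 8) => //; first exact: (rng_flex oa58 rng3_4).
exact: (rng_flex oa54 rng6_4).
Qed.

Lemma rng18_4 : upto 4 18 9.
Proof.
move=> i i9; have : i \in [:: 0; 1; 2; 4; 5; 7; 8; 3; 6; 9] by case: i i9 => [|[|[|[|[|[|[|[|[|[|]]]]]]]]]].
rewrite -[_ :: _]/([:: 0; 1; 2; 4; 5; 7; 8] ++ [:: 3; 6; 9]) mem_cat => /orP[]; last first.
  (* Sizes 9, 18 and 27 are three times those over groups of size 6. *)
  rewrite !inE => /or3P[] /eqP ->; apply: (@P_infl 3 4 6) oa43 _; exact: known.
by rewrite !inE => /or4P[|||/or4P[]] /eqP ->; apply: known.
Qed.

Lemma rng36_4 : upto 4 36 16.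
Proof. exact: (rng_flex oa54 rng9_4). Qed.

Lemma rng3_8 : upto 8 3 3.
Proof. by move=> [|[|[|[|//]]]] _; apply: known. Qed.

Lemma rng6_8 : upto 8 6 7.
Proof.
by move=> [|[|[|[|[|[|[|[|//]]]]]]]] _; apply: known.
Qed.

Lemma X6n n : 4 <= n -> P n 6 (3 * n.-1).
Proof.
apply: (X6_all frames) => [m /andP[m4 m15]|]; last exact: known.
by move: m m4 m15; do 16 (case=> //; try by move=> *; apply: known).
Qed.

Lemma oa4P n : 0 < n -> n %% 4 != 2 -> oa 4 n.
Proof.
move=> n0 n4; apply: oa_macneish => // p; rewrite mem_primes => /and3P[pp _ pn].
have l0 : 0 < logn p n by rewrite logn_gt0 mem_primes pp n0.
have [p2|p3] := leqP p 2; last first.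
  rewrite ltnS (leq_trans p3) //; case: (logn p n) l0 => // l _.
  by rewrite expnS leq_pmulr // expn_gt0 prime_gt0.
have {p2}p2 : p = 2 by apply/eqP; rewrite eqn_leq p2 prime_gt1.
rewrite p2 in l0 *; case E : (logn 2 n) l0 => [|[|l]] // _; last first.
  by rewrite !expnS; have := expn_gt0 2 l; lia.
exfalso; have : 2 ^ 1 %| n by rewrite pfactor_dvdn // E.
have : ~~ (2 ^ 2 %| n) by rewrite pfactor_dvdn // E.
move: n4; lia.
Qed.

(** Unless 2 or 3 divides n exactly once, every prime power in its factorisation is at least 4. *)
Lemma oa5P n : 0 < n -> n %% 4 != 2 -> (n %% 3 != 0) || (n %% 9 == 0) -> oa 5 n.
Proof.
move=> n0 n4 n3; apply: oa_macneish => // p; rewrite mem_primes => /and3P[pp _ pn].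
have l0 : 0 < logn p n by rewrite logn_gt0 mem_primes pp n0.
have [p3|p4] := leqP p 3; last first.
  rewrite ltnS (leq_trans p4) //; case: (logn p n) l0 => // l _.
  by rewrite expnS leq_pmulr // expn_gt0 prime_gt0.
have p23 : (p == 2) || (p == 3) by move: (prime_gt1 pp) p3; case: (p) => [|[|[|[|]]]].
have l2 : 1 < logn p n.
  rewrite ltnNge; apply/negP => l1; have E : logn p n = 1 by lia.
  have : p ^ 1 %| n by rewrite pfactor_dvdn // E.
  have : ~~ (p ^ 2 %| n) by rewrite pfactor_dvdn // E.
  by case/orP: p23 => /eqP ->; move: n4 n3; lia.
case: (logn p n) l2 => [|[|l]] // _; rewrite ltnS !expnS mulnA.
by apply: leq_trans (leq_pmulr _ _); [case/orP: p23 => /eqP ->|rewrite expn_gt0 prime_gt0].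
Qed.

(** * Filling recursions for m >= g *)

(** With u = 3a and m = 8eq + 3t, the bound m <= g(u - 1)/2 reads t <= 4eq(a - 1). *)
Definition DD e q a t := P (3 * a) (8 * e * q) (8 * e * q + 3 * t).
Definition full e q a := forall t, t <= 4 * e * q * (a - 1) -> DD e q a t.

Lemma P_eq u g m u' g' m' : u = u' -> g = g' -> m = m' -> P u g m -> P u' g' m'.
Proof. by move=> -> -> ->. Qed.

Lemma rng_eq u g lo hi u' g' lo' : u = u' -> g = g' -> lo = lo' ->
  rng u g lo hi -> rng u' g' lo' hi.
Proof. by move=> -> -> ->. Qed.

(** Sizes of the last group add up under filling. A master reaching its maximum, lo + hi = 4eqw(v -
    1), gives the maximum 4eq(vw - 1). *)
Lemma fill_rng e q v w lo hi : 0 < w -> rng v (24 * e * q * w) (3 * lo) hi -> full e q w ->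
  forall t, lo <= t <= lo + hi + 4 * e * q * (w - 1) -> DD e q (v * w) t.
Proof.
move=> w0 Hr Hf t /andP[t1 t2]; set c := 4 * e * q * (w - 1) in t2.
(* The master takes as much of t as it can, the fillings take the rest. *)
have H := @P_fill v (3 * w) (8 * e * q) (3 * lo + 3 * minn (t - lo) hi)
   (8 * e * q + 3 * (t - lo - minn (t - lo) hi)).
apply: (@P_eq _ _ _ _ _ _ _ _ _ (H _ _)).
- lia.
- by [].
- lia.
- apply: (@P_eq _ _ _ _ _ _ _ _ _ (Hr (minn (t - lo) hi) _)) => //; lia.
- by apply: Hf; rewrite -/c; lia.
Qed.

Lemma rng48_4 : upto 4 48 24.
Proof. exact: (rng_flex oa54 rng12_4). Qed.

(** The factor ew has to carry an array with five columns; when 2 divides it exactly once, this 2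
    moves into the base type 48^4. *)
Lemma rng4 e q w : 0 < w -> e \in [:: 1; 2] -> oa 10 q -> (w %% 3 != 0) || (w %% 9 == 0) ->
  upto 4 (24 * e * q * w) (12 * e * q * w).
Proof.
move=> w0 e12 Oq w3; have O5q : oa 5 q by apply: oa_le Oq.
have k3 : ((e * w) %% 3 != 0) || ((e * w) %% 9 == 0).
  by move: e12 w3; rewrite !inE => /orP[] /eqP ->; lia.
have k0 : 0 < e * w by move: e12; rewrite !inE => /orP[] /eqP ->; lia.
have [k4|k4] := boolP ((e * w) %% 4 != 2).
  have H := rng_flex (oa_mul O5q (oa5P k0 k4 k3)) rng24_4.
  rewrite /upto (_ : 12 * e * q * w = q * (e * w) * 12); last lia.
  by apply: rng_eq H; lia.
have k4' : (e * w %/ 2) %% 4 != 2 by lia.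
have O : oa 5 (e * w %/ 2) by apply: oa5P => //; lia.
have H := rng_flex (oa_mul O5q O) rng48_4.
have E : e * w = 2 * (e * w %/ 2) by lia.
set k := e * w %/ 2 in H E.
have E1 : 12 * e * q * w = 12 * q * (e * w) by lia.
have E2 : 24 * e * q * w = 24 * q * (e * w) by lia.
rewrite /upto (_ : 12 * e * q * w = q * k * 24); last by rewrite E1 E; lia.
by apply: rng_eq H; rewrite ?E2 ?E; lia.
Qed.

(** A single factor 3 cannot be used for scaling and goes into the base type 9^4. There the sizes
    end at 12, below the bound 13.5, hence 32 and not 36. *)
Lemma rng4_3 e q w : 0 < w -> e \in [:: 1; 2] -> oa 10 q -> w %% 3 != 0 ->
  upto 4 (24 * e * q * (3 * w)) (32 * e * q * w).
Proof.
move=> w0 e12 Oq w3; have O5q : oa 5 q by apply: oa_le Oq.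
have O : oa 5 (8 * (e * w)).
  by apply: oa5P; move: e12; rewrite !inE => /orP[] /eqP ->; lia.
have H := rng_flex (oa_mul O5q O) rng9_4.
rewrite /upto (_ : 32 * e * q * w = q * (8 * (e * w)) * 4); last lia.
by apply: rng_eq H; lia.
Qed.

(** For three groups the transversal design already has a last group of maximal size, so filling it
    reaches the end of the range. *)
Lemma top3 e q w : 0 < w -> e \in [:: 1; 2] -> 0 < q -> full e q w ->
  forall t, 8 * e * q * w <= t <= 4 * e * q * (3 * w - 1) -> DD e q (3 * w) t.
Proof.
move=> w0 e12 q0 Hf t ht; apply: (@fill_rng e q 3 w (8 * e * q * w) 0) => //; last first.
  by move: ht; move: (e * q) => c; rewrite -!(mulnA _ e q); nia.
move=> [|//] _; apply: (@P_eq _ _ _ _ _ _ _ _ _ (@P_td (24 * e * q * w) _)) => //; first lia.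
apply: oa4P; last lia.
by rewrite !muln_gt0 q0 w0; move: e12; rewrite !inE => /orP[] /eqP ->.
Qed.

Lemma P_inflD n u g m : oa 4 n -> n %| g -> n %| m -> P u (g %/ n) (m %/ n) -> P u g m.
Proof.
by move=> On ng nm /(P_infl On); rewrite ![n * _]mulnC !divnK.
Qed.

Definition types := map d_type table.

(** A design of type g^u is also one of type g^(u-1) g^1; either description may be the tabulated
    one. *)
Definition listed u g m :=
  [|| (u, g, m) \in types, (m == 0) && ((u.-1, g, g) \in types) && (0 < u) |
      (m == g) && ((u.+1, g, 0) \in types)].

Definition avail u g m :=
  listed u g m || has (fun n => [&& n %| g, n %| m & listed u (g %/ n) (m %/ n)]) [:: 3; 4].

Lemma availP u g m : avail u g m -> P u g m.
Proof.
have T u' g' m' : (u', g', m') \in types -> P u' g' m'.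
  exact: known.
have L u' g' m' : listed u' g' m' -> P u' g' m'.
  case/or3P => [/T //|/andP[/andP[/eqP -> /T H] u0]|/andP[/eqP -> /T]]; last exact: P_last.
  by rewrite -(prednK u0); apply: P_next.
case/orP => [/L //|/hasP[n n34 /and3P[ng nm /L]]]; apply: P_inflD => //.
by move: n34; rewrite !inE => /orP[] /eqP ->; [apply: oa43|apply: oa44].
Qed.

Lemma rng_avail u g lo hi :
  all (fun i => avail u g (lo + 3 * i)) (iota 0 hi.+1) -> rng u g lo hi.
Proof. by move=> /allP H i ii; apply/availP/H; rewrite mem_iota. Qed.

(** * Ranges for few groups *)

Lemma rng2 e : e \in [:: 1; 2] -> rng 6 (8 * e) (8 * e) (4 * e).
Proof. by rewrite !inE => /orP[] /eqP ->; apply: rng_avail. Qed.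

Lemma rng3 e : e \in [:: 1; 2] -> rng 9 (8 * e) (8 * e) (8 * e).
Proof. by rewrite !inE => /orP[] /eqP ->; apply: rng_avail. Qed.

(** [rng_mix] is used with the smallest and the largest size of its second ingredient; the two
    ranges overlap and end at the maximum 48c. For c = 1 the mixed range starts at 12, as 6^4 is
    missing, and smaller sizes are tabulated. *)
Lemma rng5 c : c \in [:: 1; 2; 4] -> upto 5 (24 * c) (16 * c).
Proof.
have R n : prime n.+1 -> 4 <= n.+1 -> roa 4 n.+1 by apply: roa_prime.
rewrite !inE => /or3P[] /eqP ->.
- apply: (@rng_cat _ _ 0 3 12 12) => //; first exact: rng_avail.
  apply: (@rng_cat _ _ 12 8 24 8) => //.
    by apply: (@rng_mix 4 6 4 3 2 0) (R _ _ _) rng6_4 _ => //; apply: availP.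
  by apply: (@rng_mix 4 6 4 3 2 12) (R _ _ _) rng6_4 _ => //; apply: availP.
- apply: (@rng_cat _ _ 0 24 24 24) => //.
    by apply: (@rng_mix 4 12 4 0 6 0) (R _ _ _) rng12_4 _ => //; apply: availP.
  by apply: (@rng_mix 4 12 4 0 6 24) (R _ _ _) rng12_4 _ => //; apply: availP.
- apply: (@rng_cat _ _ 0 48 48 48) => //.
    by apply: (@rng_mix 4 24 4 0 12 0) (R _ _ _) rng24_4 _ => //; apply: availP.
  by apply: (@rng_mix 4 24 4 0 12 48) (R _ _ _) rng24_4 _ => //; apply: availP.
Qed.

Lemma rng7 c : c \in [:: 1; 2; 4] -> upto 7 (24 * c) (24 * c).
Proof.
have R n : prime n.+1 -> 4 <= n.+1 -> roa 4 n.+1 by apply: roa_prime.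
rewrite !inE => /or3P[] /eqP ->.
- apply: (@rng_cat _ _ 0 5 18 18) => //; first exact: rng_avail.
  apply: (@rng_cat _ _ 18 12 36 12) => //.
    by apply: (@rng_mix 4 6 6 3 2 0) (R _ _ _) rng6_4 _ => //; apply: availP.
  by apply: (@rng_mix 4 6 6 3 2 18) (R _ _ _) rng6_4 _ => //; apply: availP.
- apply: (@rng_cat _ _ 0 36 36 36) => //.
    by apply: (@rng_mix 4 12 6 0 6 0) (R _ _ _) rng12_4 _ => //; apply: availP.
  by apply: (@rng_mix 4 12 6 0 6 36) (R _ _ _) rng12_4 _ => //; apply: availP.
- apply: (@rng_cat _ _ 0 72 72 72) => //.
    by apply: (@rng_mix 4 24 6 0 12 0) (R _ _ _) rng24_4 _ => //; apply: availP.
  by apply: (@rng_mix 4 24 6 0 12 72) (R _ _ _) rng24_4 _ => //; apply: availP.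
Qed.

(** The range may stop at 48e, below the maximum 60e, because [top3] takes over exactly there. The
    ranges for nine groups, and for five groups of size 72e, are cut for the same reason. *)
Lemma rng6 e : e \in [:: 1; 2] -> upto 6 (24 * e) (16 * e).
Proof.
rewrite !inE => /orP[] /eqP ->; first exact: rng_avail.
apply: (@rngW _ _ 0 (8 * 5)) => //; apply: (@rng_flex 6 6 0 5 8) oa78 _.
exact: rng_avail.
Qed.

Lemma rng9 c : c \in [:: 1; 2; 4] -> upto 9 (24 * c) (24 * c).
Proof.
have R k : k <= 9 -> roa k 9 by apply: (@roa_prime_power k 3 2).
rewrite !inE => /or3P[] /eqP ->.
- by apply: (@rng_mix 8 3 8 0 3 0) (R _ _) rng3_8 _ => //; apply: availP.
- apply: (@rngW _ _ 0 56) => //.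
  by apply: (@rng_mix 8 6 8 0 7 0) (R _ _) rng6_8 _ => //; apply: availP.
- by apply: (@rng_mix 4 24 8 0 12 0) (R _ _) rng24_4 _ => //; apply: availP.
Qed.

Lemma rng9_3 e : e \in [:: 1; 2] -> upto 9 (72 * e) (64 * e).
Proof.
have R k : k <= 9 -> roa k 9 by apply: (@roa_prime_power k 3 2).
rewrite !inE => /orP[] /eqP ->; [apply: (@rngW _ _ 0 72) => //|].
  by apply: (@rng_mix 4 18 8 0 9 0) (R _ _) rng18_4 _ => //; apply: availP.
by apply: (@rng_mix 4 36 8 0 16 0) (R _ _) rng36_4 _ => //; apply: availP.
Qed.

Lemma rng5_3 e : e \in [:: 1; 2] -> upto 5 (72 * e) (32 * e).
Proof.
have R k : k <= 5 -> roa k 5 by apply: roa_prime.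
rewrite !inE => /orP[] /eqP ->; [apply: (@rngW _ _ 0 36) => //|apply: (@rngW _ _ 0 64) => //].
  by apply: (@rng_mix 4 18 4 0 9 0) (R _ _) rng18_4 _ => //; apply: availP.
by apply: (@rng_mix 4 36 4 0 16 0) (R _ _) rng36_4 _ => //; apply: availP.
Qed.

(** Nine groups and the last one use all ten columns of the array of order q. *)
Lemma flexq u g hi q : u <= 9 -> oa 10 q -> upto u g hi -> upto u (q * g) (q * hi).
Proof.
move=> u9 Oq H; have O : oa u.+1 q by apply: oa_le Oq.
by have := rng_flex O H; rewrite muln0.
Qed.

Lemma full1 e q : 0 < q -> e \in [:: 1; 2] -> oa 4 q -> full e q 1.
Proof.
move=> q0 e12 Oq t; rewrite subnn muln0 leqn0 => /eqP ->; rewrite /DD muln0 addn0 muln1.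
apply: P_td; apply: oa_mul Oq; apply: oa4P; move: e12; rewrite !inE => /orP[] /eqP ->; lia.
Qed.

Lemma DD_small e q v w g hi : g = 24 * e * w -> v <= 9 -> 0 < w -> oa 10 q ->
  upto v g hi -> full e q w -> forall t, t <= q * hi + 4 * e * q * (w - 1) -> DD e q (v * w) t.
Proof.
move=> -> v9 w0 Oq H Hf t tt; apply: (@fill_rng e q v w 0 (q * hi)) => //.
by apply: rng_eq (flexq v9 Oq H) => //; lia.
Qed.

(** * Master designs with an extremal last group *)

(** The top 12nB is half of 24B n, the maximum, because both ingredients are extremal there. The
    start 6nB is 3nB from the second ingredient plus n times 3B, the smallest size over 6^4 scaled
    by B. *)
Lemma mix4 n B : roa 4 n.+1 -> 4 <= n.+1 -> oa 5 B ->
  rng n.+1 (24 * B) (6 * n * B) (2 * n * B).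
Proof.
move=> Or n4 OB; have OB4 : oa 4 B by apply: oa_le OB.
have H := rng_mix Or (rng_flex OB rng6_4) (P_infl OB4 (X6n n4)).
apply: (@rngW _ _ (6 * n * B) (n * (B * 2))) => //; first lia.
by apply: rng_eq H => //; rewrite /=; lia.
Qed.

(** Over eight groups of size 6 the size 0 is available, so the range starts at 3nk; the price is
    eight columns of the resolvable array and nine columns for k. *)
Lemma mix8 n k : roa 8 n.+1 -> 4 <= n.+1 -> oa 9 k ->
  rng n.+1 (48 * k) (3 * n * k) (7 * n * k).
Proof.
move=> Or n4 Ok; have Ok4 : oa 4 k by apply: oa_le Ok.
have H := rng_mix Or (rng_flex Ok rng6_8) (P_infl Ok4 (X6n n4)).
apply: (@rngW _ _ (3 * n * k) (n * (k * 7))) => //; first lia.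
by apply: rng_eq H => //; rewrite /=; lia.
Qed.

Lemma mix8_0 n k : roa 8 n.+1 -> P n.+1 6 0 -> oa 9 k -> upto n.+1 (48 * k) (7 * n * k).
Proof.
move=> Or Hn Ok; have Ok4 : oa 4 k by apply: oa_le Ok.
have H := rng_mix Or (rng_flex Ok rng6_8) (P_infl Ok4 Hn).
rewrite /upto (_ : 7 * n * k = n * (k * 7)); last lia.
by apply: rng_eq H => //; rewrite ?muln0 //; lia.
Qed.

Lemma mix8_3 n m k : roa 8 n.+1 -> P n.+1 3 m -> oa 9 k -> rng n.+1 (24 * k) (k * m) (3 * n * k).
Proof.
move=> Or Hn Ok; have Ok4 : oa 4 k by apply: oa_le Ok.
have H := rng_mix Or (rng_flex Ok rng3_8) (P_infl Ok4 Hn).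
rewrite (_ : 3 * n * k = n * (k * 3)); last lia.
by apply: rng_eq H => //; rewrite ?muln0 ?addn0 //; lia.
Qed.

(** A substitute for [mix8] when the fields of order 5 and 7 are too small for eight columns. *)
Lemma mix4_12 n k : n.+1 \in [:: 5; 7] -> oa 5 k -> rng n.+1 (48 * k) (6 * n * k) (6 * n * k).
Proof.
move=> n57 Ok; have Ok4 : oa 4 k by apply: oa_le Ok.
have Or : roa 4 n.+1 by move: n57; rewrite !inE => /orP[] /eqP ->; apply: roa_prime.
have Hn : P n.+1 12 (6 * n).
  by move: n57; rewrite !inE => /orP[] /eqP [->]; apply: availP.
have H := rng_mix Or (rng_flex Ok rng12_4) (P_infl Ok4 Hn).
rewrite (_ : 6 * n * k = n * (k * 6)); last lia.
by apply: rng_eq H => //; rewrite ?muln0 ?addn0 //; lia.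
Qed.

Lemma P0 g m : P 0 g m.
Proof. by apply: dec0 => -[i x] [j y] /=; rewrite (ord1 i) (ord1 j) eqxx. Qed.

Lemma fillv v g x y M m : gdd (rcons (rcons (nseq v (g * x)) (g * y)) M) ->
  P x g m -> P y g m -> P (v * x + y) g (M + m).
Proof.
move=> H Hx Hy; pose b (i : nat) := if i < v then x else y.
have mk (F : nat -> nat) : mkseq (fun i => F (b i)) v.+1 = rcons (nseq v (F x)) (F y).
  rewrite mkseqS {2}/b ltnn; congr rcons; transitivity [seq F x | _ <- iota 0 v].
    by apply/eq_in_map => z; rewrite mem_iota /b => /andP[_ ->].
  by rewrite -[v in RHS](size_iota 0); elim: (iota 0 v) => //= ? ? ->.
have E : \sum_(i < v.+1) b i = v * x + y.
  rewrite big_ord_recr /= {2}/b ltnn (eq_bigr (fun=> x)) => [|i _]; last by rewrite /b ltn_ord.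
  by rewrite sum_nat_const card_ord.
rewrite -E; apply: gdd_fill => [|i]; last by rewrite /b; case: ifP.
by rewrite (map_enum_ord v.+1 (fun i => g * b i)) (mk (muln g)).
Qed.

(** In type (24eqx)^4 (24eqy)^1 the fifth group is filled like the others, and the m new points form
    the last group. Then 24eqy has to lie in the range of [rng4], which means 2y <= 3x, or of the
    shorter [rng4_3], which means 3y <= 4x. *)
Lemma four_one e q x y m : 0 < x -> e \in [:: 1; 2] -> oa 10 q ->
  (3 * y <= 4 * x) || (x %% 3 != 0) && (2 * y <= 3 * x) ->
  P (3 * x) (8 * e * q) m -> P (3 * y) (8 * e * q) m -> P (3 * (4 * x + y)) (8 * e * q) m.
Proof.
move=> x0 e12 Oq xy Hx Hy.
rewrite (_ : 3 * (4 * x + y) = 4 * (3 * x) + 3 * y); last lia.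
apply: (fillv (v := 4) (M := 0)) => //; rewrite -/(P _ _ _) gdd_rcons0.
suff H : P 4 (24 * e * q * x) (0 + 3 * (8 * e * q * y)).
  by apply: (@P_eq _ _ _ _ _ _ _ _ _ H) => //; lia.
have [x3|x3] := boolP ((x %% 3 != 0) || (x %% 9 == 0)).
  apply: (rng4 x0 e12 Oq x3).
  have : 2 * y <= 3 * x by lia.
  by move: (e * q) => c; rewrite -!(mulnA _ e q); nia.
have xE : x = 3 * (x %/ 3) by lia.
rewrite xE; apply: (@rng4_3 e q (x %/ 3)) => //; [lia|lia|].
have : y <= 4 * (x %/ 3) by lia.
by move: (x %/ 3) => w; rewrite -!(mulnA _ e q); move: (e * q) => c; nia.
Qed.

(** An array with six columns: four columns of weight 24eq, a fifth cut down to y points, and a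
    sixth with free weights up to 36eq, the maximum over four groups of size 24eq. The fillings for
    x and y add at most 4eq(y - 1), the smaller of their bounds. *)
Lemma DD_low e q x y : 0 < q -> e \in [:: 1; 2] -> oa 10 q -> oa 6 x -> 1 <= y <= x ->
  full e q x -> full e q y ->
  forall t, t <= 12 * e * q * x + 4 * e * q * (y - 1) -> DD e q (4 * x + y) t.
Proof.
move=> q0 e12 Oq Ox /andP[y0 yx] fx fy t tt.
pose T := minn t (12 * e * q * x).
have HT : T <= x * (12 * e * q) by rewrite /T; lia.
have [w Hw sw] := sum_progression 0 3 HT.
pose s := 24 * e * q.
pose wt (j : 'I_6) (z : 'I_x) := if j < 4 then s else if (j == 4 :> nat) then (if z < y then s else 0) else w z.
have H := @gdd_oa 6 x wt Ox.
have {H} : gdd (rcons (rcons (nseq 4 (8 * e * q * (3 * x))) (8 * e * q * (3 * y))) (3 * T)).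
  apply: eq_ind (H _) _ _ => [z|].
    have [i ii wi] := Hw (z ord_max); rewrite add0n in wi.
    rewrite !enum_ordSl enum_ord0 /= /wt /=.
    have -> : lift ord0 (lift ord0 (lift ord0 (lift ord0 (lift ord0 ord0)))) = ord_max :> 'I_6.
      exact: val_inj.
    rewrite wi; case: ifP => _.
      have := flexq (isT : 5 <= 9) Oq (rng5 (c := e) _) => /(_ _ i) H5.
      apply: (@P_eq 5 (q * (24 * e)) (0 + 3 * i) 5 s (3 * i)) => //; first by rewrite /s; lia.
      by apply: H5; [move: e12; rewrite !inE => /orP[] /eqP ->|lia].
    have H4 : P 4 s (3 * i).
      have := @rng4 e q 1 isT e12 Oq isT i; rewrite !muln1; apply; lia.
    by apply: gdd_nz H4 => /=.
  rewrite !enum_ordSl enum_ord0 /= /wt /= sum_nat_const card_ord.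
  have -> : \sum_(z < x) (if z < y then s else 0) = 8 * e * q * (3 * y).
    rewrite -big_mkcond /= sum_nat_const; suff -> : #|[pred z : 'I_x | z < y]| = y by rewrite /s; lia.
    rewrite -[RHS]card_ord -(card_codom (f := widen_ord yx)) => [|i j /(congr1 val) /= /val_inj //].
    apply: eq_card => z; apply/idP/codomP => [zy|[i ->]]; last by rewrite inE /=.
    by exists (Ordinal zy); apply: val_inj.
  by rewrite sw muln0 add0n (_ : x * s = 8 * e * q * (3 * x)) // /s; lia.
move=> H; have := @fillv 4 (8 * e * q) (3 * x) (3 * y) (3 * T) (8 * e * q + 3 * (t - T)) H.
have ty : t - T <= 4 * e * q * (y - 1).
  by move: tt; rewrite /T; move: (12 * e * q * x) (4 * e * q * (y - 1)) => A B; lia.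
have tx : t - T <= 4 * e * q * (x - 1) by apply: leq_trans ty _; rewrite leq_mul2l leq_sub2r ?orbT.
move=> /(_ (fx _ tx) (fy _ ty)); rewrite /DD; apply: P_eq; [lia|by []|].
by have HTt : T <= t := geq_minl _ _; rewrite -addnCA -mulnDr subnKC.
Qed.

Lemma coprime6_below b : 4 <= b -> exists x, [/\ coprime 6 x, x <= b & b <= x + 3].
Proof.
move=> b4; have M x : coprime 6 (x %% 6) -> x <= b <= x + 3 ->
    exists x, [/\ coprime 6 x, x <= b & b <= x + 3].
  by rewrite coprime_modr => cx /andP[? ?]; exists x.
have : b %% 6 < 6 by rewrite ltn_mod.
case E : (b %% 6) => [|[|[|[|[|[|//]]]]]] _.
- by apply: (M (b - 1)); last lia; rewrite (_ : (b - 1) %% 6 = 5) //; lia.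
- by apply: (M b); last lia; rewrite E.
- by apply: (M (b - 1)); last lia; rewrite (_ : (b - 1) %% 6 = 1) //; lia.
- by apply: (M (b - 2)); last lia; rewrite (_ : (b - 2) %% 6 = 1) //; lia.
- by apply: (M (b - 3)); last lia; rewrite (_ : (b - 3) %% 6 = 1) //; lia.
- by apply: (M b); last lia; rewrite E.
Qed.

(** This needs 4x < a <= 5x and six columns of order x. The values 26 and 27 force x = 6. From 81
    on, an x coprime to 6 works because a <= 4x + 16 and x >= 17. *)
Lemma split_td a : 20 <= a -> a %% 4 != 0 -> a != 26 -> a != 27 ->
  exists x y, [/\ a = 4 * x + y, 1 <= y <= x & oa 6 x].
Proof.
move=> a20 a4 a26 a27.
have S x : oa 6 x -> 4 * x < a <= 5 * x -> exists x y, [/\ a = 4 * x + y, 1 <= y <= x & oa 6 x].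
  by move=> Ox ax; exists x, (a - 4 * x); split=> //; lia.
have [?|?] := leqP a 25; first by apply: (S 5); [apply: oa6|lia].
have [?|?] := leqP a 35; first by apply: (S 7); [apply: oa6|lia].
have [?|?] := leqP a 40; first by apply: (S 8); [apply: (@oa_field 5 2 3)|lia].
have [?|?] := leqP a 45; first by apply: (S 9); [apply: (@oa_field 5 3 2)|lia].
have [?|?] := leqP a 55; first by apply: (S 11); [apply: oa6|lia].
have [?|?] := leqP a 65; first by apply: (S 13); [apply: oa6|lia].
have [?|?] := leqP a 80; first by apply: (S 16); [apply: (@oa_field 5 2 4)|lia].
have [|x [cx xb bx]] := @coprime6_below ((a - 1) %/ 4); first lia.
by apply: (S x); [apply: oa6 => //; lia|lia].
Qed.

Lemma prime_ge11 p : prime p -> p != 2 -> p != 3 -> p != 5 -> p != 7 -> 11 <= p.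
Proof. by do 11 (case: p => [|p] //). Qed.

(** As neither 3 nor 4 divides a, a prime at least 5 does; it becomes the number of groups. If 5 and
    7 do not occur, all odd prime factors are at least 11, which provides the columns that [mix8]
    asks for. *)
Lemma split_mix a : 20 <= a -> a %% 4 != 0 -> a %% 3 != 0 -> exists n w,
  a = n.+1 * w /\ (n.+1 \in [:: 5; 7] \/
     [/\ prime n.+1, 11 <= n.+1, a %% 5 != 0 & a %% 7 != 0]).
Proof.
move=> a20 a4 a3.
have [/eqP a5|a5] := boolP (a %% 5 == 0).
  by exists 4, (a %/ 5); split; [lia|left].
have [/eqP a7|a7] := boolP (a %% 7 == 0).
  by exists 6, (a %/ 7); split; [lia|left].
have b1 : 1 < (if odd a then a else a %/ 2) by case: ifP => _; lia.
set b := if odd a then a else a %/ 2 in b1.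
have ba : b %| a.
  rewrite /b; case: ifP => // oa; apply/dvdnP; exists 2; have := odd_double_half a.
  by rewrite oa; lia.
have ob : odd b.
  rewrite /b; case: ifP => // oa; have := odd_double_half a; rewrite oa.
  by move: a4; lia.
have pp := pdiv_prime b1; have pa : pdiv b %| a by apply: dvdn_trans (pdiv_dvd b) ba.
have N k : a %% k != 0 -> pdiv b != k by apply: contraNneq => <-; rewrite -/(dvdn _ _).
have p2 : pdiv b != 2.
  by apply: contraTneq ob => p2; have := pdiv_dvd b; rewrite p2 dvdn2.
have p11 : 11 <= pdiv b by apply: prime_ge11 => //; apply: N.
exists (pdiv b).-1, (a %/ pdiv b); rewrite prednK ?prime_gt0 //; split.
  by rewrite mulnC divnK.
by right.
Qed.

(** * Induction on a for m >= g *)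

Section D.
Variables (e q : nat).
Hypotheses (e12 : e \in [:: 1; 2]) (q0 : 0 < q) (Oq : oa 10 q).

Let e0 : 0 < e. Proof. by move: e12; rewrite !inE => /orP[] /eqP ->. Qed.
Let c0 : 0 < e * q. Proof. by rewrite muln_gt0 e0. Qed.
Let ec : e \in [:: 1; 2; 4]. Proof. by move: e12; rewrite !inE => /orP[] /eqP ->. Qed.
Let ec2 : e * 2 \in [:: 1; 2; 4]. Proof. by move: e12; rewrite !inE => /orP[] /eqP ->. Qed.

Let smallc v w c hi a : v <= 9 -> 0 < w -> upto v c hi -> c = 24 * e * w -> a = v * w ->
  full e q w -> forall t, t <= q * hi + 4 * e * q * (w - 1) -> DD e q a t.
Proof. by move=> v9 w0 H cE -> Hf; apply: (DD_small cE v9 w0 Oq H Hf). Qed.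

Lemma full_base a : a \in [:: 2; 3; 5; 7] -> full e q a.
Proof.
have f1 := full1 q0 e12 (oa_le (isT : 4 <= 10) Oq).
rewrite !inE => /or4P[] /eqP -> t tt.
- have O : oa 7 q by apply: oa_le Oq.
  have := rng_flex O (rng2 e12) => /(_ t); rewrite /DD => H; apply: P_eq (H _); lia.
- have := rng_flex Oq (rng3 e12) => /(_ t); rewrite /DD => H; apply: P_eq (H _); lia.
- by apply: (smallc (v := 5) (w := 1) _ _ (rng5 ec)) => //; lia.
- by apply: (smallc (v := 7) (w := 1) _ _ (rng7 ec)) => //; lia.
Qed.

(** If 3 divides w exactly once the master range is short; the remaining values come from [top3],
    reading 4w as three times 4(w/3). *)
Lemma full_mul4 w : 0 < w -> full e q w -> (w %% 3 = 0 -> full e q (4 * (w %/ 3))) ->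
  full e q (4 * w).
Proof.
move=> w0 fw f3 t tt.
have [w3|w3] := boolP ((w %% 3 != 0) || (w %% 9 == 0)).
  by apply: (@fill_rng e q 4 w 0 (12 * e * q * w)) => //; [apply: rng4|nia].
have wE : w = 3 * (w %/ 3) by lia.
have w30 : 0 < w %/ 3 by lia.
have [t1|t1] := leqP t (32 * e * q * (w %/ 3)).
  apply: (@fill_rng e q 4 w 0 (32 * e * q * (w %/ 3))) => //; last first.
    by rewrite add0n (leq_trans t1) // leq_addr.
  by rewrite {1}wE; apply: rng4_3 => //; lia.
have -> : 4 * w = 3 * (4 * (w %/ 3)) by lia.
apply: top3 => //; [lia|by apply: f3; lia|].
have -> : 3 * (4 * (w %/ 3)) = 4 * w by lia.
by rewrite tt andbT; lia.
Qed.

(** The last hypothesis says that the filled range reaches the point where [top3] takes over. *)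
Lemma full_mul3 v w c hi a : v * w = 3 * a -> v <= 9 -> 0 < w -> 0 < a -> upto v c hi ->
  c = 24 * e * w -> full e q w -> full e q a ->
  8 * e * a <= hi + 4 * e * (w - 1) -> full e q (3 * a).
Proof.
move=> vw v9 w0 a0 H cE fw fa hh t tt.
have [t1|t1] := leqP (8 * e * q * a) t; first by apply: top3 => //; rewrite t1.
apply: (smallc v9 w0 H cE (esym vw) fw).
have -> : q * hi + 4 * e * q * (w - 1) = q * (hi + 4 * e * (w - 1)) by lia.
by apply: leq_trans (ltnW t1) _; rewrite (_ : 8 * e * q * a = q * (8 * e * a)) ?leq_mul2l ?hh ?orbT //; lia.
Qed.

(** The groups of the master are filled with w = 1. For e = 1, [mix4] gives large t and [mix8_3] the
    middle. A design of type 3^11 or 3^19 would have a fractional number of blocks, so 3^12 and 3^20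
    replace them with m = 3; the range then starts at t = q, and smaller t use 11 = 4 * 2 + 3 and 19
    = 4 * 4 + 3. For e = 2, [mix8] and [mix8_0] suffice. *)
Lemma full_prime n : n.+1 \in [:: 11; 13; 17; 19] -> (forall b, 0 < b < 5 -> full e q b) ->
  full e q n.+1.
Proof.
move=> nn fb t tt; have f1 : full e q 1 by apply: fb.
have Or k : k <= 8 -> roa k n.+1.
  by move=> k8; move: nn; rewrite !inE => /or4P[] /eqP ->; apply: roa_prime => //; lia.
have n4 : 4 <= n.+1 by move: nn; rewrite !inE; lia.
have O9 : oa 9 q by apply: oa_le Oq.
have O5 : oa 5 q by apply: oa_le Oq.
rewrite subSS subn0 in tt.
suff H : exists lo hi, rng n.+1 (24 * e * q) (3 * lo) hi /\ lo <= t <= lo + hi \/ DD e q n.+1 t.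
  case: H => lo [hi []// [H ht]]; rewrite -[n.+1]muln1.
  by apply: (@fill_rng e q n.+1 1 lo hi) => //; [rewrite muln1|lia].
move: e12 tt fb; rewrite !inE => /orP[] /eqP -> tt fb; rewrite ?muln1.
  have [t2|t2] := leqP (2 * n * q) t.
    exists (2 * n * q), (2 * n * q); left; split; last lia.
    by apply: rng_eq (mix4 (Or 4 isT) n4 O5) => //; lia.
  have [t1|t1] := leqP q t.
    have [m [m03 Hm]] : exists m, (m = 0 \/ m = 3) /\ P n.+1 3 m.
      move: nn; rewrite !inE => /or4P[] /eqP ->; [exists 3|exists 0|exists 0|exists 3];
        (split; [by auto|by apply: availP]).
    exists (if m == 0 then 0 else q), (3 * n * q); left.
    by case: m03 Hm => -> Hm /=; (split; [apply: rng_eq (mix8_3 (Or 8 isT) Hm O9) => //; lia|lia]).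
  move: nn; rewrite !inE => /or4P[] /eqP nE.
  - exists 0, 0; right; rewrite nE /DD; apply: (@four_one 1 q 2 3) => //.
      by apply: fb; lia.
    by apply: fb; lia.
  - exists 0, (3 * n * q); left; split; last lia.
    apply: rng_eq (mix8_3 (m := 0) (Or 8 isT) _ O9) => //; try lia.
    by rewrite nE; apply: availP.
  - exists 0, (3 * n * q); left; split; last lia.
    apply: rng_eq (mix8_3 (m := 0) (Or 8 isT) _ O9) => //; try lia.
    by rewrite nE; apply: availP.
  - exists 0, 0; right; rewrite nE /DD; apply: (@four_one 1 q 4 3) => //.
      by apply: fb; lia.
    by apply: fb; lia.
have [t2|t2] := leqP (n * q) t.
  exists (n * q), (7 * n * q); left; split; last lia.
  by apply: rng_eq (mix8 (Or 8 isT) n4 O9) => //; lia.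
exists 0, (7 * n * q); left; split; last lia.
apply: rng_eq (mix8_0 (Or 8 isT) _ O9) => //; try lia.
by move: nn; rewrite !inE => /or4P[] /eqP ->; apply: availP.
Qed.
End D.

Lemma full_26 e q : e \in [:: 1; 2] -> 0 < q -> oa 10 q -> full e q 2 -> full e q 26.
Proof.
move=> e12 q0 Oq f2 t tt.
have Or k : k <= 8 -> roa k 13 by move=> k8; apply: roa_prime => //; lia.
have O9 : oa 9 q by apply: oa_le Oq.
have O5 : oa 5 q by apply: oa_le Oq.
have O4 : oa 4 q by apply: oa_le Oq.
suff H : exists lo hi, rng 13 (24 * e * q * 2) (3 * lo) hi /\ lo <= t <= lo + hi + 4 * e * q.
  case: H => lo [hi [H ht]]; apply: (@fill_rng e q 13 2 lo hi) => //.
  by rewrite muln1.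
move: e12 tt; rewrite !inE => /orP[] /eqP -> tt.
  have [t2|t2] := leqP (12 * q) t.
    exists (12 * q), (84 * q); split; last lia.
    by apply: rng_eq (@mix8 12 q (Or 8 isT) isT O9) => //; lia.
  exists 0, (84 * q); split; last lia.
  by apply: rng_eq (@mix8_0 12 q (Or 8 isT) (availP _) O9) => //; lia.
have R M : P 13 24 M -> rng 13 (24 * 2 * q * 2) (q * M) (12 * (q * 12)).
  move=> HM; have H := rng_mix (Or 4 isT) (rng_flex O5 rng24_4) (P_infl O4 HM).
  by apply: rng_eq H => //; lia.
have [t2|t2] := leqP (48 * q) t.
  exists (48 * q), (144 * q); split; last lia.
  apply: (rngW _ _ _ (R 144 _)); [lia|lia|lia|].
  by apply: (P_inflD oa44) => //; apply: (@X6n 13).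
exists 0, (144 * q); split; last lia.
apply: (rngW _ _ _ (R 0 (availP _))); by [|lia].
Qed.

(** Small t come from [DD_low], large t from [top3] if 3 divides a and otherwise from a master with
    a prime number of groups. *)
Lemma full_big e q a : e \in [:: 1; 2] -> 0 < q -> oa 10 q ->
  20 <= a -> a %% 4 != 0 -> a != 26 -> a != 27 ->
  (forall b, 0 < b < a -> full e q b) -> full e q a.
Proof.
move=> e12 q0 Oq a20 a4 a26 a27 IH t tt.
have e0 : 0 < e by move: e12; rewrite !inE => /orP[] /eqP ->.
have O4 : oa 4 q by apply: oa_le Oq.
have O5 : oa 5 q by apply: oa_le Oq.
have O9 : oa 9 q by apply: oa_le Oq.
have [x [y [aE xy Ox]]] := split_td a20 a4 a26 a27.
have [tl|tl] := leqP t (12 * e * q * x + 4 * e * q * (y - 1)).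
  by rewrite aE; apply: DD_low tl => //; apply: IH; lia.
have [a3|a3] := boolP (a %% 3 == 0).
  have wE : a = 3 * (a %/ 3) by lia.
  rewrite wE; apply: top3 => //; [lia|by apply: IH; lia|].
  rewrite -wE tt andbT; apply: leq_trans (ltnW tl).
  have h : 2 * (a %/ 3) <= 3 * x + (y - 1) by lia.
  have : 4 * e * q * (2 * (a %/ 3)) <= 4 * e * q * (3 * x + (y - 1)) by rewrite leq_mul2l h orbT.
  lia.
have [n [w [aw H]]] := split_mix a20 a4 a3.
have w0 : 0 < w by case: w aw {H} => //; lia.
have w3 : w %% 3 != 0 by apply: contraNneq a3 => w3; rewrite aw -modnMmr w3 muln0.
have n4 : 4 <= n.+1 by case: H => [|[]]; rewrite ?inE; lia.
have Or k : k <= 4 \/ k <= 8 /\ 11 <= n.+1 -> roa k n.+1.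
  case: H => [n57|[pn n11 _ _]] Hk.
    by move: n57; rewrite !inE => /orP[] /eqP nE; apply: roa_prime; rewrite nE // in Hk *; lia.
  by apply: roa_prime => //; lia.
have fw : full e q w by apply: IH; rewrite w0 aw; nia.
(* The master starts no later than [DD_low] ends, since nw < a <= 5x. *)
have t2 : 2 * e * q * (n * w) <= t.
  apply: leq_trans (ltnW tl).
  have h : n * w <= 6 * x by move: aw aE; nia.
  have : 2 * e * q * (n * w) <= 2 * e * q * (6 * x) by rewrite leq_mul2l h orbT.
  by move: (4 * e * q * (y - 1)) => A; lia.
have te : t <= 4 * e * q * (n * w) + 4 * e * q * (w - 1).
  by rewrite -mulnDr; apply: leq_trans tt _; rewrite leq_mul2l aw; apply/orP; right; nia.
have [ew|ew] := boolP ((e * w) %% 4 != 2).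
  have OB : oa 5 (q * (e * w)).
    by apply: oa_mul O5 (oa5P _ ew _); [rewrite muln_gt0 e0|move: e12 w3; rewrite !inE => /orP[] /eqP ->; lia].
  have R := mix4 (Or 4 (or_introl isT)) n4 OB.
  rewrite aw; apply: (@fill_rng e q n.+1 w (2 * e * q * (n * w)) (2 * n * (q * (e * w)))) => //.
    by apply: rng_eq R => //; lia.
  by rewrite t2 /=; apply: leq_trans te _; lia.
(* Here 2 divides ew exactly once, so the scaling factor is k = ew/2 and the base types have twice
   the size. *)
set k := e * w %/ 2.
have kE : e * w = 2 * k by rewrite /k; lia.
have k0 : 0 < k by case: k kE => //; lia.
have K1 : 24 * e * q * w = 24 * q * (e * w) by lia.
have K2 : 2 * e * q * (n * w) = 2 * q * n * (e * w) by lia.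
have K4 : 4 * e * q * (n * w) = 4 * q * n * (e * w) by lia.
rewrite K2 kE in t2; rewrite K4 kE in te.
case: H => [n57|[pn n11 a5 a7]].
  have Ok : oa 5 (q * k).
    by apply: oa_mul O5 (oa5P k0 _ _); rewrite /k; move: e12 w3 ew; rewrite !inE => /orP[] /eqP ->; lia.
  rewrite aw; apply: (@fill_rng e q n.+1 w (2 * n * (q * k)) (6 * n * (q * k))) => //.
    by apply: rng_eq (mix4_12 n57 Ok) => //; rewrite ?K1 ?kE; lia.
  by apply/andP; split; [apply: leq_trans t2; lia|apply: leq_trans te _; lia].
have ka : k %| a.
  have : k %| w.
    rewrite /k; move: e12 ew; rewrite !inE => /orP[] /eqP -> ew; last by rewrite mulKn.
    by apply/dvdnP; exists 2; lia.
  by move=> kw; rewrite aw dvdn_mull.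
have kodd : k %% 2 != 0 by rewrite /k; move: ew; lia.
(* All prime factors of k are at least 11, hence nine columns. *)
have Ok : oa 9 (q * k).
  apply: oa_mul O9 _; apply: oa_primes => // p pp pk.
  have pa : p %| a by apply: dvdn_trans ka.
  have N m : a %% m != 0 -> p != m by apply: contraNneq => <-; rewrite -/(dvdn _ _).
  have p2 : p != 2 by apply: contraNneq kodd => p2; rewrite -/(dvdn _ _) -p2.
  by have := prime_ge11 pp p2 (N 3 a3) (N 5 a5) (N 7 a7); lia.
rewrite aw; apply: (@fill_rng e q n.+1 w (n * (q * k)) (7 * n * (q * k))) => //.
  by apply: rng_eq (mix8 (Or 8 (or_intror (conj isT n11))) n4 Ok) => //; rewrite ?K1 ?kE; lia.
by apply/andP; split; [apply: leq_trans t2; lia|apply: leq_trans te _; lia].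
Qed.

Theorem full_all e q a : e \in [:: 1; 2] -> 0 < q -> oa 10 q -> 0 < a -> full e q a.
Proof.
move=> e12 q0 Oq; elim/ltn_ind: a => a IH a0.
have ec : e \in [:: 1; 2; 4] by move: e12; rewrite !inE => /orP[] /eqP ->.
have ec2 : 2 * e \in [:: 1; 2; 4] by move: e12; rewrite !inE => /orP[] /eqP ->.
have IH' b : 0 < b < a -> full e q b by case/andP=> b0 ba; apply: IH.
have [->|a1] := eqVneq a 1; first by apply: full1 => //; apply: oa_le Oq.
have [a23|a23] := boolP (a \in [:: 2; 3; 5; 7]); first exact: full_base.
have [/eqP a4|a4] := boolP (a %% 4 == 0).
  have -> : a = 4 * (a %/ 4) by lia.
  by apply: full_mul4 => //; [lia|apply: IH'; lia|move=> w3; apply: IH'; lia].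
have [a9|a9] := boolP (a \in [:: 6; 9; 15; 18; 27]).
  move: a9 IH'; rewrite !inE => /or4P[||| /orP[]] /eqP -> IH'.
  - by apply: (full_mul3 e12 q0 Oq (a := 2) (v := 6) (w := 1) _ _ _ _ (rng6 e12)) => //; try (apply: IH'; lia); lia.
  - by apply: (full_mul3 e12 q0 Oq (a := 3) (v := 9) (w := 1) _ _ _ _ (rng9 ec)) => //; try (apply: IH'; lia); lia.
  - by apply: (full_mul3 e12 q0 Oq (a := 5) (v := 5) (w := 3) _ _ _ _ (rng5_3 e12)) => //; try (apply: IH'; lia); lia.
  - by apply: (full_mul3 e12 q0 Oq (a := 6) (v := 9) (w := 2) _ _ _ _ (rng9 ec2)) => //; try (apply: IH'; lia); lia.
  - by apply: (full_mul3 e12 q0 Oq (a := 9) (v := 9) (w := 3) _ _ _ _ (rng9_3 e12)) => //; try (apply: IH'; lia); lia.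
have [a10|a10] := boolP (a \in [:: 10; 14]).
  have f2 : full e q 2 by apply: IH'; move: a10; rewrite !inE; lia.
  move: a10; rewrite !inE => /orP[] /eqP -> t tt.
    by apply: (DD_small (v := 5) (w := 2) _ _ _ Oq (rng5 ec2)) => //; lia.
  by apply: (DD_small (v := 7) (w := 2) _ _ _ Oq (rng7 ec2)) => //; lia.
have [ap|ap] := boolP (a \in [:: 11; 13; 17; 19]).
  case: a ap {IH a0 a1 a23 a4 a9 a10} IH' => // n nn IH'.
  by apply: full_prime => // b b5; apply: IH'; move: nn; rewrite !inE; lia.
have [->|a26] := eqVneq a 26.
  by apply: full_26 => //; apply: full_base.
by apply: full_big IH' => //; move: a23 a9 a10 ap; rewrite !inE; lia.
Qed.

(** * The case m < g *)

Section Small.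
Variables (e q m : nat).
Hypotheses (e12 : e \in [:: 1; 2]) (q0 : 0 < q) (Oq : oa 10 q).
Hypotheses (mg : m < 8 * e * q) (m3 : m = 8 * e * q %[mod 3]).
Hypothesis given : forall v, v \in [:: 6; 9; 12; 15; 18] -> m <= e * q * (v - 1) ->
  P v (2 * e * q) m.

Let O4 : oa 4 q. Proof. exact: oa_le Oq. Qed.
Let O44 : oa 4 (4 * q). Proof. exact: oa_mul oa44 O4. Qed.

(** The group size is g = s * 4w, and each of the four holes is filled, with the m new points, by a
    given design with groups of size s * w = g/4. The choice of s and w follows the available holey
    designs. *)
Lemma small_htd v : v \in [:: 6; 9; 12; 15; 18] -> m <= e * q * (v - 1) -> P v (8 * e * q) m.
Proof.
move=> vi mv; have := given vi mv; move: e12 vi; rewrite !inE => /orP[] /eqP -> vi Hv.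
  rewrite (_ : 8 * 1 * q = q * (4 * 2)); last lia.
  apply: htd_gdd => //; first by move: vi => /or4P[|||/orP[]] /eqP ->.
  by apply: P_eq Hv => //; lia.
have [v6|v6] := eqVneq v 6.
  rewrite (_ : 8 * 2 * q = q * (4 * 4)); last lia.
  by rewrite v6; apply: htd_gdd => //; apply: P_eq Hv => //; lia.
rewrite (_ : 8 * 2 * q = 4 * q * (4 * 1)); last lia.
apply: htd_gdd => //; last by apply: P_eq Hv => //; lia.
  by move: vi v6 => /or4P[|||/orP[]] /eqP ->.
by rewrite muln_gt0.
Qed.

(** For v >= 9 the bound (g/4)(v - 1)/2 is at least g, so m < g satisfies it. *)
Lemma small_big v : 9 <= v -> v \in [:: 9; 12; 15; 18] -> P v (8 * e * q) m.
Proof.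
move=> v9 vi; apply: small_htd; first by rewrite inE vi orbT.
apply: leq_trans (ltnW mg) _; rewrite (_ : 8 * e * q = e * q * 8) ?leq_mul2l; last lia.
by apply/orP; right; lia.
Qed.

Lemma small_k v u : (v, u) \in [:: (12, 21); (9, 27)] -> P u (8 * e * q) m.
Proof.
move=> vu; have vi : v \in [:: 6; 9; 12; 15; 18].
  by move: vu; rewrite !inE => /orP[] /eqP [-> _].
have Hv : P v (2 * e * q) m.
  apply: given => //; apply: leq_trans (ltnW mg) _.
  rewrite (_ : 8 * e * q = e * q * 8) ?leq_mul2l; last lia.
  by apply/orP; right; move: vu; rewrite !inE => /orP[] /eqP [-> _].
have [s [w [w12 s0 Os E1 E2]]] : exists s w, [/\ w \in [:: 1; 2], 0 < s, oa 4 s,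
   2 * e * q = s * w & 8 * e * q = s * (4 * w)].
  move: e12; rewrite !inE => /orP[] /eqP ->.
    by exists q, 2; split=> //; lia.
  by exists (4 * q), 1; split=> //; lia.
rewrite E1 in Hv; rewrite E2; move: vu Hv; rewrite !inE => /orP[] /eqP [-> ->] Hv.
  exact: k21_gdd.
exact: k27_gdd.
Qed.

(** The given designs for v = 6 end at 5eq; between 5eq and 8eq tabulated designs of type (8e)^6 are
    scaled by q. *)
Lemma small6 : P 6 (8 * e * q) m.
Proof.
have [m5|m5] := leqP m (e * q * 5); first exact: small_htd.
have H : rng 6 (8 * e) (5 * e) e by move: e12; rewrite !inE => /orP[] /eqP ->; apply: rng_avail.
have O7 : oa 7 q by apply: oa_le Oq.
move: (rng_flex O7 H) => /(_ ((m - e * q * 5) %/ 3)) K.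
by apply: P_eq (K _) => //; lia.
Qed.

(** The generic step is a = 4x + y with x >= 2 and y = 0 or y >= 2. The value y = 1 is excluded,
    since in type g^3 m^1 every block meets all four groups, which forces m = g. This leaves 7, 9,
    13 and 17 as separate cases. *)
Lemma small_all a : 2 <= a -> P (3 * a) (8 * e * q) m.
Proof.
elim/ltn_ind: a => a IH a2.
have O8 : oa 4 (8 * e * q).
  by apply: oa_mul O4; apply: oa4P; move: e12; rewrite !inE => /orP[] /eqP ->.
have [->|a_2] := eqVneq a 2; first exact: small6.
have [a6|a6] := boolP (a \in [:: 3; 4; 5; 6]).
  by apply: small_big; move: a6; rewrite !inE; lia.
have [->|a7] := eqVneq a 7; first exact: (@small_k 12).
have [->|a9] := eqVneq a 9; first exact: (@small_k 9).
(* For 13 = 5 * 2 + 3 and 17 = 7 * 2 + 3: type 6^v 9^1 is scaled by g and its groups are filled by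
   the cases a = 2 and a = 3. *)
have sp v : P v 6 9 -> a = v * 2 + 3 -> P (3 * a) (8 * e * q) m.
  move=> Hv aE; have := @fillv v (8 * e * q) 6 9 0 m.
  rewrite add0n => H; apply: (@P_eq (v * 6 + 9) (8 * e * q) m) => //; first lia.
  apply: H.
  - by rewrite gdd_rcons0; apply: P_infl.
  - by apply: (IH 2); lia.
  - by apply: (IH 3) => //; move: a6; rewrite !inE; lia.
have [a13|a13] := eqVneq a 13; first by apply: (sp 5) => //; exact: availP.
have [a17|a17] := eqVneq a 17; first by apply: (sp 7) => //; exact: availP.
have t x y : a = 4 * x + y -> 2 <= x -> y = 0 \/ 2 <= y ->
   (3 * y <= 4 * x) || (x %% 3 != 0) && (2 * y <= 3 * x) -> P (3 * a) (8 * e * q) m.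
  move=> aE x2 y2 xy; rewrite aE; apply: four_one => //; [lia|by apply: IH; lia|].
  by case: y2 => [->|y2]; [apply: P0|apply: IH; lia].
have [a14|a14] := leqP 14 a; first by apply: (t ((a - 2) %/ 4) (a - 4 * ((a - 2) %/ 4))); lia.
have : a \in [:: 8; 10; 11; 12] by move: a6; rewrite !inE; lia.
by rewrite !inE => /or4P[] /eqP aE; [apply: (t 2 0)|apply: (t 2 2)|apply: (t 2 3)|apply: (t 3 0)];
  rewrite ?aE //; lia.
Qed.
End Small.

Theorem theorem3p7 (h q : nat) :
  h \in [:: 8; 16] -> 0 < q -> ~~ (3 %| q) ->
  GDD_exists (pred1 10) (nseq 10 q) ->
  (forall v d, v \in [:: 6; 9; 12; 15; 18] ->
     0 < d -> d <= h * q - 3 -> d = (h * q) %/ 4 %[mod 3] ->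
     d * 2 <= ((h * q) %/ 4) * (v - 1) ->
     GDD_exists (pred1 4) (nseq v ((h * q) %/ 4) ++ [:: d])) ->
  forall u m, 6 <= u -> 1 <= m -> u %% 3 = 0 -> m = h * q %[mod 3] ->
    m * 2 <= (h * q) * (u - 1) ->
    GDD_exists (pred1 4) (nseq u (h * q) ++ [:: m]).
Proof.
move=> h8 q0 _ /(@oa_of_GDD 10 q isT) Oq given u m u6 m1 u3 m3 mu.
have [e [e12 hE]] : exists e, e \in [:: 1; 2] /\ h = 8 * e.
  by move: h8; rewrite !inE => /orP[] /eqP ->; [exists 1|exists 2].
have e0 : 0 < e by move: e12; rewrite !inE => /orP[] /eqP ->.
have uE : u = 3 * (u %/ 3) by lia.
move: (u %/ 3) uE => a uE; subst u h.
have g4 : 8 * e * q %/ 4 = 2 * e * q by rewrite (_ : 8 * e * q = 2 * e * q * 4) ?mulnK //; lia.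
apply: GDD_of_gdd.
- by rewrite cats1 all_rcons m1 all_nseq !muln_gt0 e0 q0 orbT.
- by rewrite size_cat size_nseq /=; lia.
rewrite cats1 -/(P _ _ _); have [mg|gm] := leqP (8 * e * q) m.
  have tE : m = 8 * e * q + 3 * ((m - 8 * e * q) %/ 3) by lia.
  rewrite {}tE; apply: full_all => //; first lia.
  move: mg mu; rewrite -!(mulnA _ e q); move: (e * q) => c mg mu.
  (* Here c = eq and g(u - 1) = 8c(3a - 1) = 24c(a - 1) + 16c, so that m - 8c <= 12c(a - 1). *)
  have : 2 * m <= 24 * c * (a - 1) + 16 * c by nia.
  have : m - 8 * c <= 12 * c * (a - 1) -> (m - 8 * c) %/ 3 <= 4 * c * (a - 1) by lia.
  by move=> K L; apply: K; lia.
apply: small_all => //; last lia.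
move=> v vi mv; apply: gdd_of_GDD.
have := given v m vi m1; rewrite g4 cats1; apply; first lia.
  by rewrite m3; lia.
by rewrite (_ : 2 * e * q * (v - 1) = e * q * (v - 1) * 2) ?leq_mul2r ?mv ?orbT //; lia.
Qed.
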